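(* Let $q\ge2$ and $2829\le K\le L\le M$ be integers. Under either open or periodic boundary conditions the following hold. (1) (Transition time) For all distinct $\mathbf{s},\mathbf{s}'\in\mathcal{S}$ and all $\epsilon>0$, $$\lim_{\beta\to\infty}\mathbb{P}_{\mathbf{s}}^{\beta}\big[e^{\beta(\Gamma-\epsilon)}<\tau_{\breve{\mathbf{s}}}\le\tau_{\mathbf{s}'}<e^{\beta(\Gamma+\epsilon)}\big]=1,$$ $$\lim_{\beta\to\infty}\frac1\beta\log\mathbb{E}_{\mathbf{s}}^{\beta}[\tau_{\breve{\mathbf{s}}}]=\lim_{\beta\to\infty}\frac1\beta\log\mathbb{E}_{\mathbf{s}}^{\beta}[\tau_{\mathbf{s}'}]=\Gamma .$$ Moreover, under $\mathbb{P}_{\mathbf{s}}^{\beta}$, as $\beta\to\infty$, each of $\tau_{\breve{\mathbf{s}}}/\mathbb{E}_{\mathbf{s}}^{\beta}[\tau_{\breve{\mathbf{s}}}]$ and $\tau_{\mathbf{s}'}/\mathbb{E}_{\mathbf{s}}^{\beta}[\tau_{\mathbf{s}'}]$ converges in distribution to an exponential random variable with mean $1$. (2) (Mixing time) For all $\epsilon\in(0,1/2)$, $\lim_{\beta\to\infty}\frac1\beta\log t_\beta^{\mathrm{mix}}(\epsilon)=\Gamma$. (3) (Spectral gap) There exist constants $0<c_1\le c_2$ (independent of $\beta$) such that $c_1e^{-\beta\Gamma}\le\lambda_\beta\le c_2e^{-\beta\Gamma}$.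
   Context: $\Lambda=\{1,\dots,K\}\times\{1,\dots,L\}\times\{1,\dots,M\}$, with open or periodic boundary conditions (periodic: $\Lambda=\mathbb{T}_K\times\mathbb{T}_L\times\mathbb{T}_M$, $\mathbb{T}_N=\mathbb{Z}/N\mathbb{Z}$); $x\sim y$ denotes nearest neighbours. $S=\{1,\dots,q\}$, $\mathcal{X}=S^\Lambda$, $H(\sigma)=\sum_{\{x,y\}\subseteq\Lambda:x\sim y}\mathbf{1}\{\sigma(x)\ne\sigma(y)\}$. For $\beta>0$, $\mu_\beta(\sigma)=Z_\beta^{-1}e^{-\beta H(\sigma)}$ with $Z_\beta=\sum_{\zeta}e^{-\beta H(\zeta)}$. $\mathbf{s}_a$ is the configuration with all spins equal to $a$; $\mathcal{S}=\{\mathbf{s}_1,\dots,\mathbf{s}_q\}$; for $\mathbf{s}\in\mathcal{S}$, $\breve{\mathbf{s}}=\mathcal{S}\setminus\{\mathbf{s}\}$. Dynamics: $\sigma^{x,a}$ is $\sigma$ with the spin at $x$ replaced by $a$. $\{\sigma_\beta(t)\}_{t\ge0}$ is the continuous-time Markov chain on $\mathcal{X}$ with rates $r_\beta(\sigma,\zeta)=e^{-\beta\max\{H(\zeta)-H(\sigma),0\}}$ if $\zeta=\sigma^{x,a}\ne\sigma$ for some $x\in\Lambda,a\in S$, and $r_\beta(\sigma,\zeta)=0$ otherwise; it is irreducible and reversible with respect to $\mu_\beta$. $\mathbb{P}_\sigma^\beta,\mathbb{E}_\sigma^\beta$ are the law and expectation of this process started at $\sigma$. $\tau_{\mathcal{A}}=\inf\{t\ge0:\sigma_\beta(t)\in\mathcal{A}\}$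 and $\tau_\sigma=\tau_{\{\sigma\}}$. The mixing time is $t_\beta^{\mathrm{mix}}(\epsilon)=\min\{t\ge0:\max_{\sigma\in\mathcal{X}}\|\mathbb{P}_\sigma^\beta[\sigma_\beta(t)\in\cdot]-\mu_\beta\|_{\mathrm{TV}}\le\epsilon\}$, where $\|\cdot\|_{\mathrm{TV}}$ is total variation distance, and $\lambda_\beta$ is the spectral gap of the dynamics. Energy barrier: $\sigma\sim\zeta$ means that $\sigma,\zeta$ differ at exactly one site; a path is a sequence $(\omega_t)_{t=0}^T$ with $\omega_t\sim\omega_{t+1}$; $\Phi(\sigma,\zeta)$ is the minimum over paths connecting $\sigma$ and $\zeta$ of $\max_tH(\omega_t)$; $\Gamma=\Phi(\mathbf{s},\mathbf{s}')$ for any distinct $\mathbf{s},\mathbf{s}'\in\mathcal{S}$. One has $\Gamma=2KL+2K+2$ (periodic) and $\Gamma=KL+K+1$ (open). *)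

(* Defs.v *)
From HB Require Import structures.
From mathcomp Require Import all_boot all_order all_algebra.
From mathcomp Require Import all_classical all_reals all_analysis.

Set Implicit Arguments.
Unset Strict Implicit.
Unset Printing Implicit Defensive.

Import Order.TTheory GRing.Theory Num.Theory.
Import numFieldNormedType.Exports.

Local Open Scope classical_set_scope.
Local Open Scope ring_scope.

(** * Continuous-time Markov chains on a finite state space *)

Section Ctmc.
Context {R : realType} {S : finType}.

(* Jump rates [r x y] are only meaningful for [x != y]. *)
Definition generator (r : S -> S -> R) (x y : S) : R :=
  if x == y then - \sum_(z | z != x) r x z else r x y.

Definition generator_mx (r : S -> S -> R) : 'M[R]_#|S| :=
  \matrix_(i, j) generator r (enum_val i) (enum_val j).

(* The (x, y) entry of the matrix exponential exp(t Q), Q = generator_mx r. *)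
Definition transition (r : S -> S -> R) (t : R) (x y : S) : R :=
  limn (series (fun n : nat =>
    t ^+ n / n`!%:R * (generator_mx r ^+ n) (enum_rank x) (enum_rank y))).

(* Probability of visiting the states of [s] at the respective times of [s],
   starting from [x] at time [t]. *)
Fixpoint fdd (r : S -> S -> R) (t : R) (x : S) (s : seq (R * S)) : R :=
  if s is (u, y) :: s' then transition r (u - t) x y * fdd r u y s' else 1.

(* [X] is, under [P], a Markov jump process with rates [r] started at [x0]:
   the paths are right-continuous for the discrete topology on [S] and the
   finite-dimensional distributions are those of the semigroup exp(t Q).
   Only the times t >= 0 are relevant. Taking a single time 0 in [ctmc_fdd]
   gives X 0 = x0 almost surely. *)
Record is_ctmc (d : measure_display) (Omega : measurableType d)
    (P : probability Omega R) (X : R -> Omega -> S) (r : S -> S -> R)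
    (x0 : S) : Prop := {
  ctmc_measurable : forall t x, 0 <= t -> measurable [set w | X t w = x];
  ctmc_right_continuous : forall w t, 0 <= t ->
    \forall u \near t^'+, X u w = X t w;
  ctmc_fdd : forall s : seq (R * S),
    path (fun u v : R => u <= v) 0 (map fst s) ->
    P [set w | forall p, p \in s -> X p.1 w = p.2] = (fdd r 0 x0 s)%:E }.

(* +oo when [A] is never visited *)
Definition hitting_time (Omega : Type) (X : R -> Omega -> S) (A : {set S})
    (w : Omega) : \bar R :=
  ereal_inf [set t%:E | t in [set t : R | 0 <= t /\ X t w \in A]].

Definition tv_dist (p m : S -> R) : R :=
  \big[Num.max/0]_(A : {set S}) `|\sum_(a in A) p a - \sum_(a in A) m a|.

(* [law x t] is the law at time [t] of the chain started at [x]. *)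
Definition mixing_time (law : S -> R -> S -> R) (m : S -> R) (eps : R) : R :=
  inf [set t : R |
    0 <= t /\ \big[Num.max/0]_(x : S) tv_dist (law x t) m <= eps].

(* For irreducible reversible rates, 0 is a simple eigenvalue of the negated
   generator and the other eigenvalues are real and positive. *)
Definition spectral_gap (r : S -> S -> R) : R :=
  inf [set l : R | l != 0 /\ eigenvalue (- generator_mx r) l].

End Ctmc.

(* Convergence in distribution, as b --> +oo, of the extended-real random
   variables [Y b] (each on its own probability space) to the law [nu]:
   convergence of the distribution functions at the continuity points of the
   limit. *)
Definition cvg_in_distribution {R : realType} (d : measure_display)
    (Omega : R -> measurableType d) (P : forall b, probability (Omega b) R)
    (Y : forall b, Omega b -> \bar R)
    (nu : set R -> \bar R) : Prop :=
  forall t : R, {for t, continuous (fun u : R => fine (nu `]-oo, u]%classic))} ->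
    P b [set w | (Y b w <= t%:E)%E] @[b --> +oo] --> nu `]-oo, t]%classic.

(** * The Potts model on a three-dimensional box *)

Inductive boundary := Open | Periodic.

(* Coordinates are numbered from 0. *)
Definition site (K L M : nat) : finType := ('I_K * 'I_L * 'I_M)%type.

Definition adjacent (bc : boundary) (N : nat) (i j : 'I_N) : bool :=
  match bc with
  | Open => (i.+1 == j :> nat) || (j.+1 == i :> nat)
  | Periodic => (i.+1 %% N == j :> nat)%N || (j.+1 %% N == i :> nat)%N
  end.

Definition nearest_neighbours (bc : boundary) (K L M : nat)
    (x y : site K L M) : bool :=
  [|| [&& adjacent bc x.1.1 y.1.1, x.1.2 == y.1.2 & x.2 == y.2],
      [&& x.1.1 == y.1.1, adjacent bc x.1.2 y.1.2 & x.2 == y.2]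
    | [&& x.1.1 == y.1.1, x.1.2 == y.1.2 & adjacent bc x.2 y.2]].

Definition config (K L M q : nat) : finType := {ffun site K L M -> 'I_q}.

Section Potts.
Context {R : realType} (bc : boundary) (K L M q : nat).
Local Notation site := (site K L M).
Local Notation config := (config K L M q).

(* Number of unordered pairs of neighbours with different spins. *)
Definition hamiltonian (s : config) : nat :=
  #|[set e : {set site} | [exists x, exists y,
      [&& e == [set x; y]%SET, nearest_neighbours bc x y & s x != s y]]]%SET|.

Definition gibbs (beta : R) (s : config) : R :=
  expR (- beta * (hamiltonian s)%:R) /
  \sum_(z : config) expR (- beta * (hamiltonian z)%:R).

Definition monochromatic (a : 'I_q) : config := [ffun=> a].

Definition ground_states : {set config} := [set monochromatic a | a : 'I_q]%SET.

Definition other_ground_states (s : config) : {set config} :=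
  (ground_states :\ s)%SET.

Definition update (s : config) (x : site) (a : 'I_q) : config :=
  [ffun y => if y == x then a else s y].

Definition metropolis_rate (beta : R) (s z : config) : R :=
  if [exists x, exists a, (z == update s x a) && (z != s)]
  then expR (- beta * Num.max ((hamiltonian z)%:R - (hamiltonian s)%:R) 0)
  else 0.

Definition differ_at_one_site (s z : config) : bool :=
  #|[set x | s x != z x]%SET| == 1%N.

(* A set of natural numbers embedded in R, so that the infimum is attained. *)
Definition communication_height (s z : config) : R :=
  inf [set h | exists p : seq config,
    [/\ path differ_at_one_site s p, last s p = z
      & h = (\max_(w <- s :: p) hamiltonian w)%:R]].

End Potts.

(* Main.v *)
Require Import Defs.
From HB Require Import structures.
From mathcomp Require Import all_boot all_order all_algebra fingroup perm.
From mathcomp Require Import all_classical all_reals all_analysis measurable_realfun.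
From mathcomp Require Import ring lra zify.

Set Implicit Arguments.
Unset Strict Implicit.
Unset Printing Implicit Defensive.

Import Order.TTheory GRing.Theory Num.Theory.
Import numFieldNormedType.Exports.

Local Open Scope classical_set_scope.
Local Open Scope ring_scope.

(* Idea.  Let A be a set of ground states, B the other ground states and b in B.
   The equilibrium potential h (h = 1 on B, h = 0 on A, harmonic elsewhere)
   satisfies L h = - kappa 1_B >= - kappa h off A, where by the permutation
   symmetry of the spins the escape rate kappa does not depend on the point of B;
   hence P_b(tau_A > t) >= exp(- kappa t) exactly.  Reversibility gives
   kappa E_b(tau_A) = mu(h) / mu(B), which lies between 1 and 1 + O(exp(- beta)).
   Since the tail is monotone, above exp(- kappa t), and has almost the same
   integral, tau_A / E_b(tau_A) is asymptotically exponential.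

   The rate kappa is a capacity: the indicator of the valley of B (points reachable
   from B below Gamma) bounds it from above, and a path of height Gamma from B to A
   bounds it from below, so that kappa is comparable to exp(- beta Gamma).

   Laying a path omega between ground states over a configuration sigma costs at
   most H(sigma) + H(omega), so any two configurations sigma, zeta communicate at
   height H(sigma) + H(zeta) + Gamma.  This yields a Poincare inequality with
   constant of order exp(- beta Gamma), hence the bounds on the gap and the mixing
   time; mixing before time exp(beta (Gamma - eta)) is excluded by the
   slowness of tau_A.

   The semigroup exp(t Q) enters only through its first order expansion in t, all
   statements about positive times being obtained by splitting [0, t] into small
   steps. *)

(** * First order expansion of the semigroup *)

(** Two pairs of targets occur: [A] is all the other ground states and [B] the starting point alone,
    or [A] is one ground state and [B] all the rest. In both, every ground state lies in [A] or [B],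
    so the mass of [h] outside [B] sits on configurations of energy at least 1; hence the relative
    error N exp(- beta) in the mean, with N the number of configurations.

    The obstacle is the passage from matrices to paths. That exp(t Q) is stochastic and
    multiplicative is read off from the processes, one for each starting point. On a grid of step dt
    each step costs an error C dt^2, so t / dt steps cost C t dt, which vanishes; right continuity
    carries the grid estimates over to hitting times. [Gamma] enters through two facts: distinct
    ground states are joined at height G, and separated strictly below it. Powers of N are absorbed
    by exp(beta eta) as beta grows. *)

Section TransitionExpansion.
Context {R : realType} {S : finType}.
Implicit Types (r : S -> S -> R).

(** The sum of the absolute values of all entries is a crude submultiplicative norm that dominates
    every entry. *)
Lemma abs_expmx_le (n : nat) (M : 'M[R]_n) (k : nat) (i j : 'I_n) :
  `|(M ^+ k) i j| <= (\sum_a \sum_b `|M a b|) ^+ k.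
Proof.
elim: k i j => [|k IH] i j.
  by rewrite !expr0 mxE; case: (i == j); rewrite ?normr1 ?normr0 ?ler01.
rewrite !exprS mxE (le_trans (ler_norm_sum _ _ _))//.
rewrite (le_trans (y := \sum_a `|M i a| * (\sum_a \sum_b `|M a b|) ^+ k))//.
  by apply: ler_sum => a _; rewrite normrM ler_wpM2l.
rewrite -mulr_suml ler_wpM2r//; first by rewrite exprn_ge0// !sumr_ge0 => // *; rewrite sumr_ge0.
rewrite [leRHS](bigD1 i)//= lerDl sumr_ge0// => a _; exact: sumr_ge0.
Qed.

Lemma is_cvg_transition r (t : R) (x y : S) :
  cvgn (series (fun n : nat =>
    t ^+ n / n`!%:R * (generator_mx r ^+ n) (enum_rank x) (enum_rank y))).
Proof.
set M := generator_mx r; set c := \sum_a \sum_b `|M a b|.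
apply: normed_cvg.
apply: (@series_le_cvg _ _ (exp_coeff (`|t| * c))) => [n|n|n|] /=.
- exact: normr_ge0.
- by rewrite /exp_coeff/= exp_coeff_ge0// mulr_ge0// sumr_ge0// => *; rewrite sumr_ge0.
- rewrite /exp_coeff/= !normrM normrX exprMn normfV [`|n`!%:R|]ger0_norm//.
  by rewrite mulrAC ler_wpM2r ?invr_ge0// ler_wpM2l ?exprn_ge0// abs_expmx_le.
- exact: is_cvg_series_exp_coeff.
Qed.

(** For t <= 1 each term of order at least two carries a factor at most t^2, and what remains is
    dominated by the series of exp(c). *)
Lemma transition_first_order r : exists2 C : R, 0 <= C &
  forall (t : R) (x y : S), 0 <= t <= 1 ->
  `|transition r t x y - ((x == y)%:R + t * generator r x y)| <= C * t ^+ 2.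
Proof.
set M := generator_mx r; set c := \sum_a \sum_b `|M a b|.
have c0 : 0 <= c by rewrite sumr_ge0// => *; rewrite sumr_ge0.
exists (expR c) => [|t x y /andP[t0 t1]]; first exact: expR_ge0.
set u := fun n : nat => t ^+ n / n`!%:R * (M ^+ n) (enum_rank x) (enum_rank y).
have Cu : cvgn (series u) by exact: is_cvg_transition.
set v := (X in _ - X).
have -> : transition r t x y - v = limn (fun n => series u n - v).
  by rewrite limB//; [rewrite lim_cst|exact: is_cvg_cst].
have Cv : cvgn (fun n => series u n - v) by apply: is_cvgB => //; exact: is_cvg_cst.
rewrite -lim_norm//; apply: limr_le; first exact: is_cvg_norm.
near=> n.
have [m ->] : exists m, n = m.+2.
  by exists n.-2; near: n; exists 2 => //= -[|[|]].
rewrite /series/= big_nat_recl// big_nat_recl//.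
rewrite {1 2}/u !expr0 expr1 !divr1 mul1r !mxE !enum_rankK (inj_eq enum_rank_inj).
rewrite addrA [X in `|X|]addrAC subrr add0r.
rewrite (le_trans (ler_norm_sum _ _ _))//.
rewrite (le_trans (y := \sum_(0 <= i < m) t ^+ 2 * exp_coeff c i.+2))//.
  apply: ler_sum => i _; have -> : exp_coeff c i.+2 = c ^+ i.+2 / i.+2`!%:R by [].
  rewrite /u normrM normrM normrX normfV.
  rewrite (ger0_norm t0) [`|_%:R|]ger0_norm// -addn2 exprD -mulrA -mulrA mulrCA.
  rewrite ler_wpM2l ?exprn_ge0// -[leRHS]mul1r ler_pM ?exprn_ge0//.
  - by rewrite exprn_ile1.
  - by rewrite mulrC ler_wpM2r// ?invr_ge0// addn2 abs_expmx_le.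
rewrite -mulr_sumr mulrC ler_wpM2r ?exprn_ge0//.
rewrite (le_trans (y := series (exp_coeff c) m.+2))//.
  rewrite /series/= [leRHS]big_nat_recl// big_nat_recl// addrA lerDr.
  by rewrite addr_ge0 ?exp_coeff_ge0.
rewrite /expR; apply: nondecreasing_cvgn_le.
  by apply/nondecreasing_seqP => k; rewrite !seriesEnat/= big_nat_recr//= lerDl exp_coeff_ge0.
exact: is_cvg_series_exp_coeff.
Unshelve. all: by end_near. Qed.

End TransitionExpansion.

(** * Taboo probabilities *)

Section FiniteValued.
Context {R : realType} {S : finType} (d : measure_display)
  (Omega : measurableType d) (P : probability Omega R).

Lemma measure_partition (Y : Omega -> S) (E : set Omega) :
  measurable E -> (forall y, measurable [set w | Y w = y]) ->
  P E = (\sum_y P (E `&` [set w | Y w = y]))%E.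
Proof.
move=> mE mY.
rewrite (reindex (@enum_val S predT)); last exact/onW_bij/enum_val_bij.
rewrite -measure_bigsetU_ord.
- congr (P _); rewrite -bigcup_seq predeqE => w; split=> [Ew|[i _ []]//].
  exists (enum_rank (Y w)); first by rewrite /= mem_index_enum.
  by split => //=; rewrite /= enum_rankK.
- by move=> i; exact: measurableI.
- move=> i j _ _ [w [[_ /= ei] [_ /= ej]]].
  by apply: enum_val_inj; rewrite -ei -ej.
Qed.

Lemma measure_partition_cond (Y : Omega -> S) (p : pred S) (E : set Omega) :
  measurable E -> (forall y, measurable [set w | Y w = y]) ->
  P (E `&` [set w | p (Y w)]) = (\sum_(y | p y) P (E `&` [set w | Y w = y]))%E.
Proof.
move=> mE mY.
have mp : measurable [set w | p (Y w)].
  rewrite (_ : [set w | _] = \bigcup_(y in [set y | p y]) [set w | Y w = y]).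
    by apply: fin_bigcup_measurable => // y _; exact: mY.
  by rewrite predeqE => w; split => [pY|[y /= py ->]//]; exists (Y w).
rewrite (@measure_partition Y)//; last exact: measurableI.
rewrite [RHS]big_mkcond/=; apply: eq_bigr => y _.
case: ifPn => py.
  congr (P _); rewrite predeqE => w /=; split=> [[[? ?] ?]//|[Ew e]].
  by rewrite e.
rewrite (_ : _ `&` _ = set0) ?measure0// -subset0 => w /= [[_ pY] e].
by move: py; rewrite -e pY.
Qed.

End FiniteValued.

Section TabooProbabilities.
Context {R : realType} {S : finType}.
Implicit Types (r : S -> S -> R) (A : {set S}).

(** The sum of [fdd] over the trajectories that avoid [A] at the times [ts]; [prob_prefix_avoid]
    identifies it with a probability. *)
Fixpoint taboo r A (t : R) (x : S) (ts : seq R) : R :=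
  if ts is u :: ts' then
    \sum_(y | y \notin A) transition r (u - t) x y * taboo r A u y ts'
  else 1.

(** [fdd] unfolds from the start, whereas the induction in [prob_prefix_avoid] prescribes one more
    state at the end. *)
Lemma fdd_rcons r (t : R) (x : S) (s : seq (R * S)) (p : R * S) :
  fdd r t x (rcons s p) =
  fdd r t x s * transition r (p.1 - (last (t, x) s).1) (last (t, x) s).2 p.2.
Proof.
elim: s t x => [|[u y] s IH] t x /=; first by case: p => u y /=; rewrite mulr1 mul1r.
by rewrite IH mulrA; case: s {IH}.
Qed.

Context (d : measure_display) (Omega : measurableType d)
  (P : probability Omega R) (X : R -> Omega -> S) (r : S -> S -> R) (x0 : S).
Hypothesis HX : is_ctmc P X r x0.

Lemma measurable_prefix (s : seq (R * S)) :
  (forall p, p \in s -> 0 <= p.1) ->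
  measurable [set w | forall p, p \in s -> X p.1 w = p.2].
Proof.
elim: s => [|q s IH] h.
  by rewrite (_ : [set _ | _] = setT)//; rewrite predeqE.
rewrite (_ : [set _ | _] = [set w | X q.1 w = q.2] `&`
    [set w | forall p, p \in s -> X p.1 w = p.2]); last first.
  rewrite predeqE => w; split=> [H|[H1 H2] p /=].
    by split => [|p ps] /=; apply: H; rewrite inE ?eqxx// ps orbT.
  by rewrite inE => /predU1P[->|/H2].
apply: measurableI.
  by apply: (ctmc_measurable HX); apply: h; rewrite inE eqxx.
by apply: IH => p ps; apply: h; rewrite inE ps orbT.
Qed.

Lemma measurable_avoid A (ts : seq R) : (forall u, u \in ts -> 0 <= u) ->
  measurable [set w | forall u, u \in ts -> X u w \notin A].
Proof.
elim: ts => [|u ts IH] h.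
  by rewrite (_ : [set _ | _] = setT)//; rewrite predeqE.
rewrite (_ : [set _ | _] = \bigcup_(y in [set y | y \notin A]) [set w | X u w = y] `&`
    [set w | forall v, v \in ts -> X v w \notin A]); last first.
  rewrite predeqE => w; split=> [H|[[y /= yA e] H2] v /=].
    split => [|v vts] /=; last by apply: H; rewrite inE vts orbT.
    by exists (X u w) => //=; apply: H; rewrite inE eqxx.
  by rewrite inE => /predU1P[->|/H2//]; rewrite e.
apply: measurableI.
  apply: fin_bigcup_measurable => // y _.
  by apply: (ctmc_measurable HX); apply: h; rewrite inE eqxx.
by apply: IH => v vs; apply: h; rewrite inE vs orbT.
Qed.

(** Induction on the avoided times with an arbitrary prefix [s]: the event is cut according to the
    state at the next time [u], and that state joins the prefix; when no avoided time is left,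
    [ctmc_fdd] applies. *)
Lemma prob_prefix_avoid A (s : seq (R * S)) (ts : seq R) :
  path (fun u v : R => u <= v) 0 (map fst s ++ ts) ->
  P [set w | (forall p, p \in s -> X p.1 w = p.2) /\
             (forall u, u \in ts -> X u w \notin A)] =
  (fdd r 0 x0 s * taboo r A (last (0, x0) s).1 (last (0, x0) s).2 ts)%:E.
Proof.
elim: ts s => [|u ts IH] s.
  rewrite cats0 => ps; rewrite /= mulr1 -(ctmc_fdd HX ps).
  by congr (P _); rewrite predeqE => w; split => [[]|].
move=> ps.
have pos v : v \in map fst s ++ u :: ts -> 0 <= v.
  by move: ps; rewrite (path_sortedE le_trans) => /andP[/allP + _]; apply.
have u0 : 0 <= u by apply: pos; rewrite mem_cat inE eqxx orbT.
set E := [set w | (forall p, p \in s -> X p.1 w = p.2) /\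
             (forall u, u \in ts -> X u w \notin A)].
have mE : measurable E.
  apply: measurableI.
    by apply: measurable_prefix => p p_s; apply: pos; rewrite mem_cat map_f.
  by apply: measurable_avoid => v vts; apply: pos; rewrite mem_cat inE vts !orbT.
rewrite (_ : [set _ | _] = E `&` [set w | X u w \notin A]); last first.
  rewrite predeqE => w; split=> /= [[H1 H2]|[[H1 H2] H3]].
    split=> [|//=]; last by apply: H2; rewrite inE eqxx.
    by split=> // v vs; apply: H2; rewrite inE vs orbT.
  by split=> // v; rewrite inE => /predU1P[->|/H2].
rewrite (measure_partition_cond P (Y := X u) (fun y => y \notin A))//; last first.
  by move=> y; exact: (ctmc_measurable HX).
rewrite (eq_bigr (fun y => (fdd r 0 x0 (rcons s (u, y)) * taboo r A u y ts)%:E)).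
  rewrite sumEFin; congr (_ %:E); rewrite mulr_sumr; apply: eq_bigr => y _.
  by rewrite fdd_rcons /= mulrA.
move=> y yA; rewrite (_ : E `&` _ = [set w |
    (forall p, p \in rcons s (u, y) -> X p.1 w = p.2) /\
             (forall u, u \in ts -> X u w \notin A)]); last first.
  rewrite predeqE => w; split=> /= [[[H1 H2] H3]|[H1 H2]].
    by split=> // p; rewrite mem_rcons inE => /predU1P[->|/H1].
  split; last by apply: (H1 (u, y)); rewrite mem_rcons inE eqxx.
  by split=> // p p_s; apply: H1; rewrite mem_rcons inE p_s orbT.
by rewrite IH ?last_rcons// map_rcons cat_rcons.
Qed.

Lemma prob_at (t : R) (y : S) : 0 <= t ->
  P [set w | X t w = y] = (transition r t x0 y)%:E.
Proof.
move=> t0; have := ctmc_fdd HX (s := [:: (t, y)]).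
rewrite /= andbT t0 subr0 mulr1 => <-//.
congr (P _); rewrite predeqE => w; split=> /= [e p|H]; last by apply: (H (t, y)); rewrite inE.
by rewrite inE => /eqP ->.
Qed.

Lemma measurable_at_in (t : R) (p : pred S) : 0 <= t -> measurable [set w | p (X t w)].
Proof.
move=> t0; rewrite (_ : [set w | _] = \bigcup_(y in [set y | p y]) [set w | X t w = y]).
  by apply: fin_bigcup_measurable => // y _; exact: (ctmc_measurable HX).
by rewrite predeqE => w; split => [pX|[y /= py ->]//]; exists (X t w).
Qed.

Lemma prob_at_in (t : R) (p : pred S) : 0 <= t ->
  P [set w | p (X t w)] = (\sum_(y | p y) transition r t x0 y)%:E.
Proof.
move=> t0; rewrite -[X in P X]setTI.
rewrite (measure_partition_cond P (Y := X t) p)//; last first.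
  by move=> y; exact: (ctmc_measurable HX).
by rewrite -sumEFin; apply: eq_bigr => y _; rewrite setTI prob_at.
Qed.

(** Positivity of the entries of exp(t Q) is taken from the process, whose probabilities they are;
    the next two lemmas follow the same principle. *)
Lemma start_transition_ge0 (t : R) (y : S) : 0 <= t -> 0 <= transition r t x0 y.
Proof. by move=> t0; rewrite -lee_fin -prob_at. Qed.

Lemma start_transition_sum1 (t : R) : 0 <= t -> \sum_y transition r t x0 y = 1.
Proof.
move=> t0; apply: EFin_inj; rewrite -sumEFin -(@probability_setT _ _ _ P).
rewrite (@measure_partition _ _ _ _ P (X t))//; last first.
  by move=> y; exact: (ctmc_measurable HX).
by apply: eq_bigr => y _; rewrite setTI prob_at.
Qed.

Lemma start_chapman_kolmogorov (t u : R) (z : S) : 0 <= t -> 0 <= u ->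
  transition r (t + u) x0 z = \sum_y transition r t x0 y * transition r u y z.
Proof.
move=> t0 u0; apply: EFin_inj; rewrite -prob_at ?addr_ge0// -sumEFin.
have mX v : 0 <= v -> forall y, measurable [set w | X v w = y].
  by move=> v0 y; exact: (ctmc_measurable HX).
rewrite (@measure_partition _ _ _ _ P (X t))//; [|by apply: mX; rewrite addr_ge0|exact: mX].
apply: eq_bigr => y _.
have := ctmc_fdd HX (s := [:: (t, y); (t + u, z)]).
rewrite /= andbT t0 lerDl u0 subr0 addrAC subrr add0r mulr1 => <-//.
congr (P _); rewrite predeqE => w; split=> /= [[e1 e2] p|H].
  by rewrite !inE => /orP[]/eqP ->.
by split; [apply: (H (t + u, z))|apply: (H (t, y))]; rewrite !inE eqxx ?orbT.
Qed.

Fixpoint grid (t dt : R) (n : nat) : seq R :=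
  if n is n'.+1 then (t + dt) :: grid (t + dt) dt n' else [::].

Lemma mem_grid (t dt : R) (n : nat) (u : R) :
  reflect (exists2 k, (k < n)%N & u = t + k.+1%:R * dt) (u \in grid t dt n).
Proof.
elim: n t u => [|n IH] t u /=; first by constructor => -[].
rewrite inE; apply: (iffP orP) => [[/eqP ->|/IH[k kn ->]]|[[|k] kn ->]].
- by exists 0 => //; rewrite mul1r.
- by exists k.+1 => //; rewrite [k.+2%:R]mulrS mulrDl mul1r addrA.
- by left; rewrite mul1r.
- by right; apply/IH; exists k => //; rewrite [k.+2%:R]mulrS mulrDl mul1r addrA.
Qed.

(** Survival of the skeleton chain of step [dt] at its next [n] times. The starting point is not
    tested: for [n = 0] the value is 1 even in [A]. *)
Fixpoint survival r A (dt : R) (n : nat) (x : S) : R :=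
  if n is n'.+1 then
    \sum_(y | y \notin A) transition r dt x y * survival r A dt n' y
  else 1.

Lemma taboo_grid A (t dt : R) (n : nat) (x : S) :
  taboo r A t x (grid t dt n) = survival r A dt n x.
Proof.
elim: n t x => //= n IH t x; apply: eq_bigr => y _.
by rewrite IH addrAC subrr add0r.
Qed.

Lemma prob_avoid_grid A (dt : R) (n : nat) : 0 <= dt ->
  P [set w | forall k, (k < n)%N -> X (k.+1%:R * dt) w \notin A] =
  (survival r A dt n x0)%:E.
Proof.
move=> dt0; have := @prob_prefix_avoid A [::] (grid 0 dt n).
rewrite /= mul1r taboo_grid => <-; last first.
  elim: n (0 : R) => //= n IH t; by rewrite IH lerDl dt0.
congr (P _); rewrite predeqE => w; split=> /= [H|[_ H] k kn].
  by split=> // u /mem_grid[k kn ->]; rewrite add0r; exact: H.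
by apply: H; apply/mem_grid; exists k => //; rewrite add0r.
Qed.

End TabooProbabilities.

(** * Potential theory of reversible chains *)

Section PotentialTheory.
Context {R : realType} {S : finType} (r : S -> S -> R) (mu : S -> R).

Definition gen_op (f : S -> R) (x : S) : R := \sum_y r x y * (f y - f x).

Definition dirichlet_form (f g : S -> R) : R :=
  2^-1 * \sum_x \sum_y mu x * r x y * ((f y - f x) * (g y - g x)).

Lemma sum_generator (f : S -> R) (x : S) :
  \sum_y generator r x y * f y = gen_op f x.
Proof.
rewrite (bigD1 x)//= /generator eqxx mulNr mulr_suml /gen_op [RHS](bigD1 x)//= subrr mulr0 add0r.
rewrite addrC -sumrB; apply: eq_bigr => y yx.
by rewrite eq_sym (negbTE yx) mulrBr.
Qed.

Lemma gen_opB (f g : S -> R) (x : S) :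
  gen_op (fun y => f y - g y) x = gen_op f x - gen_op g x.
Proof. by rewrite /gen_op -sumrB; apply: eq_bigr => y _; ring. Qed.

Lemma gen_opZ (a : R) (f : S -> R) (x : S) :
  gen_op (fun y => a * f y) x = a * gen_op f x.
Proof. by rewrite /gen_op mulr_sumr; apply: eq_bigr => y _; ring. Qed.

Lemma gen_op_cstB (a : R) (f : S -> R) (x : S) :
  gen_op (fun y => a - f y) x = - gen_op f x.
Proof. by rewrite /gen_op -sumrN; apply: eq_bigr => y _; ring. Qed.

Lemma gen_op_bij (p : S -> S) (f : S -> R) (x : S) : bijective p ->
  (forall x y, r (p x) (p y) = r x y) ->
  gen_op (f \o p) x = gen_op f (p x).
Proof.
move=> bp rp; rewrite /gen_op [RHS](reindex p)/=; last exact: onW_bij.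
by apply: eq_bigr => y _; rewrite rp.
Qed.

Hypothesis r_ge0 : forall x y, 0 <= r x y.
Hypothesis mu_gt0 : forall x, 0 < mu x.
Hypothesis reversible : forall x y, mu x * r x y = mu y * r y x.
Hypothesis irreducible : forall x y, connect (fun x y => 0 < r x y) x y.

(** Exchanging the two summation variables, by reversibility, gives a second expression of the left
    side; the form is the average of both. *)
Lemma dirichlet_formE (f g : S -> R) :
  \sum_x mu x * (f x * - gen_op g x) = dirichlet_form f g.
Proof.
set T := \sum_x \sum_y mu x * r x y * (f x * (g x - g y)).
have -> : \sum_x mu x * (f x * - gen_op g x) = T.
  apply: eq_bigr => x _; rewrite -sumrN !mulr_sumr; apply: eq_bigr => y _; ring.
have TE : T = \sum_x \sum_y mu x * r x y * (f y * (g y - g x)).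
  rewrite /T exchange_big /=; apply: eq_bigr => x _; apply: eq_bigr => y _.
  by rewrite (reversible y x).
have : T + T = 2 * dirichlet_form f g; last by move=> h; lra.
rewrite {2}TE /dirichlet_form mulrA divff ?mul1r ?pnatr_eq0// -big_split/=.
apply: eq_bigr => x _; rewrite -big_split/=; apply: eq_bigr => y _; ring.
Qed.

Lemma dirichlet_formC (f g : S -> R) : dirichlet_form f g = dirichlet_form g f.
Proof.
congr (_ * _); apply: eq_bigr => x _; apply: eq_bigr => y _.
by rewrite [(f y - f x) * _]mulrC.
Qed.

Let term_ge0 (f : S -> R) x y :
  0 <= mu x * r x y * ((f y - f x) * (f y - f x)).
Proof. by rewrite -expr2 mulr_ge0 ?sqr_ge0// mulr_ge0// ltW. Qed.

Lemma dirichlet_form_ge0 (f : S -> R) : 0 <= dirichlet_form f f.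
Proof.
by rewrite mulr_ge0 ?invr_ge0// sumr_ge0// => x _; rewrite sumr_ge0.
Qed.

Lemma dirichlet_form_le_add (f g : S -> R) :
  2 * dirichlet_form f g <= dirichlet_form f f + dirichlet_form g g.
Proof.
have := dirichlet_form_ge0 (fun x => f x - g x).
suff -> : dirichlet_form (fun x => f x - g x) (fun x => f x - g x) =
  dirichlet_form f f + dirichlet_form g g - 2 * dirichlet_form f g by move=> h; lra.
rewrite /dirichlet_form mulrCA -!mulrDr -mulrBr; congr (_ * _).
rewrite mulr_sumr -big_split -sumrB/=; apply: eq_bigr => x _.
rewrite mulr_sumr -big_split -sumrB/=; apply: eq_bigr => y _.
ring.
Qed.

Lemma sum_gen_op (f : S -> R) : \sum_x mu x * gen_op f x = 0.
Proof.
have := dirichlet_formE (fun=> 1) f.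
rewrite /dirichlet_form [X in _ * X]big1 ?mulr0; last first.
  by move=> x _; rewrite big1// => y _; rewrite subrr mul0r mulr0.
under eq_bigr do rewrite mul1r mulrN.
by rewrite sumrN => /eqP; rewrite oppr_eq0 => /eqP.
Qed.

Lemma edge_le_dirichlet (m : R) (f : S -> R) (x y : S) : 0 < m ->
  m <= mu x * r x y -> (f y - f x) ^+ 2 <= 2 / m * dirichlet_form f f.
Proof.
move=> m0 mxy; rewrite /dirichlet_form mulrA -mulrA mulrCA mulrA.
rewrite (_ : 2^-1 * (2 / m) = m^-1); last by field; rewrite gt_eqF.
rewrite mulrC ler_pdivlMr//.
rewrite (bigD1 x)//= (bigD1 y)//= mulrC -expr2 -addrA.
rewrite (le_trans (y := mu x * r x y * (f y - f x) ^+ 2))//.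
  by rewrite ler_wpM2r// sqr_ge0.
by rewrite lerDl addr_ge0// sumr_ge0// => z _; rewrite sumr_ge0.
Qed.

Lemma connect_dist_le (e : rel S) (D : R) (f : S -> R) (x y : S) : 0 <= D ->
  (forall z w, e z w -> `|f w - f z| <= D) -> connect e x y ->
  `|f y - f x| <= #|S|%:R * D.
Proof.
move=> D0 He /connectP[p ep ->].
have [q [eq uq ->]] : exists q, [/\ path e x q, uniq (x :: q) & last x p = last x q].
  by case/shortenP: ep => q *; exists q.
have size_q : (size q <= #|S|)%N.
  by rewrite (leq_trans _ (max_card (mem (x :: q))))// (card_uniqP uq)/= leqnSn.
rewrite (le_trans (y := (size q)%:R * D))//; last by rewrite ler_wpM2r// ler_nat.
elim: q x eq {uq size_q ep} => [|z q IH] x /=; first by rewrite subrr normr0 mul0r.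
move=> /andP[exz pq]; rewrite (le_trans (ler_distD (f z) _ _))//.
by rewrite mulrS mulrDl mul1r addrC lerD ?He// IH.
Qed.

(** A simple path has at most |S| steps, each changing [f] by at most the square root of 2 / m times
    the form; the 2 undoes the factor 1/2 of [dirichlet_form], of which one ordered edge is kept. *)
Lemma connect_dirichlet (e : rel S) (m : R) (f : S -> R) (x y : S) : 0 < m ->
  (forall z w, e z w -> m <= mu z * r z w) -> connect e x y ->
  (f y - f x) ^+ 2 <= #|S|%:R ^+ 2 * 2 / m * dirichlet_form f f.
Proof.
move=> m0 He exy; set E := dirichlet_form f f.
have E0 : 0 <= 2 / m * E by rewrite mulr_ge0 ?dirichlet_form_ge0// divr_ge0// ltW.
have := @connect_dist_le e (Num.sqrt (2 / m * E)) f x y (sqrtr_ge0 _).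
move=> /(_ _ exy) h; rewrite -real_normK ?num_real//.
have -> : #|S|%:R ^+ 2 * 2 / m * E = #|S|%:R ^+ 2 * Num.sqrt (2 / m * E) ^+ 2.
  by rewrite sqr_sqrtr// !mulrA.
rewrite -exprMn lerXn2r// ?nnegrE ?mulr_ge0 ?sqrtr_ge0//; apply: h => z w ezw.
rewrite -sqrtr_sqr ler_sqrt// edge_le_dirichlet//; exact: He.
Qed.

(** At a negative minimum, which lies off [A], the terms of [gen_op f] are nonnegative with
    nonpositive sum, hence vanish: the minimum spreads along positive rates up to [a], where [f] is
    nonnegative. *)
Lemma minimum_principle (A : {set S}) (f : S -> R) (a : S) : a \in A ->
  (forall x, x \in A -> 0 <= f x) -> (forall x, x \notin A -> gen_op f x <= 0) ->
  forall x, 0 <= f x.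
Proof.
move=> aA fA Lf z.
have [x0 _ min0] := @arg_minP _ _ _ z predT f isT.
rewrite (le_trans _ (min0 z isT))//; rewrite leNgt; apply/negP => fx0.
have step x y : f x = f x0 -> 0 < r x y -> f y = f x0.
  move=> fx rxy; have xA : x \notin A by apply/negP => /fA; rewrite fx leNgt fx0.
  have terms u : 0 <= r x u * (f u - f x) by rewrite mulr_ge0// subr_ge0 fx min0.
  have S0 : gen_op f x = 0.
    by apply/eqP; rewrite eq_le Lf//= sumr_ge0.
  have H0 := psumr_eq0P (fun u _ => terms u) S0.
  have /eqP : r x y * (f y - f x) = 0 by exact: H0.
  by rewrite mulf_eq0 gt_eqF//= subr_eq0 => /eqP ->.
have /connectP[p] := irreducible x0 a.
have : f x0 = f x0 by [].
(* The induction on the path needs any starting point with the minimal value, not only the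
   minimiser. *)
move: {1 3 4}x0 => x; elim: p x => [|y p IH] x fx /=.
  by move=> _ ax; have := fA _ aA; rewrite ax fx leNgt fx0.
by move=> /andP[rxy py]; apply: IH => //; apply: step fx rxy.
Qed.

Lemma dirichlet_problem_unique (A : {set S}) (f g : S -> R) (a : S) : a \in A ->
  (forall x, x \in A -> f x = g x) ->
  (forall x, x \notin A -> gen_op f x = gen_op g x) -> forall x, f x = g x.
Proof.
move=> aA fgA Lfg.
have le u v : (forall x, x \in A -> u x = v x) ->
    (forall x, x \notin A -> gen_op u x = gen_op v x) -> forall x, u x <= v x.
  move=> uvA Luv x; rewrite -subr_ge0.
  apply: (minimum_principle (f := fun x => v x - u x) aA) => y yA.
    by rewrite uvA// subrr.
  by rewrite gen_opB Luv// subrr.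
by move=> x; apply/eqP; rewrite eq_le !le// => y yA; rewrite ?fgA ?Lfg.
Qed.

(** Fredholm alternative: the square system made of the identity on [A] and the negated generator
    off [A] is injective by uniqueness, hence invertible. *)
Lemma dirichlet_problem_exists (A : {set S}) (phi : S -> R) (a : S) : a \in A ->
  exists f, (forall x, x \in A -> f x = 0) /\
            (forall x, x \notin A -> - gen_op f x = phi x).
Proof.
move=> aA.
pose T : 'M[R]_#|S| := \matrix_(j, i) if enum_val i \in A then (j == i)%:R
  else - generator r (enum_val i) (enum_val j).
have TE (v : 'rV[R]_#|S|) i : (v *m T) 0 i = if enum_val i \in A then v 0 i
    else - gen_op (fun x => v 0 (enum_rank x)) (enum_val i).
  rewrite mxE; case: ifPn => iA.
    rewrite (bigD1 i)//= mxE iA eqxx mulr1 big1 ?addr0// => j ji.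
    by rewrite mxE iA (negbTE ji) mulr0.
  rewrite -sum_generator -sumrN (reindex (@enum_val S predT))/=; last first.
    exact/onW_bij/enum_val_bij.
  by apply: eq_bigr => j _; rewrite mxE (negbTE iA) enum_valK mulrN mulrC.
have Tu : T \in unitmx.
  rewrite -row_free_unit; apply: inj_row_free => v vT0.
  have v0 : forall x, v 0 (enum_rank x) = 0.
    apply: (@dirichlet_problem_unique A (fun x => v 0 (enum_rank x)) (fun=> 0) a aA) => x xA.
      by have := TE v (enum_rank x); rewrite vT0 mxE enum_rankK xA => ->.
    have := TE v (enum_rank x); rewrite vT0 mxE enum_rankK (negbTE xA) => /eqP.
    rewrite eq_sym oppr_eq0 => /eqP ->; rewrite /gen_op big1// => y _.
    by rewrite subrr mulr0.
  by apply/rowP => i; rewrite mxE -(enum_valK i) v0.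
pose w : 'rV[R]_#|S| := \row_i if enum_val i \in A then 0 else phi (enum_val i).
exists (fun x => (w *m invmx T) 0 (enum_rank x)).
have wT : w *m invmx T *m T = w by rewrite mulmxKV.
split=> x xA; have := TE (w *m invmx T) (enum_rank x).
  by rewrite wT mxE enum_rankK xA => <-.
by rewrite wT mxE enum_rankK (negbTE xA) => <-.
Qed.

(* [kappa] is the escape rate from [B] to [A], [h] the equilibrium potential
   and [g] the mean hitting time of [A]. *)
Lemma equilibrium_potential (A B : {set S}) (a b : S) :
  a \in A -> b \in B -> (forall x, x \in B -> x \notin A) ->
  (forall b', b' \in B -> exists p : S -> S, [/\ bijective p,
     forall x y, r (p x) (p y) = r x y, forall x, (p x \in A) = (x \in A),
     forall x, (p x \in B) = (x \in B) & p b = b']) ->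
  exists (kappa : R) (h g : S -> R),
    [/\ 0 < kappa,
     [/\ forall x, 0 <= h x <= 1, forall x, x \in A -> h x = 0,
       forall x, x \in B -> h x = 1 &
       forall x, x \notin A -> gen_op h x = - kappa * (x \in B)%:R],
     [/\ forall x, 0 <= g x, forall x, x \in A -> g x = 0 &
       forall x, x \notin A -> gen_op g x = -1],
     g b * (kappa * \sum_(x in B) mu x) = \sum_x mu x * h x &
     kappa * \sum_(x in B) mu x = dirichlet_form h h /\
     forall f : S -> R, (forall x, x \in A -> f x = 0) ->
       (forall x, x \in B -> f x = 1) ->
       kappa * \sum_(x in B) mu x <= dirichlet_form f f].
Proof.
move=> aA bB notA sym.
(* [G] solves - L G = 1_B off [A]. Once it is constant on [B], dividing by [G b] gives the
   equilibrium potential, with escape rate [(G b)^-1]. *)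
have [G [GA LG]] := dirichlet_problem_exists (fun x => (x \in B)%:R) aA.
have [g [gA Lg]] := dirichlet_problem_exists (fun x => 1) aA.
(* A bijection that preserves the rates, [A] and the right-hand side sends the solution to a
   solution, so uniqueness makes it invariant. *)
have symb (phi : S -> R) f : (forall x, x \in A -> f x = 0) ->
    (forall x, x \notin A -> - gen_op f x = phi x) ->
    (forall p : S -> S, (forall x, (p x \in B) = (x \in B)) ->
       forall x, phi (p x) = phi x) ->
    forall b', b' \in B -> f b' = f b.
  move=> fA Lf phip b' /sym[p [bp rp pA pB <-]].
  have := @dirichlet_problem_unique A (f \o p) f a aA; rewrite /comp; apply.
    by move=> x xA; rewrite fA ?pA// fA.
  move=> x xA; apply/eqP; rewrite -eqr_opp; apply/eqP.
  by rewrite gen_op_bij// !Lf ?pA// phip.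
have GB b' : b' \in B -> G b' = G b.
  by apply: (symb (fun x => (x \in B)%:R)) => // p pB x; rewrite pB.
have gB b' : b' \in B -> g b' = g b by apply: (symb (fun=> 1)).
have G0 x : 0 <= G x.
  apply: (minimum_principle aA) => y yA; first by rewrite GA.
  by rewrite -oppr_ge0 LG.
have g0 x : 0 <= g x.
  apply: (minimum_principle aA) => y yA; first by rewrite gA.
  by rewrite -oppr_ge0 Lg.
have Gb : 0 < G b.
  rewrite lt_def G0 andbT; apply/eqP => Gb0.
  have : 0 <= gen_op G b by rewrite sumr_ge0// => y _; rewrite Gb0 subr0 mulr_ge0.
  by rewrite -oppr_le0 LG ?notA// bB ler10.
(* Off [A] and [B] the function [G] is harmonic, so the minimum principle is used with their union
   as boundary. *)
have G1 x : G x <= G b.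
  rewrite -subr_ge0.
  apply: (@minimum_principle (A :|: B) (fun x => G b - G x) a); first by rewrite inE aA.
    by move=> y; rewrite inE => /orP[/GA ->|/GB ->]; rewrite ?subr0 ?subrr ?(ltW Gb).
  move=> y; rewrite inE negb_or => /andP[yA yB].
  by rewrite gen_op_cstB LG// (negbTE yB).
pose h x := (G b)^-1 * G x.
have Lh x : x \notin A -> gen_op h x = - (G b)^-1 * (x \in B)%:R.
  by move=> xA; rewrite gen_opZ -LG// mulNr mulrN opprK.
have hA x : x \in A -> h x = 0 by move=> /GA Gx; rewrite /h Gx mulr0.
have hB x : x \in B -> h x = 1.
  by move=> /GB Gx; rewrite /h Gx mulVf// gt_eqF.
have hf f : (forall x, x \in A -> f x = 0) -> dirichlet_form f h =
    (G b)^-1 * \sum_(x in B) mu x * f x.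
  move=> fA; rewrite -dirichlet_formE mulr_sumr [RHS]big_mkcond/=.
  apply: eq_bigr => x _; have [xA|xA] := boolP (x \in A).
    by rewrite fA// mul0r !mulr0 if_same.
  rewrite Lh//; case: (x \in B); rewrite ?mulr1 ?mulr0 ?oppr0 ?mulr0//; ring.
have hBf f : (forall x, x \in A -> f x = 0) -> (forall x, x \in B -> f x = 1) ->
    dirichlet_form f h = (G b)^-1 * \sum_(x in B) mu x.
  move=> fA fB; rewrite hf//; congr (_ * _); apply: eq_bigr => x xB.
  by rewrite fB// mulr1.
exists (G b)^-1, h, g; split.
- by rewrite invr_gt0.
- split=> // x; rewrite mulr_ge0 ?invr_ge0//= ler_pdivrMl// mulr1; exact: G1.
- by split=> // x xA; rewrite -[LHS]opprK Lg.
(* The form of [g] and [h] is computed twice: through - L h, which off [A] is carried by [B], and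
   through - L g, equal to 1 wherever [h] is nonzero. *)
- rewrite mulrCA mulr_sumr; transitivity (dirichlet_form g h).
    by rewrite hf//; congr (_ * _); apply: eq_bigr => x /gB ->; rewrite mulrC.
  rewrite dirichlet_formC -dirichlet_formE; apply: eq_bigr => x _.
  have [xA|xA] := boolP (x \in A); first by rewrite hA// mul0r.
  by rewrite Lg// mulr1.
- split=> [|f fA fB]; first by rewrite hBf.
  (* Dirichlet principle: every admissible [f] has the same form against [h] as [h] itself. *)
  by have := dirichlet_form_le_add f h; rewrite (hBf f)// (hBf h)//; lra.
Qed.

End PotentialTheory.

(** * Hitting times *)

Section SurvivalBounds.
Context {R : realType} {S : finType} (r : S -> S -> R).

Lemma transition_op_uniform : exists2 C : R, 0 <= C &
  forall (f : S -> R) (t : R) (x : S), 0 <= t <= 1 ->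
  `|\sum_y transition r t x y * f y - (f x + t * gen_op r f x)| <=
  C * t ^+ 2 * \sum_y `|f y|.
Proof.
have [C C0 HC] := transition_first_order r.
exists C => // f t x t01.
rewrite -sum_generator mulr_sumr.
have -> : f x = \sum_y (x == y)%:R * f y.
  rewrite (bigD1 x)//= eqxx mul1r big1 ?addr0// => y yx.
  by rewrite eq_sym (negbTE yx) mul0r.
rewrite -big_split/= -sumrB (le_trans (ler_norm_sum _ _ _))//.
rewrite mulr_sumr; apply: ler_sum => y _.
rewrite mulrA -mulrDl -mulrBl normrM ler_wpM2r//; exact: HC.
Qed.

Lemma transition_op_first_order (f : S -> R) : exists2 C : R, 0 <= C &
  forall (t : R) (x : S), 0 <= t <= 1 ->
  `|\sum_y transition r t x y * f y - (f x + t * gen_op r f x)| <= C * t ^+ 2.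
Proof.
have [C C0 HC] := transition_op_uniform.
exists (C * \sum_y `|f y|) => [|t x t01]; first by rewrite mulr_ge0// sumr_ge0.
by rewrite mulrAC; exact: HC.
Qed.

Hypothesis transition_ge0 : forall t x y, 0 <= t -> 0 <= transition r t x y.
Hypothesis transition_sum1 : forall t x, 0 <= t -> \sum_y transition r t x y = 1.

(** One step of the skeleton chain keeps at least the fraction 1 - kappa dt of [h], up to C dt^2;
    killing in [A] loses nothing as [h] vanishes there. Errors merely add up, since later steps
    weigh them by probabilities. *)
Lemma survival_ge (A : {set S}) (h : S -> R) (kappa : R) : 0 <= kappa ->
  (forall x, x \in A -> h x = 0) ->
  (forall x, h x <= 1) ->
  (forall x, x \notin A -> - kappa * h x <= gen_op r h x) ->
  exists2 C : R, 0 <= C & forall (dt : R) (n : nat) (x : S),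
    0 <= dt <= 1 -> kappa * dt <= 1 -> x \notin A ->
    (1 - kappa * dt) ^+ n * h x - n%:R * (C * dt ^+ 2) <= survival r A dt n x.
Proof.
move=> k0 hA h1 Lh; have [C C0 HC] := transition_op_first_order h.
exists C => // dt n x dt01 kdt1 xA.
have dt0 : 0 <= dt by case/andP: dt01.
elim: n x xA => [|n IH] x xA; first by rewrite mul0r subr0 mul1r h1.
set q := 1 - kappa * dt; have q0 : 0 <= q by rewrite subr_ge0.
have q1 : q <= 1 by rewrite gerBl mulr_ge0.
rewrite /= (le_trans (y := \sum_(y | y \notin A) transition r dt x y *
   (q ^+ n * h y - n%:R * (C * dt ^+ 2))))//; last first.
  by apply: ler_sum => y yA; rewrite ler_wpM2l ?transition_ge0// IH.
under eq_bigr do rewrite mulrBr mulrCA.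
rewrite sumrB -mulr_sumr -mulr_suml.
have -> : \sum_(y | y \notin A) transition r dt x y * h y =
    \sum_y transition r dt x y * h y.
  rewrite [RHS](bigID (fun y => y \in A))/= [X in _ = X + _]big1 ?add0r//.
  by move=> y yA; rewrite hA// mulr0.
have s1 : \sum_(y | y \notin A) transition r dt x y <= 1.
  rewrite -(transition_sum1 x dt0) [leRHS](bigID (fun y => y \in A))/= lerDr sumr_ge0// => y _.
  exact: transition_ge0.
have step : q * h x - C * dt ^+ 2 <= \sum_y transition r dt x y * h y.
  have /ler_normlP[] := HC dt x dt01; have := Lh x xA; have := dt0.
  move=> ? /(ler_wpM2l dt0); rewrite /q mulrA mulrN.
  by move=> ? ? _; lra.
have Cdt0 : 0 <= C * dt ^+ 2 by rewrite mulr_ge0 ?exprn_ge0.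
have qn0 : 0 <= q ^+ n by rewrite exprn_ge0.
have qn1 : q ^+ n <= 1 by rewrite exprn_ile1.
have := ler_wpM2l qn0 step; have := ler_wpM2r Cdt0 qn1.
have n0 : 0 <= n%:R * (C * dt ^+ 2) by rewrite mulr_ge0.
have := ler_wpM2r n0 s1.
rewrite [q ^+ n.+1]exprSr -[n.+1%:R]natr1.
by move=> *; lra.
Qed.

(** Lyapunov argument: off [A] one step lowers [g] in mean by at least dt - C dt^2, and [g] stays
    nonnegative, which bounds the expected number of steps before [A]. *)
Lemma sum_survival_le (A : {set S}) (g : S -> R) :
  (forall x, x \in A -> g x = 0) ->
  (forall x, 0 <= g x) ->
  (forall x, x \notin A -> gen_op r g x = -1) ->
  exists2 C : R, 0 <= C & forall (dt : R) (n : nat) (x : S),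
    0 <= dt <= 1 -> C * dt <= 1 -> x \notin A ->
    (dt - C * dt ^+ 2) * \sum_(k < n) survival r A dt k x <= g x.
Proof.
move=> gA g0 Lg; have [C C0 HC] := transition_op_first_order g.
exists C => // dt n x dt01 Cdt1 xA.
have dt0 : 0 <= dt by case/andP: dt01.
set q := dt - _; have q0 : 0 <= q.
  rewrite (_ : q = dt * (1 - C * dt)); last by rewrite /q; ring.
  by rewrite mulr_ge0// subr_ge0.
elim: n x xA => [|n IH] x xA; first by rewrite big_ord0 mulr0.
rewrite big_ord_recl/= mulrDr mulr1 exchange_big/= mulr_sumr.
have -> : g x = (g x - q) + q by ring.
rewrite addrC lerD2r.
rewrite (le_trans (y := \sum_(y | y \notin A) transition r dt x y * g y))//.
  apply: ler_sum => y yA; rewrite -mulr_sumr mulrCA ler_wpM2l ?transition_ge0//.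
  exact: IH.
have -> : \sum_(y | y \notin A) transition r dt x y * g y =
    \sum_y transition r dt x y * g y.
  rewrite [RHS](bigID (fun y => y \in A))/= [X in _ = X + _]big1 ?add0r//.
  by move=> y yA; rewrite gA// mulr0.
have /ler_normlP[] := HC dt x dt01; rewrite Lg// /q => *; lra.
Qed.

End SurvivalBounds.

(** * Functions above an exponential with almost the same integral *)

Section ExponentialTail.
Context {R : realType}.

Lemma expR_le_inv (x : R) : 0 < x -> expR (- x) <= x^-1.
Proof.
move=> x0; rewrite expRN lef_pV2 ?posrE ?expR_gt0//.
by rewrite (le_trans _ (expR_ge1Dx x))// lerDr.
Qed.

Lemma one_sub_le_expR (x : R) : 1 - x <= expR (- x).
Proof. exact: expR_ge1Dx. Qed.

Lemma expR_pow_ge (kappa t dt : R) (n : nat) : 0 <= kappa -> 0 <= dt -> 0 <= t ->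
  kappa * dt <= 2^-1 -> n%:R * dt <= t ->
  expR (- (kappa * t)) - 2 * kappa ^+ 2 * t * dt <= (1 - kappa * dt) ^+ n.
Proof.
move=> k0 dt0 t0 kdt ndt; set x := kappa * dt.
have x0 : 0 <= x by rewrite mulr_ge0.
(* For 0 <= x <= 1/2, (1 - x)(1 + x + 2 x^2) = 1 + x^2 (1 - 2 x) >= 1; hence the coefficient 2 and
   the bound 1/2 on kappa dt. *)
have e1 : expR (- (x + 2 * x ^+ 2)) <= 1 - x.
  rewrite expRN -[leRHS]invrK lef_pV2 ?posrE ?invr_gt0 ?expR_gt0//; last by rewrite /x; lra.
  rewrite (le_trans _ (expR_ge1Dx _))// -[leLHS]mul1r ler_pdivrMr; last by rewrite /x; lra.
  have : 0 <= x ^+ 2 * (1 - 2 * x).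
    by rewrite mulr_ge0 ?sqr_ge0//; rewrite /x; lra.
  by rewrite -/x; lra.
have e2 : expR (- (x + 2 * x ^+ 2)) ^+ n <= (1 - x) ^+ n.
  by rewrite lerXn2r// ?nnegrE ?expR_ge0//; rewrite /x; lra.
apply: le_trans e2; rewrite -expRM_natl.
have -> : n%:R * - (x + 2 * x ^+ 2) = - (n%:R * dt * (kappa + 2 * kappa ^+ 2 * dt)).
  by rewrite /x; ring.
have k2 : 0 <= kappa + 2 * kappa ^+ 2 * dt.
  by rewrite addr_ge0// mulr_ge0// mulr_ge0// exprn_ge0.
rewrite (le_trans (y := expR (- (t * (kappa + 2 * kappa ^+ 2 * dt)))))//; last first.
  by rewrite ler_expR lerN2 ler_wpM2r.
have -> : - (t * (kappa + 2 * kappa ^+ 2 * dt)) = - (kappa * t) - 2 * kappa ^+ 2 * t * dt by ring.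
rewrite expRD.
have w0 : 0 <= 2 * kappa ^+ 2 * t * dt by rewrite !mulr_ge0// exprn_ge0.
set w := 2 * _ * _ * _ in w0 *.
have := one_sub_le_expR w; have e0 : 0 < expR (- (kappa * t)) by exact: expR_gt0.
have el1 : expR (- (kappa * t)) <= 1 by rewrite -expR0 ler_expR oppr_le0 mulr_ge0.
move=> /(ler_wpM2l (ltW e0)); have := ler_wpM2r w0 el1; lra.
Qed.

Variables (kappa m : R) (f : R -> R).
Hypothesis kappa_gt0 : 0 < kappa.
Hypothesis f_ge : forall u, 0 <= u -> expR (- (kappa * u)) <= f u.
Hypothesis f_noninc : forall u v, 0 <= u -> u <= v -> f v <= f u.
Hypothesis f_sum : forall (dt : R) (n : nat), 0 < dt ->
  dt * \sum_(k < n) f (k.+1%:R * dt) <= m.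

(** A Riemann sum of the integral 1 / kappa. The last hypothesis makes the truncated tail a^n at
    most dt, because exp(- x) <= 1 / x. *)
Let geom_sum_ge (dt : R) (n : nat) : 0 < dt -> kappa * dt <= 1 ->
  dt^-1 <= n%:R * (kappa * dt) ->
  (1 - kappa * dt) * (1 - dt) / kappa <=
  dt * \sum_(k < n) expR (- (kappa * (k.+1%:R * dt))).
Proof.
move=> dt0 kdt1 ndt; set a := expR (- (kappa * dt)).
have kdt0 : 0 < kappa * dt by rewrite mulr_gt0.
have aE k : expR (- (kappa * (k.+1%:R * dt))) = a * a ^+ k.
  by rewrite -exprS /a -expRM_natl; congr expR; ring.
under eq_bigr do rewrite aE.
rewrite -mulr_sumr.
have a1 : a < 1 by rewrite /a -expR0 ltr_expR oppr_lt0.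
have a0 : 0 < a by exact: expR_gt0.
have ak : 1 - kappa * dt <= a by exact: one_sub_le_expR.
have anle : a ^+ n <= dt.
  rewrite /a -expRM_natl mulrN (le_trans (expR_le_inv _))//.
    by rewrite (lt_le_trans _ ndt)// invr_gt0.
  by rewrite invf_ple ?posrE// (lt_le_trans _ ndt)// invr_gt0.
have sE : (1 - a) * \sum_(k < n) a ^+ k = 1 - a ^+ n.
  by rewrite -opprB mulNr -subrX1 opprB.
rewrite ler_pdivrMr//.
have s0 : 0 <= \sum_(k < n) a ^+ k by rewrite sumr_ge0// => k _; rewrite exprn_ge0// ltW.
have h1 : 1 - dt <= kappa * dt * \sum_(k < n) a ^+ k.
  rewrite (le_trans (y := 1 - a ^+ n)) ?lerB// -sE ler_wpM2r//; lra.
rewrite (_ : dt * _ * _ = a * (kappa * dt * \sum_(k < n) a ^+ k)); last by ring.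
rewrite (le_trans (y := (1 - kappa * dt) * (kappa * dt * \sum_(k < n) a ^+ k)))//.
  by rewrite ler_wpM2l// subr_ge0.
by rewrite ler_wpM2r// mulr_ge0// ltW.
Qed.

Let small (c e : R) : 0 <= c -> 0 < e ->
  exists2 j : nat, (0 < j)%N & c / j%:R <= e.
Proof.
move=> c0 e0; exists (Num.truncn (c / e)).+1 => //.
rewrite ler_pdivrMr// mulrC -ler_pdivrMr//.
exact/ltW/truncnS_gt.
Qed.

(* [f] dominates [exp (- kappa u)], whose integral is [1 / kappa], while the integral
   of [f] is at most [m]; the excess on the window [t - eta, t] controls [f t]. *)
Lemma exponential_tail (t eta : R) : 0 < eta -> eta <= t ->
  f t <= expR (- (kappa * (t - eta))) + (m - kappa^-1) / eta.
Proof.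
move=> eta0 etat.
suff main : kappa^-1 + eta * (f t - expR (- (kappa * (t - eta)))) <= m.
  rewrite -lerBlDl ler_pdivlMr//; lra.
apply/ler_addgt0Pr => e e0.
have c0 : 0 <= eta * (1 + kappa^-1 + kappa).
  by rewrite mulr_ge0 ?(ltW eta0)// !addr_ge0// ?invr_ge0 (ltW kappa_gt0).
have e1 : 0 < Num.min e 1 by rewrite lt_min e0 ltr01.
(* The window is cut into [j] cells of length dt with dt (1 + 1 / kappa + kappa) at most e and 1:
   this bounds the loss of the Riemann sum and gives kappa dt <= 1. *)
have [j j0 je] := small c0 e1.
move: je; rewrite le_min mulrAC => /andP[je j1].
have jR0 : 0 < j%:R :> R by rewrite ltr0n.
set dt := eta / j%:R in je j1.
have dt0 : 0 < dt by rewrite divr_gt0.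
have kV0 : 0 < kappa^-1 by rewrite invr_gt0.
have kdt1 : kappa * dt <= 1 by have := mulr_gt0 dt0 kV0; lra.
set M := Num.truncn (t / dt).
have tdt0 : 0 <= t / dt by rewrite divr_ge0 ?ltW// (lt_le_trans eta0).
have /andP[M1 M2] : M%:R <= t / dt < M.+1%:R by exact: truncn_itv.
have Mt : M%:R * dt <= t by rewrite -ler_pdivlMr.
have tM : t < M.+1%:R * dt by rewrite -ltr_pdivrMr.
have jdt : j%:R * dt = eta by rewrite mulrC divfK// gt_eqF.
have jM : (j <= M)%N.
  rewrite -ltnS -(ltr_nat R) -(ltr_pM2r dt0) jdt; exact: le_lt_trans tM.
(* The [M] cells before t, then enough others for the geometric tail to be negligible. *)
pose n := (M + (Num.truncn (dt^-1 / (kappa * dt))).+1)%N.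
have ndt : dt^-1 <= n%:R * (kappa * dt).
  have kdt0 : 0 < kappa * dt by rewrite mulr_gt0.
  rewrite -ler_pdivrMr//; apply: (le_trans (ltW (truncnS_gt _))).
  by rewrite ler_nat leq_addl.
have G := geom_sum_ge dt0 kdt1 ndt.
pose ee (k : nat) := expR (- (kappa * (k.+1%:R * dt))).
set p := expR (- (kappa * (t - eta))).
(* For M - j <= k < M the right endpoint of the cell lies between t - eta and t, so [f] is at least
   [f t] there and the exponential at most [p]; on all other cells the excess is nonnegative. *)
have D : eta * (f t - p) <= dt * \sum_(k < n) (f (k.+1%:R * dt) - ee k).
  have pos k : 0 <= f (k.+1%:R * dt) - ee k.
    by rewrite subr_ge0 f_ge// mulr_ge0// ltW.
  rewrite -(big_mkord xpredT (fun k => f (k.+1%:R * dt) - ee k)).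
  rewrite (@big_cat_nat _ _ _ (M - j)%N)//=; last by rewrite (leq_trans (leq_subr _ _))// leq_addr.
  rewrite (@big_cat_nat _ _ _ M (M - j)%N)//= ?leq_subr//; last by rewrite leq_addr.
  rewrite (le_trans (y := dt * \sum_(M - j <= k < M) (f (k.+1%:R * dt) - ee k)))//.
    rewrite -jdt mulrAC [leLHS]mulrC ler_wpM2l ?(ltW dt0)//.
    rewrite (le_trans (y := \sum_(M - j <= k < M) (f t - p)))//.
      by rewrite big_const_nat iter_addr_0 subKn// mulr_natl.
    rewrite big_seq_cond [leRHS]big_seq_cond; apply: ler_sum => k.
    rewrite andbT mem_index_iota => /andP[k1 k2]; apply: lerB.
      apply: f_noninc; first by rewrite mulr_ge0// ltW.
      by rewrite (le_trans _ Mt)// ler_wpM2r ?(ltW dt0)// ler_nat.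
    rewrite ler_expR lerN2 ler_wpM2l ?(ltW kappa_gt0)//.
    have : M.+1%:R * dt <= (k.+1 + j)%:R * dt.
      by rewrite ler_wpM2r ?(ltW dt0)// ler_nat addSn ltnS addnC -leq_subLR.
    by rewrite natrD mulrDl jdt; lra.
  by rewrite ler_wpM2l ?(ltW dt0)// addrCA lerDl addr_ge0// sumr_ge0.
have F := f_sum n dt0.
rewrite sumrB mulrBr -/(ee) in D.
have : kappa^-1 - e <= (1 - kappa * dt) * (1 - dt) / kappa.
  have -> : (1 - kappa * dt) * (1 - dt) / kappa = kappa^-1 - dt - dt * kappa^-1 + dt * dt.
    by field; rewrite gt_eqF.
  have : 0 <= dt * dt by rewrite mulr_ge0 ?(ltW dt0).
  have : 0 <= dt * kappa by rewrite mulr_ge0 ?(ltW dt0, ltW kappa_gt0).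
  lra.
by move: G; rewrite -/(ee) => *; lra.
Qed.

(** The tail bound at t = eta reads f(eta) <= 1 + (m - 1 / kappa) / eta, while f(eta) >= 1 - kappa
    eta; let eta tend to 0. *)
Lemma exponential_mean_ge : kappa^-1 <= m.
Proof.
rewrite -subr_ge0; apply/ler_addgt0Pr => e e0; rewrite -lerBlDr sub0r.
pose eta := Num.min 1 (e / kappa).
have eta0 : 0 < eta by rewrite lt_min ltr01 divr_gt0.
have eta1 : eta <= 1 by rewrite ge_min lexx.
have kee : kappa * eta <= e by rewrite mulrC -ler_pdivlMr// ge_min lexx orbT.
have := exponential_tail eta0 (lexx _).
rewrite subrr mulr0 oppr0 expR0 -lerBlDl ler_pdivlMr// => h.
have h1 := f_ge (ltW eta0); have h2 := one_sub_le_expR (kappa * eta).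
have h3 : - (kappa * eta) <= f eta - 1 by lra.
have h4 := ler_wpM2r (ltW eta0) h3.
have h5 : kappa * eta * eta <= e.
  by rewrite (le_trans _ kee)// ger_pMr// mulr_gt0.
lra.
Qed.

End ExponentialTail.

(** * Hitting times in continuous time *)

Section HittingTime.
Context {R : realType} {S : finType} (d : measure_display)
  (Omega : measurableType d) (P : probability Omega R) (X : R -> Omega -> S)
  (r : S -> S -> R) (x0 : S).
Hypothesis HX : is_ctmc P X r x0.
Variable A : {set S}.
Local Notation tau := (hitting_time X A).

Lemma hitting_time_ge0 w : (0 <= tau w)%E.
Proof. by apply: le_ereal_inf_tmp => _ [u [u0 _] <-]; rewrite lee_fin. Qed.

Lemma hitting_time_ltP (t : R) w :
  (tau w < t%:E)%E <-> exists u, [/\ 0 <= u, u < t & X u w \in A].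
Proof.
split=> [/ereal_inf_ltP[_ [u [u0 Xu] <-]]|[u [u0 ut Xu]]].
  by rewrite lte_fin => ut; exists u.
by apply/ereal_inf_ltP; exists u%:E; [exists u|rewrite lte_fin].
Qed.

(* The strict bound on [k] leaves out the time [t] itself: the union over [n] is
   [tau < t], by right continuity of the paths. *)
Definition dyadic_hit (t : R) (n : nat) : set Omega :=
  [set w | exists2 k, (k.+1 < 2 ^ n)%N & X (k.+1%:R * (t / (2 ^ n)%:R)) w \in A].

Lemma hitting_time_lt_dyadic (t : R) : 0 < t ->
  [set w | (tau w < t%:E)%E] = \bigcup_n dyadic_hit t n.
Proof.
move=> t0; rewrite predeqE => w; split; last first.
  move=> [n _ [k kn Xk]]; apply/hitting_time_ltP.
  have n0 : 0 < (2 ^ n)%:R :> R by rewrite ltr0n expn_gt0.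
  exists (k.+1%:R * (t / (2 ^ n)%:R)); split=> //.
    by rewrite mulr_ge0// divr_ge0// ltW.
  by rewrite mulrCA gtr_pMr// ltr_pdivrMr// mul1r ltr_nat.
move=> /hitting_time_ltP[u [u0 ut Xu]].
have /nbhs_ballP[e /= e0 He] := ctmc_right_continuous HX w u0.
(* A mesh below this minimum puts the first grid point after [u] both in the interval where the path
   is constant and strictly before t. *)
have m0 : 0 < Num.min e (t - u) by rewrite lt_min e0 subr_gt0.
set m := Num.min _ _ in m0.
have [n nm] : exists n, t / (2 ^ n)%:R < m.
  exists (Num.bound (t / m)); have := @upper_nthrootP R (t / m) _ (leqnn _).
  by rewrite -natrX ltr_pdivrMr// => h; rewrite ltr_pdivrMr ?ltr0n ?expn_gt0// mulrC.
have n0 : 0 < (2 ^ n)%:R :> R by rewrite ltr0n expn_gt0.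
set dt := t / _ in nm; have dt0 : 0 < dt by rewrite divr_gt0.
pose k := Num.truncn (u / dt).
have /andP[k1 k2] : k%:R <= u / dt < k.+1%:R by apply: truncn_itv; rewrite divr_ge0// ltW.
move: k1 k2; rewrite ler_pdivlMr// ltr_pdivrMr// => k1 k2.
have km : k.+1%:R * dt < u + m by rewrite -natr1 mulrDl mul1r ler_ltD.
have me : m <= e by rewrite ge_min lexx.
have mt : m <= t - u by rewrite ge_min lexx orbT.
exists n => //; exists k.
  rewrite -(ltr_nat R) -(ltr_pM2r dt0) /dt [(2 ^ n)%:R * _]mulrC divfK ?gt_eqF//.
  by rewrite (lt_le_trans km)// -lerBrDl.
rewrite -/dt He//= /ball/= ltr_distlC; apply/andP; split; last by rewrite (lt_le_trans km)// lerD2l.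
by rewrite (lt_trans _ k2)// ltrBlDr ltrDl.
Qed.

Lemma measurable_dyadic_hit (t : R) (n : nat) : 0 <= t -> measurable (dyadic_hit t n).
Proof.
move=> t0.
rewrite (_ : dyadic_hit t n = \bigcup_(k in [set k | (k.+1 < 2 ^ n)%N])
   \bigcup_(y in [set y | y \in A]) [set w | X (k.+1%:R * (t / (2 ^ n)%:R)) w = y]); last first.
  rewrite predeqE => w; split=> [[k kn Xk]|[k /= kn [y /= yA e]]].
    by exists k => //; exists (X (k.+1%:R * (t / (2 ^ n)%:R)) w).
  by exists k => //; rewrite e.
apply: bigcup_measurable => k _; apply: fin_bigcup_measurable => // y _.
by apply: (ctmc_measurable HX); rewrite mulr_ge0// divr_ge0.
Qed.

Lemma dyadic_hit_homo (t : R) : {homo dyadic_hit t : n m / (n <= m)%N >-> (n <= m)%O}.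
Proof.
apply: homo_leq; [by move=> B|by move=> B1 B2 B3; exact: le_trans|move=> n].
apply/subsetPset => w [k kn Xk]; exists k.*2.+1.
  by rewrite expnS; lia.
suff -> : k.*2.+2%:R * (t / (2 ^ n.+1)%:R) = k.+1%:R * (t / (2 ^ n)%:R) by [].
have n0 : (2 ^ n)%:R != 0 :> R by rewrite pnatr_eq0 -lt0n expn_gt0.
rewrite -doubleS -muln2 expnS !natrM; field.
exact: n0.
Qed.

Lemma measurable_hitting_time_lt (t : R) : measurable [set w | (tau w < t%:E)%E].
Proof.
have [t0|t0] := ltP 0 t.
  rewrite hitting_time_lt_dyadic//; apply: bigcup_measurable => n _.
  by apply: measurable_dyadic_hit; exact: ltW.
rewrite (_ : [set _ | _] = set0)// -subset0 => w /=.
by rewrite ltNge (le_trans _ (hitting_time_ge0 w))// lee_fin.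
Qed.

Lemma measurable_hitting_time : measurable_fun setT tau.
Proof.
move=> mD; apply: (measurability _ (ErealGenInftyO.measurableE R)) => //.
move=> _ [_ [x ->] <-]; rewrite setTI.
rewrite (_ : _ @^-1` _ = [set w | (tau w < x%:E)%E]); first exact: measurable_hitting_time_lt.
by rewrite predeqE => w /=; rewrite in_itv.
Qed.

Lemma measurable_hitting_time_gt (t : R) : measurable [set w | (t%:E < tau w)%E].
Proof.
have := emeasurable_fun_o_infty measurableT measurable_hitting_time t%:E.
by rewrite setTI.
Qed.

Lemma measurable_hitting_time_le (t : R) : measurable [set w | (tau w <= t%:E)%E].
Proof.
have := emeasurable_fun_infty_c measurableT measurable_hitting_time t%:E.
by rewrite setTI.
Qed.

Lemma prob_dyadic_hit (t : R) (n : nat) : 0 <= t ->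
  P (dyadic_hit t n) = (1 - survival r A (t / (2 ^ n)%:R) (2 ^ n).-1 x0)%:E.
Proof.
move=> t0; have dt0 : 0 <= t / (2 ^ n)%:R by rewrite divr_ge0.
rewrite EFinB -(prob_avoid_grid HX)// -[dyadic_hit t n]setCK probability_setC; last first.
  exact/measurableC/measurable_dyadic_hit.
congr (1 - P _)%E; rewrite predeqE => w; split.
  move=> nH k kn; apply/negP => Xk; apply: nH; exists k => //.
  by rewrite -ltn_predRL.
by move=> H [k kn]; apply/negP/H; rewrite ltn_predRL.
Qed.

Hypothesis transition_ge0 : forall t x y, 0 <= t -> 0 <= transition r t x y.
Hypothesis transition_sum1 : forall t x, 0 <= t -> \sum_y transition r t x y = 1.
Hypothesis x0A : x0 \notin A.

Lemma prob_hitting_time_lt (kappa : R) (h : S -> R) (t : R) : 0 <= kappa ->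
  (forall x, x \in A -> h x = 0) -> (forall x, h x <= 1) -> h x0 = 1 ->
  (forall x, x \notin A -> - kappa * h x <= gen_op r h x) ->
  0 <= t ->
  (P [set w | (tau w < t%:E)%E] <= (1 - expR (- (kappa * t)))%:E)%E.
Proof.
move=> k0 hA h1 hx0 Lh; rewrite le_eqVlt => /predU1P[<-|t0].
  rewrite mulr0 oppr0 expR0 subrr (_ : [set _ | _] = set0) ?measure0//.
  by rewrite -subset0 => w /=; rewrite ltNge hitting_time_ge0.
have [C C0 HC] := survival_ge transition_ge0 transition_sum1 k0 hA h1 Lh.
have cvgP : P (dyadic_hit t n) @[n --> \oo] --> P [set w | (tau w < t%:E)%E].
  rewrite hitting_time_lt_dyadic//; apply: nondecreasing_cvg_mu.
  - by move=> n; apply: measurable_dyadic_hit; exact: ltW.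
  - by apply: bigcup_measurable => n _; apply: measurable_dyadic_hit; exact: ltW.
  - exact: dyadic_hit_homo.
rewrite -(cvg_lim _ cvgP)//.
apply/lee_addgt0Pr => e e0; apply: lime_le; first by apply/cvg_ex; eexists; exact: cvgP.
(* All smallness conditions at once: the first two terms are the errors of [expR_pow_ge] and
   [survival_ge], [2 * kappa] yields kappa dt <= 1/2, and 1 yields dt <= 1. *)
pose c := 2 * kappa ^+ 2 * t + C * t + 2 * kappa + 1.
have kt0 : 0 <= 2 * kappa ^+ 2 * t by rewrite !mulr_ge0 ?exprn_ge0 ?(ltW t0).
have Ct0 : 0 <= C * t by rewrite mulr_ge0 ?(ltW t0).
have c0 : 0 < c by rewrite /c; lra.
have m0 : 0 < Num.min e 1 / c by rewrite divr_gt0// lt_min e0 ltr01.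
exists (Num.bound (t / (Num.min e 1 / c))) => // n /= nb.
have := @upper_nthrootP R (t / (Num.min e 1 / c)) n nb.
have n0 : 0 < (2 ^ n)%:R :> R by rewrite ltr0n expn_gt0.
rewrite -natrX ltr_pdivrMr// mulrC -ltr_pdivrMr// ltr_pdivlMr//.
rewrite prob_dyadic_hit ?(ltW t0)//.
set dt := t / (2 ^ n)%:R => dtc.
have dt0 : 0 < dt by rewrite divr_gt0.
have me : Num.min e 1 <= e by rewrite ge_min lexx.
have m1 : Num.min e 1 <= 1 by rewrite ge_min lexx orbT.
have kdt0 : 0 <= kappa * dt by rewrite mulr_ge0// ltW.
have kkdt0 : 0 <= 2 * kappa ^+ 2 * t * dt by rewrite mulr_ge0// ltW.
have Ctdt0 : 0 <= C * t * dt by rewrite mulr_ge0// ltW.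
have dtc' : 2 * kappa ^+ 2 * t * dt + C * t * dt + 2 * (kappa * dt) + dt < Num.min e 1.
  by move: dtc; rewrite /c; lra.
have kdt2 : kappa * dt <= 2^-1 by lra.
have Nle : ((2 ^ n).-1)%:R * dt <= t.
  rewrite /dt mulrCA ger_pMr// ler_pdivrMr// mul1r ler_nat.
  exact: leq_pred.
have dt1 : 0 <= dt <= 1 by rewrite (ltW dt0)/=; lra.
have kdt1 : kappa * dt <= 1 by lra.
have := HC dt (2 ^ n).-1 x0 dt1 kdt1 x0A; rewrite hx0 mulr1.
have := expR_pow_ge k0 (ltW dt0) (ltW t0) kdt2 Nle.
have : ((2 ^ n).-1)%:R * (C * dt ^+ 2) <= C * t * dt.
  rewrite (_ : _ * _ = (((2 ^ n).-1)%:R * dt) * (C * dt)); last by ring.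
  rewrite (_ : C * t * dt = t * (C * dt)); last by ring.
  by rewrite ler_wpM2r// mulr_ge0// ltW.
rewrite -EFinD lee_fin => ? ? ?; lra.
Qed.

(** The event tau <= t lies in tau < t + eta, and eta = e / (kappa + 1) makes the extra cost at most
    e. *)
Lemma prob_hitting_time_gt (kappa : R) (h : S -> R) (t : R) : 0 <= kappa ->
  (forall x, x \in A -> h x = 0) -> (forall x, h x <= 1) -> h x0 = 1 ->
  (forall x, x \notin A -> - kappa * h x <= gen_op r h x) ->
  0 <= t ->
  ((expR (- (kappa * t)))%:E <= P [set w | (t%:E < tau w)%E])%E.
Proof.
move=> k0 hA h1 hx0 Lh t0.
have -> : [set w | (t%:E < tau w)%E] = ~` [set w | (tau w <= t%:E)%E].
  by rewrite predeqE => w /=; rewrite ltNge; split => [/negP|/negP].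
rewrite probability_setC; last exact: measurable_hitting_time_le.
rewrite leeBrDr; last by apply: fin_num_measure; exact: measurable_hitting_time_le.
rewrite -leeBrDl// -EFinB; apply/lee_addgt0Pr => e e0.
pose eta := e / (kappa + 1).
have eta0 : 0 < eta by rewrite divr_gt0// ltr_wpDl.
have := @prob_hitting_time_lt kappa h (t + eta) k0 hA h1 hx0 Lh (addr_ge0 t0 (ltW eta0)).
have sub : (P [set w | (tau w <= t%:E)%E] <= P [set w | (tau w < (t + eta)%:E)%E])%E.
  apply: le_measure.
  - exact/mem_set/measurable_hitting_time_le.
  - exact/mem_set/measurable_hitting_time_lt.
  - by move=> w /= h'; rewrite (le_lt_trans h')// lte_fin ltrDl.
move=> /(le_trans sub)/le_trans; apply; rewrite -EFinD lee_fin.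
rewrite mulrDr opprD expRD.
have := one_sub_le_expR (kappa * eta).
have ke : kappa * eta <= e.
  rewrite mulrC -[leRHS](@divfK _ (kappa + 1)) ?gt_eqF ?ltr_wpDl//.
  by rewrite ler_wpM2l ?(ltW eta0)// lerDl.
have e1 : expR (- (kappa * t)) <= 1 by rewrite -expR0 ler_expR oppr_le0 mulr_ge0.
have e2 := expR_ge0 (- (kappa * t)).
move=> /(ler_wpM2l e2); have ke0 : 0 <= kappa * eta by rewrite mulr_ge0// ltW.
have := ler_wpM2r ke0 e1; lra.
Qed.

Lemma prob_hitting_time_gt_grid (dt : R) (k : nat) : 0 <= dt ->
  (P [set w | ((k%:R * dt)%:E < tau w)%E] <= (survival r A dt k x0)%:E)%E.
Proof.
move=> dt0; rewrite -(prob_avoid_grid HX)//; apply: le_measure.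
- exact/mem_set/measurable_hitting_time_gt.
- apply/mem_set; rewrite (_ : [set _ | _] = [set w | forall u, u \in grid 0 dt k -> X u w \notin A]).
    by apply: (measurable_avoid HX) => u /mem_grid[j jk ->]; rewrite add0r mulr_ge0.
  rewrite predeqE => w; split=> [H u /mem_grid[j jk ->]|H j jk].
    by rewrite add0r; exact: H.
  by apply: H; apply/mem_grid; exists j => //; rewrite add0r.
- move=> w /= kt j jk; apply/negP => Xj.
  have : (tau w <= (j.+1%:R * dt)%:E)%E.
    by apply: ereal_inf_lbound; exists (j.+1%:R * dt) => //; split=> //; rewrite mulr_ge0.
  rewrite leNgt => /negP; apply; apply: le_lt_trans kt.
  by rewrite lee_fin ler_wpM2r// ler_nat.
Qed.

(** Horizontal layers of tau: summed from k = 0 they majorise it, summed from k = 1 they minorise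
    it. *)
Let step (dt : R) (k : nat) w : \bar R :=
  (dt * \1_[set w | ((k%:R * dt)%:E < tau w)%E] w)%:E.

Let step_ge0 dt k w : 0 <= dt -> (0 <= step dt k w)%E.
Proof. by move=> dt0; rewrite lee_fin mulr_ge0. Qed.

Let measurable_step dt k : measurable_fun setT (step dt k).
Proof.
apply/measurable_EFinP; apply: measurable_funM; first exact: measurable_cst.
exact/measurable_indic/measurable_hitting_time_gt.
Qed.

Let integral_step dt k : 0 <= dt ->
  (\int[P]_w step dt k w = dt%:E * P [set w | ((k%:R * dt)%:E < tau w)%E])%E.
Proof.
move=> dt0; rewrite /step.
under eq_integral do rewrite EFinM.
rewrite ge0_integralZl//; last first.
  exact/measurable_EFinP/measurable_indic/measurable_hitting_time_gt.
by rewrite integral_indic// ?setIT//; exact: measurable_hitting_time_gt.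
Qed.

Lemma mean_hitting_time_le (g : S -> R) :
  (forall x, x \in A -> g x = 0) -> (forall x, 0 <= g x) ->
  (forall x, x \notin A -> gen_op r g x = -1) ->
  (\int[P]_w tau w <= (g x0)%:E)%E.
Proof.
move=> gA g0 Lg.
have [C C0 HC] := sum_survival_le transition_ge0 gA g0 Lg.
have main dt : 0 < dt -> dt <= 1 -> C * dt < 1 ->
    (\int[P]_w tau w <= (g x0 / (1 - C * dt))%:E)%E.
  move=> dt0 dt1 Cdt1; have dt0' := ltW dt0.
  rewrite (@le_trans _ _ (\int[P]_w \sum_(0 <= k <oo) step dt k w)%E)//.
    apply: ge0_le_integral => //.
    - by move=> w _; exact: hitting_time_ge0.
    - exact: measurable_hitting_time.
    - apply: ge0_emeasurable_sum => [k w _ _|k _]; first exact: step_ge0.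
      exact: measurable_step.
    (* If the sum s of the layers were below tau, the first truncn(s / dt) + 1 layers would all be
       full, and their sum already exceeds s. *)
    move=> w _; rewrite leNgt; apply/negP => lt.
    have fS : (\sum_(0 <= k <oo) step dt k w)%E \is a fin_num.
      rewrite ge0_fin_numE; last by apply: nneseries_ge0 => k _ _; exact: step_ge0.
      by rewrite (lt_le_trans lt)// leey.
    set s := fine (\sum_(0 <= k <oo) step dt k w)%E.
    have sE : s%:E = (\sum_(0 <= k <oo) step dt k w)%E by rewrite fineK.
    have s0 : 0 <= s.
      by rewrite -lee_fin sE; apply: nneseries_ge0 => k _ _; exact: step_ge0.
    rewrite -sE in lt.
    have := @nneseries_lim_ge R (fun k => step dt k w) xpredT 0%N (Num.truncn (s / dt)).+1
      (fun k _ _ => step_ge0 k w dt0').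
    rewrite -sE leNgt => /negP; apply.
    rewrite big_mkord (eq_bigr (fun=> dt%:E)).
      rewrite sumEFin lte_fin sumr_const card_ord -mulr_natl -ltr_pdivrMr//.
      exact: truncnS_gt.
    move=> k _; rewrite /step indicE mem_set ?mulr1//=.
    apply: le_lt_trans lt; rewrite lee_fin -ler_pdivlMr//.
    rewrite (le_trans (y := (Num.truncn (s / dt))%:R))//.
      by rewrite ler_nat -ltnS.
    by rewrite truncn_le divr_ge0.
  rewrite integral_nneseries//; last first.
    by move=> k w _; exact: step_ge0.
  apply: lime_le.
    apply: is_cvg_nneseries => k _ _; apply: integral_ge0 => w _; exact: step_ge0.
  apply: nearW => n.
  rewrite (@le_trans _ _ (\sum_(0 <= k < n) (dt * survival r A dt k x0)%:E)%E)//.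
    apply: lee_sum => k _; rewrite integral_step// [leRHS]EFinM lee_wpmul2l ?lee_fin//.
    exact: prob_hitting_time_gt_grid.
  rewrite sumEFin lee_fin -mulr_sumr big_mkord ler_pdivlMr ?subr_gt0//.
  rewrite mulrAC mulrBr mulr1.
  have := HC dt n x0; rewrite dt0' dt1 => /(_ isT (ltW Cdt1) x0A).
  by rewrite expr2 mulrCA.
apply/lee_addgt0Pr => e e0.
(* [q] is the inverse of the step; it is so large that g / (1 - C / q) <= g + e at [x0]. *)
pose q := (1 + C) * (g x0 + e) / e.
have gx0 := g0 x0.
have q1 : 1 + C <= q.
  by rewrite /q ler_pdivlMr// ler_wpM2l ?addr_ge0// lerDr.
have q0 : 0 < q by apply: lt_le_trans q1; rewrite ltr_pwDl.
have Cq : C / q < 1 by rewrite ltr_pdivrMr// mul1r (lt_le_trans _ q1)// ltrDr.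
apply: (le_trans (main q^-1 _ _ Cq)).
- by rewrite invr_gt0.
- by rewrite invf_le1// (le_trans _ q1)// lerDl.
rewrite -EFinD lee_fin ler_pdivrMr ?subr_gt0// mulrBr mulr1.
have eq : e * q = (1 + C) * (g x0 + e) by rewrite /q; field; rewrite gt_eqF.
have : (g x0 + e) * (C / q) <= e by rewrite mulrA ler_pdivrMr// eq; lra.
lra.
Qed.

Lemma sum_prob_le_mean (dt : R) (n : nat) : 0 <= dt ->
  (\sum_(k < n) dt%:E * P [set w | ((k.+1%:R * dt)%:E < tau w)%E] <= \int[P]_w tau w)%E.
Proof.
move=> dt0; under eq_bigr do rewrite -integral_step//.
rewrite -(big_mkord xpredT (fun k => \int[P]_w step dt k.+1 w)%E).
rewrite -(ge0_integral_sum P measurableT (fun k => measurable_step dt k.+1)); last first.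
  by move=> k w _; exact: step_ge0.
apply: ge0_le_integral => //.
- by move=> w _; apply: sume_ge0 => k _; exact: step_ge0.
- by apply: emeasurable_sum => k; exact: measurable_step.
- exact: measurable_hitting_time.
(* The bound by n dt is carried along because it settles the case where all layers so far are
   full. *)
move=> w _; suff [] : (\sum_(0 <= k < n) step dt k.+1 w <= tau w)%E /\
    (\sum_(0 <= k < n) step dt k.+1 w <= (n%:R * dt)%:E)%E by [].
elim: n => [|n [IH1 IH2]].
  by rewrite big_geq// mul0r; split=> //; exact: hitting_time_ge0.
have le : (\sum_(0 <= k < n.+1) step dt k.+1 w <= (n.+1%:R * dt)%:E)%E.
  rewrite big_nat_recr//= -natr1 mulrDl mul1r EFinD leeD// lee_fin.
  by rewrite -[leRHS]mulr1 ler_wpM2l// indicE lern1 leq_b1.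
split=> //; have [lt|ge] := ltP (n.+1%:R * dt)%:E (tau w).
  by rewrite (le_trans le)// ltW.
rewrite big_nat_recr//= /step indicE memNset ?mulr0 ?adde0//=.
by apply/negP; rewrite -leNgt.
Qed.

End HittingTime.

(** * Mixing time and spectral gap of reversible chains *)

Section Mixing.
Context {R : realType} {S : finType} (r : S -> S -> R) (mu : S -> R).
Hypothesis r_ge0 : forall x y, 0 <= r x y.
Hypothesis mu_gt0 : forall x, 0 < mu x.
Hypothesis reversible : forall x y, mu x * r x y = mu y * r y x.
Hypothesis mu1 : \sum_x mu x = 1.
Hypothesis transition_ge0 : forall t x y, 0 <= t -> 0 <= transition r t x y.
Hypothesis transition_sum1 : forall t x, 0 <= t -> \sum_y transition r t x y = 1.
Hypothesis chapman_kolmogorov : forall t u x z, 0 <= t -> 0 <= u ->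
  transition r (t + u) x z = \sum_y transition r t x y * transition r u y z.

Definition mean (f : S -> R) : R := \sum_x mu x * f x.

Definition variance (f : S -> R) : R := \sum_x mu x * f x ^+ 2 - mean f ^+ 2.

Definition transition_op (t : R) (f : S -> R) (x : S) : R :=
  \sum_y transition r t x y * f y.

Lemma variance_centered (f : S -> R) :
  variance f = \sum_x mu x * (f x - mean f) ^+ 2.
Proof.
under [RHS]eq_bigr => x _.
  rewrite (_ : _ * _ = mu x * f x ^+ 2 - 2 * mean f * (mu x * f x) + mean f ^+ 2 * mu x); last by ring.
  over.
rewrite big_split sumrB/= -!mulr_sumr mu1 -/(mean f) /variance; ring.
Qed.

Lemma abs_mean_le (f : S -> R) (e : R) : (forall x, `|f x| <= e) -> `|mean f| <= e.
Proof.
move=> fe; rewrite (le_trans (ler_norm_sum _ _ _))//.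
rewrite -[leRHS]mul1r -mu1 mulr_suml; apply: ler_sum => x _.
by rewrite normrM ger0_norm ?ler_wpM2l// ltW.
Qed.

Lemma abs_transition_op_le (t : R) (f : S -> R) (e : R) : 0 <= t ->
  (forall x, `|f x| <= e) -> forall x, `|transition_op t f x| <= e.
Proof.
move=> t0 fe x; rewrite (le_trans (ler_norm_sum _ _ _))//.
rewrite -[leRHS]mul1r -(transition_sum1 x t0) mulr_suml; apply: ler_sum => y _.
by rewrite normrM ger0_norm ?transition_ge0// ler_wpM2l ?transition_ge0.
Qed.

Lemma transition_opD (t u : R) (f : S -> R) (x : S) : 0 <= t -> 0 <= u ->
  transition_op (t + u) f x = transition_op t (transition_op u f) x.
Proof.
move=> t0 u0; rewrite /transition_op.
under eq_bigr do rewrite chapman_kolmogorov// mulr_suml.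
rewrite exchange_big/=; apply: eq_bigr => y _; rewrite mulr_sumr.
by apply: eq_bigr => z _; rewrite mulrA.
Qed.

Let sqrB_le (a b : R) : `|a| <= 1 -> `|b| <= 1 -> a ^+ 2 - b ^+ 2 <= 2 * `|a - b|.
Proof.
move=> a1 b1; rewrite subr_sqr mulrC (le_trans (ler_norm _))// normrM.
rewrite ler_wpM2r// (le_trans (ler_normD _ _))//; lra.
Qed.

(* The constant does not depend on [f], so that the bound can be iterated. *)
Lemma variance_step (c : R) :
  (forall f, c * variance f <= dirichlet_form r mu f f) ->
  exists2 C : R, 0 <= C & forall (f : S -> R) (dt : R), 0 <= dt <= 1 ->
    (forall x, `|f x| <= 1) ->
    `|mean (transition_op dt f) - mean f| <= C * dt ^+ 2 /\
    variance (transition_op dt f) <= (1 - 2 * c * dt) * variance f + C * dt ^+ 2.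
Proof.
move=> poincare; have [C0 C00 HC0] := transition_op_uniform r.
pose n : R := #|S|%:R; pose C := C0 * n.
have C1 : 0 <= C by rewrite mulr_ge0.
pose B := \sum_x \sum_y r x y * 2.
have B0 : 0 <= B by rewrite sumr_ge0// => x _; rewrite sumr_ge0// => y _; rewrite mulr_ge0.
(* (B + C)^2 + 2 C comes from the second moment and 2 C from the square of the mean; [B] bounds L f
   for all [f] bounded by 1. *)
exists ((B + C) ^+ 2 + 4 * C) => [|f dt dt01 f1].
  by rewrite addr_ge0 ?sqr_ge0// mulr_ge0.
have /andP[dt0 dt1] := dt01.
set g := transition_op dt f.
have d2 : 0 <= dt ^+ 2 by rewrite sqr_ge0.
have Cd2 : 0 <= C * dt ^+ 2 by rewrite mulr_ge0.
have gE x : `|g x - (f x + dt * gen_op r f x)| <= C * dt ^+ 2.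
  rewrite (le_trans (HC0 f dt x dt01))// mulrAC ler_wpM2r// ler_wpM2l//.
  by rewrite (le_trans (ler_sum _ (fun y _ => f1 y)))// sumr_const.
have LB x : `|gen_op r f x| <= B.
  rewrite (le_trans (ler_norm_sum _ _ _))// (le_trans (y := \sum_y r x y * 2))//.
    apply: ler_sum => y _; rewrite normrM ger0_norm// ler_wpM2l//.
    by rewrite (le_trans (ler_normB _ _))//; have := f1 x; have := f1 y; lra.
  by rewrite /B [leRHS](bigD1 x)//= lerDl sumr_ge0// => y _; rewrite sumr_ge0// => z _; rewrite mulr_ge0.
have mg : `|mean g - mean f| <= C * dt ^+ 2.
  have -> : mean g - mean f = mean (fun x => g x - (f x + dt * gen_op r f x)).
    rewrite /mean; under [RHS]eq_bigr do rewrite mulrBr mulrDr mulrCA.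
    by rewrite sumrB big_split/= -mulr_sumr sum_gen_op// mulr0 addr0.
  exact: abs_mean_le.
have C4 : C <= (B + C) ^+ 2 + 4 * C by have := sqr_ge0 (B + C); lra.
split; first by rewrite (le_trans mg)// ler_wpM2r.
have g1 := abs_transition_op_le dt0 f1.
have m2 : mean f ^+ 2 - mean g ^+ 2 <= 2 * (C * dt ^+ 2).
  rewrite (le_trans (sqrB_le _ _)) ?abs_mean_le// distrC; lra.
have sq : \sum_x mu x * g x ^+ 2 <= \sum_x mu x * f x ^+ 2
    - 2 * dt * dirichlet_form r mu f f + ((B + C) ^+ 2 + 2 * C) * dt ^+ 2.
  rewrite -(dirichlet_formE reversible) mulr_sumr -sumrB -lerBlDl -subr_le0 -sumrB.
  (* The constant is written as an average under [mu], so that the inequality can be checked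
     pointwise. *)
  have KE K : K = \sum_x K * mu x by rewrite -mulr_sumr mu1 mulr1.
  rewrite [X in _ - X]KE -sumrB; apply: sumr_le0 => x _.
  rewrite [leLHS](_ : _ = mu x * (g x ^+ 2 - (f x ^+ 2 + 2 * dt * (f x * gen_op r f x)) - ((B + C) ^+ 2 + 2 * C) * dt ^+ 2)); last by ring.
  rewrite pmulr_rle0//.
  have h1 : `|g x - f x| <= (B + C) * dt.
    have -> : g x - f x = (g x - (f x + dt * gen_op r f x)) + dt * gen_op r f x by ring.
    rewrite (le_trans (ler_normD _ _))// normrM (ger0_norm dt0).
    have := gE x; have := ler_wpM2l dt0 (LB x).
    have : C * dt ^+ 2 <= C * dt by rewrite ler_wpM2l// expr2 -[leRHS]mulr1 ler_wpM2l.
    lra.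
  have h2 : (g x - f x) ^+ 2 <= (B + C) ^+ 2 * dt ^+ 2.
    rewrite -exprMn -real_normK ?num_real// lerXn2r// nnegrE//.
    by rewrite mulr_ge0// addr_ge0.
  have h3 : f x * (g x - (f x + dt * gen_op r f x)) <= C * dt ^+ 2.
    rewrite (le_trans (ler_norm _))// normrM -[leRHS]mul1r ler_pM//.
  have : g x ^+ 2 - (f x ^+ 2 + 2 * dt * (f x * gen_op r f x)) = (g x - f x) ^+ 2
      + 2 * (f x * (g x - (f x + dt * gen_op r f x))) by ring.
  lra.
have p := poincare f; rewrite /variance.
have := ler_wpM2l dt0 p; rewrite /variance; lra.
Qed.

(** Iteration of [variance_step] over k steps of length t / k: the total error C t^2 / k vanishes in
    the limit, and every intermediate function is still bounded by 1. *)
Lemma variance_decay (c t : R) (f : S -> R) : 0 <= c -> 0 <= t ->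
  (forall f, c * variance f <= dirichlet_form r mu f f) ->
  (forall x, `|f x| <= 1) ->
  mean (transition_op t f) = mean f /\
  variance (transition_op t f) <= expR (- (2 * c * t)).
Proof.
move=> c0 t0 /variance_step[C C0 HC] f1.
have iter (dt : R) (n : nat) : 0 <= dt <= 1 -> 2 * c * dt <= 1 ->
    `|mean (transition_op (n%:R * dt) f) - mean f| <= n%:R * (C * dt ^+ 2) /\
    variance (transition_op (n%:R * dt) f) <= expR (- (2 * c * (n%:R * dt))) + n%:R * (C * dt ^+ 2).
  move=> dt01 cdt; have dt0 : 0 <= dt by case/andP: dt01.
  have Cd0 : 0 <= C * dt ^+ 2 by rewrite mulr_ge0 ?sqr_ge0.
  elim: n => [|n [IH1 IH2]].
    rewrite !mul0r mulr0 oppr0 expR0 addr0.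
    have T0 : transition_op 0 f = f.
      apply/funext => x; rewrite /transition_op.
      have [C' C'0 HC'] := transition_op_first_order r f.
      have := HC' 0 x; rewrite lexx ler01 => /(_ isT).
      by rewrite expr2 !mul0r mulr0 addr0 normr_le0 subr_eq0 => /eqP.
    rewrite T0 subrr normr0; split=> //.
    have : \sum_x mu x * f x ^+ 2 <= 1.
      rewrite -mu1; apply: ler_sum => x _.
      by rewrite ger_pMr// -real_normK ?num_real// exprn_ile1.
    by rewrite /variance; have := sqr_ge0 (mean f); lra.
  have -> : n.+1%:R * dt = dt + n%:R * dt by rewrite mulrS mulrDl mul1r.
  set g := transition_op (n%:R * dt) f in IH1 IH2 *.
  have ndt0 : 0 <= n%:R * dt by rewrite mulr_ge0.
  have -> : transition_op (dt + n%:R * dt) f = transition_op dt g.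
    by apply/funext => x; rewrite transition_opD.
  have [H1 H2] := HC g dt dt01 (abs_transition_op_le ndt0 f1).
  split.
    rewrite (le_trans (ler_distD (mean g) _ _))// -natr1 mulrDl mul1r; lra.
  rewrite (le_trans H2)//.
  have e1 := one_sub_le_expR (2 * c * dt).
  have q0 : 0 <= 1 - 2 * c * dt by rewrite subr_ge0.
  have := ler_wpM2l q0 IH2; rewrite mulrDr.
  have -> : - (2 * c * (dt + n%:R * dt)) = - (2 * c * dt) - (2 * c * (n%:R * dt)) by ring.
  rewrite expRD -[n.+1%:R]natr1 [(n%:R + 1) * _]mulrDl mul1r.
  have := ler_wpM2r (expR_ge0 (- (2 * c * (n%:R * dt)))) e1.
  have : (1 - 2 * c * dt) * (n%:R * (C * dt ^+ 2)) <= n%:R * (C * dt ^+ 2).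
    by rewrite ler_piMl ?mulr_ge0// gerBl !mulr_ge0.
  lra.
have limit (e : R) : 0 < e -> `|mean (transition_op t f) - mean f| <= e /\
    variance (transition_op t f) <= expR (- (2 * c * t)) + e.
  move=> e0.
  (* The three summands give t / k <= 1, 2 c t / k <= 1 and a total error at most e. *)
  pose k := (Num.truncn (t + 2 * c * t + C * t ^+ 2 / e)).+1.
  have kgt : t + 2 * c * t + C * t ^+ 2 / e < k%:R by exact: truncnS_gt.
  have k0 : 0 < k%:R :> R by rewrite ltr0n.
  have ct0 : 0 <= 2 * c * t by rewrite !mulr_ge0.
  have Ct0 : 0 <= C * t ^+ 2 by rewrite mulr_ge0 ?sqr_ge0.
  have Cte0 : 0 <= C * t ^+ 2 / e by rewrite divr_ge0// ltW.
  have := iter (t / k%:R) k.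
  have -> : k%:R * (t / k%:R) = t by rewrite mulrC divfK// gt_eqF.
  have small : k%:R * (C * (t / k%:R) ^+ 2) <= e.
    rewrite (_ : _ * _ = C * t ^+ 2 / k%:R); last by field; rewrite gt_eqF.
    rewrite ler_pdivrMr// [leRHS]mulrC -ler_pdivrMr//; lra.
  move=> /(_ _ _)[].
  - rewrite divr_ge0//= ler_pdivrMr// mul1r; lra.
  - rewrite mulrA ler_pdivrMr// mul1r; lra.
  by move=> H1 H2; split; [exact: le_trans H1 small|lra].
split.
  apply/eqP; rewrite -subr_eq0 -normr_le0; apply/ler_addgt0Pr => e e0.
  by rewrite add0r; case: (limit e e0).
by apply/ler_addgt0Pr => e e0; case: (limit e e0).
Qed.

(** A single term of a variance bounds it from below: for an event A with indicator f, mu(x) (P_t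
    f(x) - mu(A))^2 <= Var(P_t f) <= exp(- 2 c t). *)
Lemma mixed_after (c t eps : R) : 0 <= c -> 0 <= t -> 0 <= eps ->
  (forall f, c * variance f <= dirichlet_form r mu f f) ->
  (forall x, expR (- (2 * c * t)) <= eps ^+ 2 * mu x) ->
  \big[Num.max/0]_(x : S) tv_dist (transition r t x) mu <= eps.
Proof.
move=> c0 t0 e0 poincare He.
apply: bigmax_le => // x _; apply: bigmax_le => // A _.
pose f (y : S) : R := (y \in A)%:R.
have f1 y : `|f y| <= 1 by rewrite /f; case: (y \in A); rewrite ?normr1// normr0.
have [mE vE] := variance_decay c0 t0 poincare f1.
have -> : \sum_(a in A) transition r t x a = transition_op t f x.
  rewrite big_mkcond; apply: eq_bigr => y _; rewrite /f.
  by case: (y \in A); rewrite ?mulr1 ?mulr0.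
have -> : \sum_(a in A) mu a = mean f.
  rewrite big_mkcond; apply: eq_bigr => y _; rewrite /f.
  by case: (y \in A); rewrite ?mulr1 ?mulr0.
rewrite -(@ler_pXn2r _ 2)// ?nnegrE// real_normK ?num_real//.
rewrite -(ler_pM2l (mu_gt0 x)) [leRHS]mulrC (le_trans _ (He x))//.
rewrite (le_trans _ vE)// variance_centered mE (bigD1 x)//= lerDl.
by rewrite sumr_ge0// => y _; rewrite mulr_ge0 ?sqr_ge0// ltW.
Qed.

End Mixing.

(** * Rayleigh quotients and the spectral gap *)

Section SpectralGap.
Context {R : realType} {S : finType} (r : S -> S -> R) (mu : S -> R).
Hypothesis r_ge0 : forall x y, 0 <= r x y.
Hypothesis mu_gt0 : forall x, 0 < mu x.
Hypothesis reversible : forall x y, mu x * r x y = mu y * r y x.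
Hypothesis mu1 : \sum_x mu x = 1.
Local Notation E f := (dirichlet_form r mu f f).

(** [eigenvalue] concerns row vectors, that is, measures; detailed balance turns the measure mu f
    into the function f. *)
Lemma eigenvector_generator (l : R) (v : 'rV[R]_#|S|) (f : S -> R) :
  (forall x, v 0 (enum_rank x) = mu x * f x) ->
  (v *m (- generator_mx r) = l *: v) <-> (forall x, - gen_op r f x = l * f x).
Proof.
move=> vf.
have vE y : (v *m (- generator_mx r)) 0 (enum_rank y) = mu y * - gen_op r f y.
  rewrite mxE -sum_generator (reindex (@enum_rank S))/=; last exact/onW_bij/enum_rank_bij.
  rewrite mulrN mulr_sumr -sumrN; apply: eq_bigr => x _.
  rewrite vf !mxE !enum_rankK mulrN; congr (- _).
  rewrite mulrAC /generator [y == x]eq_sym; case: eqVneq => [->|_]; first by ring.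
  by rewrite reversible; ring.
split=> [H x|H].
  have := vE x; rewrite H mxE vf mulrCA => /mulfI.
  by move=> <-//; rewrite gt_eqF.
apply/rowP => i; rewrite -(enum_valK i) vE mxE vf H; ring.
Qed.

(** Since L f has mean zero, an eigenfunction with l != 0 is centred, and its Dirichlet form is l
    times its variance. *)
Lemma eigenvalue_ge (c l : R) :
  (forall f, c * variance mu f <= E f) -> l != 0 ->
  eigenvalue (- generator_mx r) l -> c <= l.
Proof.
move=> poincare l0 /eigenvalueP[v vl v0].
pose f x := v 0 (enum_rank x) / mu x.
have vf x : v 0 (enum_rank x) = mu x * f x by rewrite mulrC divfK// gt_eqF.
have Lf := (eigenvector_generator l vf).1 vl.
have m0 : mean mu f = 0.
  apply: (mulfI l0); rewrite mulr0 /mean mulr_sumr.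
  transitivity (- \sum_x mu x * gen_op r f x); last by rewrite sum_gen_op// oppr0.
  by rewrite -sumrN; apply: eq_bigr => x _; rewrite mulrCA -Lf mulrN.
have Ef : E f = l * variance mu f.
  rewrite -(dirichlet_formE reversible) /variance m0 expr2 mul0r subr0 mulr_sumr.
  by apply: eq_bigr => x _; rewrite Lf; ring.
have := poincare f; rewrite Ef ler_pM2r// /variance m0 expr2 mul0r subr0.
have [x fx] : exists x, f x != 0.
  apply: contrapT => nf; move/eqP: v0; apply; apply/rowP => i; rewrite mxE -(enum_valK i) vf.
  have -> : f (enum_val i) = 0 by apply/eqP; apply: contra_notT nf => ?; exists (enum_val i).
  by rewrite mulr0.
rewrite (bigD1 x)//= ltr_pwDl//.
  by rewrite mulr_gt0// exprn_even_gt0.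
by rewrite sumr_ge0// => y _; rewrite mulr_ge0 ?sqr_ge0// ltW.
Qed.

Lemma continuous_coord (n : nat) (i : 'I_n) : continuous (fun v : 'rV[R]_n => v 0 i).
Proof. by move=> v; exact: coord_continuous. Qed.

Lemma continuous_sum (T : topologicalType) (I : Type) (s : seq I) (F : I -> T -> R) :
  (forall i, continuous (F i)) -> continuous (fun v => \sum_(i <- s) F i v).
Proof.
move=> cF; elim: s => [|i s IH] v.
  by under eq_fun do rewrite big_nil; exact: cvg_cst.
under eq_fun do rewrite big_cons; apply: (@cvgD _ R^o); [exact: cF|exact: IH].
Qed.

Definition coord_fun (v : 'rV[R]_#|S|) (x : S) : R := v 0 (enum_rank x).

Definition unit_sphere : set 'rV[R]_#|S| := [set v |
  mean mu (coord_fun v) = 0 /\ \sum_x mu x * coord_fun v x ^+ 2 = 1].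

Let continuous_mul (f g : 'rV[R]_#|S| -> R) :
  continuous f -> continuous g -> continuous (fun v => f v * g v).
Proof. by move=> cf cg v; apply: (@continuousM R _ f g v); [exact: cf|exact: cg]. Qed.

Let continuous_const (a : R) : continuous (fun _ : 'rV[R]_#|S| => a).
Proof. exact: cst_continuous. Qed.

Let continuous_coord_fun x : continuous (fun v => coord_fun v x).
Proof. exact: continuous_coord. Qed.

Let continuous_mean : continuous (fun v => mean mu (coord_fun v)).
Proof. by apply: continuous_sum => x; exact: continuous_mul. Qed.

Let continuous_normsq : continuous (fun v => \sum_x mu x * coord_fun v x ^+ 2).
Proof.
by apply: continuous_sum => x; apply: continuous_mul => //; exact: continuous_mul.
Qed.

Let continuous_dirichlet : continuous (fun v => E (coord_fun v)).
Proof.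
apply: continuous_mul => //; apply: continuous_sum => x; apply: continuous_sum => y.
have c : continuous (fun v => coord_fun v y - coord_fun v x).
  by move=> u; apply: (@continuousB R R^o _ (coord_fun ^~ y) (coord_fun ^~ x) u); exact: continuous_coord_fun.
by apply: continuous_mul => //; exact: continuous_mul.
Qed.

(** A closed subset of a box: one term of the norm gives v(x)^2 <= 1 / mu(x) <= B, hence |v(x)| <= 1
    + B without square roots. *)
Lemma compact_unit_sphere : compact unit_sphere.
Proof.
pose B : R := \sum_x (mu x)^-1.
have B0 : 0 <= B by rewrite sumr_ge0// => x _; rewrite invr_ge0 ltW.
apply: (@subclosed_compact _ _ [set v : 'rV[R]_#|S| |
    forall i, `[- (1 + B), 1 + B]%classic (v 0 i)]).
- apply: (@closedI _ [set v | mean mu (coord_fun v) = 0]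
    [set v | \sum_x mu x * coord_fun v x ^+ 2 = 1]).
    apply: (@preimage_closed _ _ (fun v => mean mu (coord_fun v)) [set 0 : R]).
      by move=> v _; exact: continuous_mean.
    exact: closed_eq.
  apply: (@preimage_closed _ _ (fun v => \sum_x mu x * coord_fun v x ^+ 2) [set 1 : R]).
    by move=> v _; exact: continuous_normsq.
  exact: closed_eq.
- by apply: (@rV_compact R _ (fun=> `[- (1 + B), 1 + B]%classic)) => i; exact: segment_compact.
- move=> v [_ v1] i; rewrite /= in_itv/= -ler_norml -(enum_valK i) -/(coord_fun v _).
  set x := enum_val i.
  have : coord_fun v x ^+ 2 <= B.
    rewrite (le_trans (y := (mu x)^-1))//.
      rewrite -[leRHS]mulr1 ler_pdivlMl// -v1 (bigD1 x)//= lerDl sumr_ge0// => y _.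
      by rewrite mulr_ge0 ?sqr_ge0// ltW.
    by rewrite /B (bigD1 x)//= lerDl sumr_ge0// => y _; rewrite invr_ge0 ltW.
  rewrite -real_normK ?num_real// => h.
  have [a1|a1] := leP `|coord_fun v x| 1; first lra.
  have := ler_wpM2l (normr_ge0 (coord_fun v x)) (ltW a1); rewrite mulr1 -expr2; lra.
Qed.

(* The minimiser of the Rayleigh quotient among centred functions is an eigenvector. *)
Lemma minimal_eigenvalue (f : S -> R) : 0 < variance mu f ->
  exists l, [/\ eigenvalue (- generator_mx r) l, l <= E f / variance mu f &
    exists g, variance mu g = 1 /\ l = E g].
Proof.
move=> vf0.
pose row (g : S -> R) : 'rV[R]_#|S| := \row_i g (enum_val i).
have rowK g : coord_fun (row g) = g.
  by apply/funext => x; rewrite /coord_fun mxE enum_rankK.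
have meanZ a g : mean mu (fun x => a * g x) = a * mean mu g.
  by rewrite /mean mulr_sumr; apply: eq_bigr => x _; ring.
have meanB g a : mean mu (fun x => g x - a) = mean mu g - a.
  rewrite /mean; under eq_bigr do rewrite mulrBr.
  by rewrite sumrB -mulr_suml mu1 mul1r.
have EZ a g : E (fun x => a * g x) = a ^+ 2 * E g.
  rewrite /dirichlet_form mulrCA; congr (_ * _); rewrite mulr_sumr.
  apply: eq_bigr => x _; rewrite mulr_sumr; apply: eq_bigr => y _; ring.
have EB a g : E (fun x => g x - a) = E g.
  congr (_ * _); apply: eq_bigr => x _; apply: eq_bigr => y _; ring.
have ray g : mean mu g = 0 -> 0 < \sum_x mu x * g x ^+ 2 ->
    unit_sphere (row (fun x => (Num.sqrt (\sum_x mu x * g x ^+ 2))^-1 * g x)).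
  move=> mg ng; set n := \sum_x _ in ng *; rewrite /unit_sphere /= rowK; split.
    by rewrite meanZ mg mulr0.
  under eq_bigr do rewrite exprMn mulrCA.
  by rewrite -mulr_sumr exprVn sqr_sqrtr ?ltW// mulVf// gt_eqF.
have Eray g : 0 <= \sum_x mu x * g x ^+ 2 ->
    E (fun x => (Num.sqrt (\sum_x mu x * g x ^+ 2))^-1 * g x) =
    E g / \sum_x mu x * g x ^+ 2.
  by move=> ng; rewrite EZ exprVn sqr_sqrtr// mulrC.
pose f0 x := f x - mean mu f.
have f0m : mean mu f0 = 0 by rewrite meanB subrr.
have f0v : \sum_x mu x * f0 x ^+ 2 = variance mu f by rewrite (variance_centered mu1).
have ne : unit_sphere !=set0.
  by eexists; apply: (ray f0) => //; rewrite f0v.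
have [v0 v0S vmin] := EVT_min_rV ne compact_unit_sphere
  (continuous_subspaceT continuous_dirichlet).
rewrite inE in v0S; have [m0 n0] := v0S.
set h := coord_fun v0 in m0 n0 vmin *; pose l := E h.
have hv : variance mu h = 1 by rewrite /variance m0 n0 expr2 mul0r subr0.
have quad g : mean mu g = 0 -> l * (\sum_x mu x * g x ^+ 2) <= E g.
  move=> mg; have [n0g|n0g] := leP (\sum_x mu x * g x ^+ 2) 0.
    by rewrite (le_trans _ (dirichlet_form_ge0 r_ge0 mu_gt0 g))// mulr_ge0_le0// dirichlet_form_ge0.
  rewrite -ler_pdivlMr// -(Eray _ (ltW n0g)).
  have := vmin (row (fun x => (Num.sqrt (\sum_x mu x * g x ^+ 2))^-1 * g x)).
  by rewrite inE rowK; apply; exact: ray.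
have lf : l <= E f / variance mu f.
  by rewrite ler_pdivlMr// -f0v (le_trans (quad _ f0m))// EB.
exists l; split=> //; last by exists h.
(* The residual of the eigenvalue equation. It is centred, so h + e w is an admissible variation of
   the minimiser for every e. *)
pose w x := - gen_op r h x - l * h x.
have mw : mean mu w = 0.
  rewrite /mean /w; under eq_bigr do rewrite mulrBr mulrN mulrCA.
  by rewrite sumrB sumrN sum_gen_op// oppr0 sub0r -mulr_sumr -/(mean mu h) m0 mulr0 oppr0.
have wE : dirichlet_form r mu w h - l * (\sum_x mu x * (w x * h x)) =
    \sum_x mu x * w x ^+ 2.
  rewrite -(dirichlet_formE reversible) mulr_sumr -sumrB; apply: eq_bigr => x _.
  rewrite expr2 {3}/w; ring.
have var e : 0 <= 2 * e * (\sum_x mu x * w x ^+ 2) +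
    e ^+ 2 * (E w - l * \sum_x mu x * w x ^+ 2).
  have mhe : mean mu (fun x => h x + e * w x) = 0.
    rewrite /mean; under eq_bigr do rewrite mulrDr.
    by rewrite big_split/= -/(mean mu h) m0 add0r -/(mean mu (fun x => e * w x)) meanZ mw mulr0.
  have := quad _ mhe.
  have -> : E (fun x => h x + e * w x) = l + 2 * e * dirichlet_form r mu w h + e ^+ 2 * E w.
    rewrite /l /dirichlet_form !(mulrCA _ (2^-1)) -!mulrDr; congr (_ * _).
    rewrite !mulr_sumr -!big_split/=; apply: eq_bigr => x _.
    rewrite !mulr_sumr -!big_split/=; apply: eq_bigr => y _; ring.
  have -> : \sum_x mu x * (h x + e * w x) ^+ 2 =
      1 + 2 * e * (\sum_x mu x * (w x * h x)) + e ^+ 2 * \sum_x mu x * w x ^+ 2.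
    rewrite -[X in X + _ + _]n0 !mulr_sumr -!big_split/=.
    by apply: eq_bigr => x _; ring.
  by rewrite -wE; lra.
have W0 : \sum_x mu x * w x ^+ 2 = 0.
  set W := \sum_x _ in var *; have W0 : 0 <= W.
    by rewrite sumr_ge0// => x _; rewrite mulr_ge0 ?sqr_ge0// ltW.
  apply/eqP; rewrite eq_le W0 andbT leNgt; apply/negP => Wgt.
  pose D := `|E w - l * W| + 1.
  have D0 : 0 < D by rewrite ltr_wpDl.
  (* As D exceeds |E w - l W|, the second order term cannot compensate the negative first order
     term. *)
  have := var (- (W / D)).
  have -> : 2 * - (W / D) * W + (- (W / D)) ^+ 2 * (E w - l * W) =
    (W / D) ^+ 2 * ((E w - l * W) - 2 * D) by field; rewrite gt_eqF.
  rewrite pmulr_rge0 ?exprn_gt0 ?divr_gt0// leNgt => /negP; apply.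
  by have := normr_ge0 (E w - l * W); have := ler_norm (E w - l * W); rewrite /D; lra.
have Lh x : - gen_op r h x = l * h x.
  have W0x := psumr_eq0P (fun x _ => mulr_ge0 (ltW (mu_gt0 x)) (sqr_ge0 (w x))) W0.
  have /eqP : mu x * w x ^+ 2 = 0 by exact: W0x.
  by rewrite mulf_eq0 gt_eqF//= sqrf_eq0 subr_eq0 => /eqP.
apply/eigenvalueP; exists (row (fun x => mu x * h x)).
  by apply/(eigenvector_generator _ (f := h)) => // x; rewrite mxE enum_rankK.
apply/eqP => /rowP z; have : \sum_x mu x * h x ^+ 2 = 0.
  rewrite big1// => x _; have := z (enum_rank x); rewrite !mxE enum_rankK => hx.
  by rewrite expr2 mulrA hx mul0r.
by rewrite n0 => /eqP; rewrite oner_eq0.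
Qed.

(** The minimiser has variance 1, so the Poincare inequality puts its eigenvalue above c > 0; being
    nonzero, this eigenvalue belongs to the set whose infimum is the gap. *)
Lemma spectral_gap_bounds (c : R) (f : S -> R) : 0 < c ->
  (forall f, c * variance mu f <= E f) -> 0 < variance mu f ->
  c <= spectral_gap r <= E f / variance mu f.
Proof.
move=> c0 poincare vf0.
have [l [el lf [g [vg lg]]]] := minimal_eigenvalue vf0.
have lc : c <= l by have := poincare g; rewrite vg mulr1 lg.
have l0 : l != 0 by rewrite gt_eqF// (lt_le_trans c0).
apply/andP; split.
  apply: lb_le_inf; first by exists l.
  by move=> l' [l'0 el']; exact: eigenvalue_ge poincare l'0 el'.
apply: le_trans lf; apply: ge_inf => //.
by exists c => l' [l'0 el']; exact: eigenvalue_ge poincare l'0 el'.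
Qed.

End SpectralGap.

(** * Energy landscape of the Potts model *)

Section ConnectHomo.
Context {T T' : finType} (e : rel T) (e' : rel T') (f : T -> T').

Lemma connect_homo : (forall x y, e x y -> connect e' (f x) (f y)) ->
  forall x y, connect e x y -> connect e' (f x) (f y).
Proof.
move=> ef x y /connectP[p ep ->]; elim: p x ep => [|z p IH] x //= /andP[xz pz].
exact: connect_trans (ef _ _ xz) (IH _ pz).
Qed.

End ConnectHomo.

Section Landscape.
Context (bc : boundary) (K L M q : nat).
Local Notation site := (site K L M).
Local Notation config := (config K L M q).
Local Notation H := (@hamiltonian bc K L M q).
Implicit Types (s z w : config) (a b : 'I_q) (h : nat).

Definition recolor (p : {perm 'I_q}) s : config := [ffun x => p (s x)].

Lemma recolor_bij p : bijective (recolor p).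
Proof.
exists (recolor (p^-1)%g) => s; apply/ffunP => x; rewrite !ffunE.
  exact: permK.
exact: permKV.
Qed.

Lemma hamiltonian_recolor p s : H (recolor p s) = H s.
Proof.
apply: eq_card => e; rewrite !inE; apply: eq_existsb => x; apply: eq_existsb => y.
by rewrite !ffunE (inj_eq perm_inj).
Qed.

Lemma recolor_monochromatic p a : recolor p (monochromatic K L M a) = monochromatic K L M (p a).
Proof. by apply/ffunP => x; rewrite !ffunE. Qed.

Lemma differ_at_one_site_recolor p s z :
  differ_at_one_site (recolor p s) (recolor p z) = differ_at_one_site s z.
Proof.
congr (_ == _); apply: eq_card => x; rewrite !inE !ffunE.
by rewrite (inj_eq perm_inj).
Qed.

Lemma differ_at_one_site_sym s z : differ_at_one_site s z = differ_at_one_site z s.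
Proof. by congr (_ == _); apply: eq_card => x; rewrite !inE eq_sym. Qed.

Lemma differ_at_one_siteE s z :
  [exists x, exists a, (z == update s x a) && (z != s)] = differ_at_one_site s z.
Proof.
apply/existsP/idP => [[x /existsP[a /andP[/eqP -> ne]]]|/cards1P[x xE]].
  apply/cards1P; exists x; apply/setP => y; rewrite !inE !ffunE.
  have [->|] := eqVneq y x; last by rewrite eqxx.
  apply: contraNneq ne => e; apply/eqP/ffunP => y'; rewrite ffunE.
  by case: eqVneq => // ->; rewrite e.
exists x; apply/existsP; exists (z x); apply/andP; split.
  apply/eqP/ffunP => y; rewrite ffunE; have [->//|yx] := eqVneq y x.
  have : y \notin [set x | s x != z x]%SET by rewrite xE inE.
  by rewrite inE negbK => /eqP.
have : x \in [set x | s x != z x]%SET by rewrite xE inE.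
by rewrite inE; apply: contraNneq => ->.
Qed.

Lemma hamiltonian_monochromatic a : H (monochromatic K L M a) = 0.
Proof.
apply: eq_card0 => e; rewrite !inE; apply/negbTE/existsPn => x; apply/existsPn => y.
by rewrite !ffunE eqxx !andbF.
Qed.

Lemma hamiltonian_eq0 s x y : H s = 0 -> nearest_neighbours bc x y -> s x = s y.
Proof.
move=> Hs nn; apply/eqP; apply: contraTT isT => ne.
suff : (0 < H s)%N by rewrite Hs.
apply/card_gt0P; exists [set x; y]%SET; rewrite inE.
by apply/existsP; exists x; apply/existsP; exists y; rewrite eqxx nn ne.
Qed.

Lemma adjacentS (n : nat) (i j : 'I_n) : i.+1 = j :> nat -> Defs.adjacent bc i j.
Proof.
move=> ij; rewrite /Defs.adjacent; case: bc; first by rewrite ij eqxx.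
by rewrite ij modn_small ?eqxx.
Qed.

Lemma adjacent_constant (n : nat) (T : Type) (f : 'I_n -> T) :
  (forall i j, Defs.adjacent bc i j -> f i = f j) -> forall i j, f i = f j.
Proof.
move=> fadj; case: n f fadj => [|n] f fadj; first by case.
suff f0 k (kn : (k < n.+1)%N) : f (Ordinal kn) = f ord0.
  by move=> [i ip] [j jp]; rewrite !f0.
elim: k kn => [|k IH] kn; first by congr f; apply: val_inj.
rewrite -(IH (ltnW kn)); apply/esym/fadj/adjacentS => //.
Qed.

Lemma hamiltonian_gt0 s : site -> s \notin ground_states K L M q -> (0 < H s)%N.
Proof.
move=> x0; apply: contraR; rewrite -eqn0Ngt => /eqP Hs.
apply/imsetP; exists (s x0) => //; apply/ffunP => -[[i j] k]; rewrite ffunE.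
case: x0 => -[i0 j0] k0.
have e1 : s (i, j, k) = s (i0, j, k).
  apply: (adjacent_constant (f := fun i => s (i, j, k))) => u v uv.
  by apply: hamiltonian_eq0 => //; rewrite /nearest_neighbours/= uv !eqxx.
have e2 : s (i0, j, k) = s (i0, j0, k).
  apply: (adjacent_constant (f := fun j => s (i0, j, k))) => u v uv.
  by apply: hamiltonian_eq0 => //; rewrite /nearest_neighbours/= uv !eqxx/= orbT.
rewrite e1 e2.
apply: (adjacent_constant (f := fun k => s (i0, j0, k))) => u v uv.
by apply: hamiltonian_eq0 => //; rewrite /nearest_neighbours/= uv !eqxx/= !orbT.
Qed.

(** The bound is strict, so that [edge G.+1] allows height G and [edge G] forbids it: both halves of
    the definition of Gamma use one relation. *)
Definition edge h : rel config :=
  [rel s z | [&& differ_at_one_site s z, (H s < h)%N & (H z < h)%N]].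

Lemma edge_sym h : symmetric (edge h).
Proof.
by move=> s z; rewrite /edge /= differ_at_one_site_sym [(H s < h)%N && _]andbC.
Qed.

Lemma connect_edge_sym h s z : connect (edge h) s z = connect (edge h) z s.
Proof. by apply: sym_connect_sym; exact: edge_sym. Qed.

Lemma connect_edge_le h h' s z : (h <= h')%N -> connect (edge h) s z -> connect (edge h') s z.
Proof.
move=> hh'; apply: (connect_homo (f := id)) => u v /and3P[uv hu hv].
by apply: connect1; rewrite /edge/= uv !(leq_trans _ hh').
Qed.

Lemma connect_edge_recolor p h s z : connect (edge h) s z ->
  connect (edge h) (recolor p s) (recolor p z).
Proof.
apply: connect_homo => u v uv; apply: connect1.
by rewrite /edge/= differ_at_one_site_recolor !hamiltonian_recolor.
Qed.

Lemma connect_differ s z : connect (@differ_at_one_site K L M q) s z.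
Proof.
have [n le] := ubnP #|[set x | s x != z x]%SET|.
elim: n s le => // n IH s le.
have [->//|/eqP ne] := eqVneq s z.
have [x sx] : exists x, s x != z x.
  apply: contrapT => nx; apply: ne; apply/ffunP => x; apply/eqP.
  by apply: contra_notT nx => ?; exists x.
apply: (connect_trans (y := update s x (z x))).
  apply: connect1; rewrite -differ_at_one_siteE.
  apply/existsP; exists x; apply/existsP; exists (z x); rewrite eqxx/=.
  by apply: contra_neq sx => /ffunP/(_ x); rewrite ffunE eqxx.
apply: IH; rewrite -ltnS (leq_trans _ le)// ltnS; apply: proper_card.
apply/properP; split; last by exists x; rewrite !inE ?sx// ffunE eqxx negbK.
apply/fintype.subsetP => y; rewrite !inE ffunE; case: (eqVneq y x) => [->|//].
by rewrite eqxx.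
Qed.

Lemma connect_edge_max s z : connect (edge (\max_w H w).+1) s z.
Proof.
have := connect_differ s z; apply: (connect_homo (f := id)) => u v uv.
by apply: connect1; rewrite /edge/= uv !ltnS !leq_bigmax.
Qed.

(** While [z] moves from the ground state of a spin b != a to that of [a], the overlay moves from
    [s] to the ground state of [a]. *)
Definition overlay s z a : config := [ffun x => if z x == a then a else s x].

(** Where both [s] and [z] agree along an edge, so does the overlay. *)
Lemma hamiltonian_overlay s z a : (H (overlay s z a) <= H s + H z)%N.
Proof.
rewrite /hamiltonian -cardsUI (leq_trans _ (leq_addr _ _))//.
apply: subset_leq_card; apply/fintype.subsetP => e; rewrite !inE.
move=> /existsP[x /existsP[y /and3P[ee nn]]]; rewrite !ffunE => ne.
have [sxy|sxy] := boolP (s x != s y).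
  by apply/orP; left; apply/existsP; exists x; apply/existsP; exists y; apply/and3P.
apply/orP; right; apply/existsP; exists x; apply/existsP; exists y; apply/and3P; split => //.
apply: contraNneq ne => ->; case: (z y == a); rewrite ?eqxx//.
by rewrite negbK in sxy.
Qed.

Lemma overlay_differ s z z' a : differ_at_one_site z z' ->
  overlay s z a = overlay s z' a \/
  differ_at_one_site (overlay s z a) (overlay s z' a).
Proof.
move=> /cards1P[x xE].
have [e|ne] := eqVneq (overlay s z a x) (overlay s z' a x).
  left; apply/ffunP => y; have [->//|yx] := eqVneq y x.
  have : y \notin [set x | z x != z' x]%SET by rewrite xE inE.
  by rewrite inE negbK !ffunE => /eqP ->.
right; apply/cards1P; exists x; apply/setP => y; rewrite !inE.
have [->//|yx] := eqVneq y x.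
have : y \notin [set x | z x != z' x]%SET by rewrite xE inE.
by rewrite inE negbK !ffunE => /eqP ->; rewrite eqxx.
Qed.

Lemma connect_overlay h s z z' a : connect (edge h) z z' ->
  connect (edge (H s + h)) (overlay s z a) (overlay s z' a).
Proof.
apply: (connect_homo (f := fun w => overlay s w a)) => u v /and3P[uv hu hv].
have [->|duv] := overlay_differ s a uv; first exact: connect0.
apply: connect1; rewrite /edge/= duv.
by rewrite !(leq_ltn_trans (hamiltonian_overlay _ _ _))// ltn_add2l.
Qed.

Lemma overlay_full s a : overlay s (monochromatic K L M a) a = monochromatic K L M a.
Proof. by apply/ffunP => x; rewrite !ffunE eqxx. Qed.

Lemma overlay_empty s a b : b != a -> overlay s (monochromatic K L M b) a = s.
Proof. by move=> ba; apply/ffunP => x; rewrite !ffunE (negbTE ba). Qed.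

Lemma perm_pair (T : finType) (a a' b b' : T) : a != a' -> b != b' ->
  exists p : {perm T}, p a = b /\ p a' = b'.
Proof.
move=> aa' bb'; pose c := tperm a b a'.
have cb : c != b by rewrite /c -[X in _ != X](tpermL a b) (inj_eq perm_inj) eq_sym.
exists (tperm a b * tperm c b')%g; rewrite !permM tpermL -/c tpermL; split=> //.
by rewrite tpermD// eq_sym.
Qed.

(** Heights are natural numbers, so there is a least [G] such that energies at most [G] suffice; its
    minimality is the separation strictly below [G]. *)
Lemma communication_heightP (R : realType) s z : s != z ->
  exists G : nat, [/\ communication_height bc s z = G%:R :> R,
    connect (edge G.+1) s z & ~~ connect (edge G) s z].
Proof.
move=> sz; have ex : exists h, connect (edge h.+1) s z.
  by exists (\max_w H w); exact: connect_edge_max.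
case: (ex_minnP ex) => G GP Gmin; exists G; split=> //; last first.
  case: G Gmin {GP} => [|G] Gmin; last by apply/negP => /Gmin; rewrite ltnn.
  apply/negP => /connectP[[|w p] /=]; first by move=> _ e; rewrite e eqxx in sz.
  by move=> /andP[/and3P[]].
have maxP (h : nat) (p : seq config) :
    (\max_(w <- s :: p) H w <= h)%N -> path (@differ_at_one_site K L M q) s p -> path (edge h.+1) s p.
  elim: p s {sz ex GP Gmin} => [//|w p IH] u /=.
  rewrite big_cons geq_max => /andP[Hu Hp] /andP[uw wp].
  have Hw : (H w <= h)%N by move: Hp; rewrite big_cons geq_max => /andP[].
  by rewrite IH// andbT /edge/= uw !ltnS Hu Hw.
have lb (v : R) : [set h : R | exists p : seq config,
    [/\ path (@differ_at_one_site K L M q) s p, last s p = z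
      & h = (\max_(w <- s :: p) H w)%:R]] v -> G%:R <= v.
  move=> [p [sp lp ->]]; rewrite ler_nat; apply: Gmin; apply/connectP; exists p => //.
  exact: maxP.
have [p pe pz] := connectP GP.
have mem : [set h : R | exists p : seq config,
    [/\ path (@differ_at_one_site K L M q) s p, last s p = z
      & h = (\max_(w <- s :: p) H w)%:R]] (\max_(w <- s :: p) H w)%:R.
  exists p; split=> //; apply: sub_path pe => u v; by case/and3P.
have pmax (h : nat) u v : (H u <= h)%N -> path (edge h.+1) u v ->
    (\max_(w <- u :: v) H w <= h)%N.
  elim: v u => [|w v IH] u Hu /=; first by rewrite big_cons big_nil maxn0.
  by move=> /andP[/and3P[_ _ Hw] wv]; rewrite big_cons geq_max Hu IH.
have pG : (\max_(w <- s :: p) H w <= G)%N.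
  (* The relation bounds the energy of [s] itself only through a first step, which exists because s
     != z. *)
  apply: (pmax G s p _ pe); case: p pz mem pe => [zs|w p _ _ /= /andP[/and3P[]]//].
  by rewrite zs eqxx in sz.
apply/eqP; rewrite eq_le; apply/andP; split.
  rewrite (le_trans (y := (\max_(w <- s :: p) H w)%:R))//; last by rewrite ler_nat.
  by apply: ge_inf => //; exists G%:R.
by apply: lb_le_inf => //; eexists; exact: mem.
Qed.

End Landscape.

(** * Poincare inequality, spectral gap and capacities of the Potts model *)

Section PottsEstimates.
Context {R : realType} (bc : boundary) (K L M q : nat) (beta : R).
Local Notation site := (site K L M).
Local Notation config := (config K L M q).
Local Notation H := (@hamiltonian bc K L M q).
Local Notation r := (@metropolis_rate R bc K L M q beta).
Local Notation mu := (@gibbs R bc K L M q beta).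
Local Notation ground := (ground_states K L M q).
Local Notation E f := (dirichlet_form r mu f f).
Local Notation N := (#|config|%:R : R).
Implicit Types s z : config.
Hypothesis beta_gt0 : 0 < beta.
Variables (x0 : site) (q_ge2 : (2 <= q)%N).

Definition partition_function : R := \sum_(z : config) expR (- beta * (H z)%:R).
Local Notation Z := partition_function.

Lemma metropolis_rateE s z : r s z =
  if differ_at_one_site s z then expR (- beta * Num.max ((H z)%:R - (H s)%:R) 0) else 0.
Proof. by rewrite /metropolis_rate differ_at_one_siteE. Qed.

Lemma metropolis_rate_ge0 s z : 0 <= r s z.
Proof. by rewrite metropolis_rateE; case: ifP => // _; exact: expR_ge0. Qed.

Lemma ground_exists : exists s, s \in ground.
Proof.
case: q q_ge2 => // q' _.
by exists (monochromatic K L M ord0); apply/imsetP; exists ord0.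
Qed.

Lemma hamiltonian_ground s : s \in ground -> H s = 0%N.
Proof. by move=> /imsetP[a _ ->]; exact: hamiltonian_monochromatic. Qed.

Lemma expR_hamiltonian_le1 s : expR (- beta * (H s)%:R) <= 1.
Proof. by rewrite -expR0 ler_expR mulNr oppr_le0 mulr_ge0// ltW. Qed.

Lemma partition_function_ge1 : 1 <= Z.
Proof.
have [s gs] := ground_exists.
rewrite /partition_function (bigD1 s)//= (hamiltonian_ground gs) mulr0 expR0 lerDl.
by rewrite sumr_ge0// => z _; exact: expR_ge0.
Qed.

Lemma partition_function_gt0 : 0 < Z.
Proof. exact: lt_le_trans partition_function_ge1. Qed.
Local Notation Z_gt0 := partition_function_gt0.

Lemma partition_function_le : Z <= N.
Proof.
rewrite (le_trans (ler_sum _ (fun s _ => expR_hamiltonian_le1 s)))//.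
by rewrite sumr_const.
Qed.

Lemma card_config_ge1 : 1 <= N.
Proof.
by have [s _] := ground_exists; rewrite ler1n; apply/card_gt0P; exists s.
Qed.

Lemma gibbsE s : mu s = expR (- beta * (H s)%:R) / Z.
Proof. by []. Qed.

Lemma gibbs_gt0 s : 0 < mu s.
Proof. by rewrite gibbsE divr_gt0 ?expR_gt0 ?Z_gt0. Qed.

Lemma gibbs_sum1 : \sum_s mu s = 1.
Proof. by rewrite -mulr_suml divff// gt_eqF ?Z_gt0. Qed.

Lemma gibbs_le s : mu s <= Z^-1.
Proof.
by rewrite gibbsE -[leRHS]mul1r ler_wpM2r ?expR_hamiltonian_le1// invr_ge0 ltW ?Z_gt0.
Qed.

Lemma gibbs_ground s : s \in ground -> mu s = Z^-1.
Proof. by move=> gs; rewrite gibbsE hamiltonian_ground// mulr0 expR0 mul1r. Qed.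

Lemma gibbs_not_ground s : s \notin ground -> mu s <= expR (- beta) / Z.
Proof.
move=> gs; rewrite gibbsE ler_wpM2r ?invr_ge0 ?(ltW Z_gt0)// ler_expR mulNr lerN2.
by rewrite -[leLHS]mulr1 ler_wpM2l ?(ltW beta_gt0)// ler1n (@hamiltonian_gt0 bc).
Qed.

(** With Metropolis rates the conductance sees only the higher endpoint; reversibility and all
    comparisons with exp(- beta h) follow. *)
Lemma conductanceE s z : mu s * r s z =
  if differ_at_one_site s z then expR (- beta * (maxn (H s) (H z))%:R) / Z else 0.
Proof.
have e : (H s)%:R + Num.max ((H z)%:R - (H s)%:R) 0 = (maxn (H s) (H z))%:R :> R.
  have [sz|zs] := leqP (H s) (H z).
    by rewrite max_l ?subr_ge0 ?ler_nat// addrC subrK.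
  by rewrite max_r ?subr_le0 ?ler_nat ?(ltnW zs)// addr0.
rewrite metropolis_rateE gibbsE; case: (differ_at_one_site s z); last by rewrite mulr0.
by rewrite -e mulrDr expRD mulrAC.
Qed.

Lemma metropolis_reversible s z : mu s * r s z = mu z * r z s.
Proof. by rewrite !conductanceE differ_at_one_site_sym maxnC. Qed.

Lemma metropolis_irreducible s z : connect (fun s z => 0 < r s z) s z.
Proof.
have := connect_differ s z; apply: (connect_homo (f := id)) => u v uv.
by apply: connect1; rewrite metropolis_rateE uv expR_gt0.
Qed.

Lemma conductance_ge (h : nat) s z : edge bc h.+1 s z ->
  expR (- beta * h%:R) / Z <= mu s * r s z.
Proof.
move=> /and3P[sz]; rewrite !ltnS => hs hz.
rewrite conductanceE sz ler_pM2r ?invr_gt0 ?Z_gt0//.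
by rewrite ler_expR !mulNr lerN2 ler_pM2l ?beta_gt0// ler_nat geq_max hs.
Qed.

Lemma connect_edge_dirichlet (h : nat) (f : config -> R) s z :
  connect (edge bc h.+1) s z ->
  (f z - f s) ^+ 2 <= 2 * N ^+ 2 * Z * expR (beta * h%:R) * E f.
Proof.
move=> sz; have m0 : 0 < expR (- beta * h%:R) / Z by rewrite divr_gt0 ?expR_gt0 ?Z_gt0.
have := connect_dirichlet metropolis_rate_ge0 gibbs_gt0 f m0 (conductance_ge (h := h)) sz.
rewrite mulNr expRN (_ : _ / _ = 2 * N ^+ 2 * Z * expR (beta * h%:R))//.
by field; rewrite !gt_eqF ?expR_gt0 ?Z_gt0.
Qed.

Variable G : nat.
Hypothesis ground_connect : forall s z, s \in ground -> z \in ground -> s != z ->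
  connect (edge bc G.+1) s z /\ ~~ connect (edge bc G) s z.

Lemma connect_ground s z : z \in ground -> connect (edge bc (H s + G).+1) s z.
Proof.
move=> /imsetP[a _ ->].
have [b ba] : exists b : 'I_q, b != a.
  have : (1 < #|'I_q|)%N by rewrite card_ord.
  rewrite (cardD1 a) inE ltnS => /card_gt0P[b]; rewrite !inE => /andP[ba _].
  by exists b.
have gm c : monochromatic K L M c \in ground by apply/imsetP; exists c.
have ne : monochromatic K L M b != monochromatic K L M a.
  by apply: contra_neq ba => /ffunP/(_ x0); rewrite !ffunE.
have [+ _] := ground_connect (gm b) (gm a) ne.
by move=> /(connect_overlay s a); rewrite overlay_full overlay_empty// addnS.
Qed.

(** Both paths lead to one ground state. Bounding the height by the sum of the energies suits
    [poincare_inequality], where mu(s) mu(z) pays for exactly that sum. *)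
Lemma connect_any s z : connect (edge bc (H s + H z + G).+1) s z.
Proof.
have [g gg] := ground_exists.
apply: (connect_trans (y := g)).
  apply: connect_edge_le (connect_ground s gg); rewrite ltnS leq_add2r; exact: leq_addr.
rewrite connect_edge_sym; apply: connect_edge_le (connect_ground z gg).
by rewrite ltnS leq_add2r leq_addl.
Qed.

Lemma variance_pairs (f : config -> R) :
  variance mu f = 2^-1 * \sum_s \sum_z mu s * mu z * (f z - f s) ^+ 2.
Proof.
have -> : \sum_s \sum_z mu s * mu z * (f z - f s) ^+ 2 = 2 * variance mu f.
  transitivity (\sum_s (mu s * \sum_z mu z * f z ^+ 2 + mu s * f s ^+ 2 - 2 * (mu s * f s) * mean mu f)).
    apply: eq_bigr => s _.
    under eq_bigr => z _.
      rewrite (_ : _ * _ = mu s * (mu z * f z ^+ 2) + mu s * f s ^+ 2 * mu z - 2 * (mu s * f s) * (mu z * f z)); last by ring.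
      over.
    by rewrite sumrB big_split/= -!mulr_sumr gibbs_sum1 mulr1.
  rewrite sumrB big_split/= -mulr_suml gibbs_sum1 mul1r -mulr_suml -mulr_sumr.
  by rewrite /variance -/(mean mu f); ring.
by rewrite mulrA mulVf ?mul1r// pnatr_eq0.
Qed.

Lemma sum_pairs_const (c : R) : \sum_(s : config) \sum_(z : config) c = c * N ^+ 2.
Proof. by rewrite !sumr_const -mulrnA -[LHS]mulr_natr natrM. Qed.

(** The weight mu(s) mu(z) cancels exp(beta (H s + H z)), so all N^2 pairs have the same bound;
    another N^2 comes from the squared path length, and the 2 of [connect_edge_dirichlet] cancels
    the 1/2 of [variance_pairs]. *)
Lemma poincare_inequality (f : config -> R) :
  expR (- beta * G%:R) / N ^+ 4 * variance mu f <= E f.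
Proof.
have N0 : 0 < N by rewrite (lt_le_trans _ card_config_ge1).
rewrite mulrAC ler_pdivrMr ?exprn_gt0// mulNr expRN mulrC ler_pdivrMr ?expR_gt0//.
rewrite variance_pairs mulrC ler_pdivrMr//.
have Ef := dirichlet_form_ge0 metropolis_rate_ge0 gibbs_gt0 f.
rewrite (le_trans (y := \sum_(s : config) \sum_(z : config) (2 * N ^+ 2 * expR (beta * G%:R) * E f)))//.
  apply: ler_sum => s _; apply: ler_sum => z _.
  have := connect_edge_dirichlet f (connect_any s z).
  rewrite !natrD !mulrDr !expRD => h.
  have m0 : 0 <= mu s * mu z by rewrite mulr_ge0// ltW ?gibbs_gt0.
  rewrite (le_trans (ler_wpM2l m0 h))// !gibbsE !mulNr !expRN.
  rewrite [leLHS](_ : _ = 2 * N ^+ 2 * expR (beta * G%:R) * E f / Z); last first.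
    by field; rewrite !gt_eqF ?expR_gt0 ?Z_gt0.
  rewrite ler_pdivrMr ?Z_gt0// ler_peMr ?partition_function_ge1//.
  by rewrite mulr_ge0// mulr_ge0 ?expR_ge0// mulr_ge0 ?sqr_ge0.
by rewrite sum_pairs_const [leLHS](_ : _ = E f * N ^+ 4 * expR (beta * G%:R) * 2)//; ring.
Qed.

(** A move across the boundary of [C] has an endpoint of energy at least [G], otherwise closedness
    would apply; its conductance is then at most exp(- beta G) / Z. *)
Lemma cut_dirichlet_le (C : {set config}) :
  (forall s z, s \in C -> edge bc G s z -> z \in C) ->
  E (fun s => (s \in C)%:R) <= N ^+ 2 * expR (- beta * G%:R) / Z.
Proof.
move=> closedC; pose b := expR (- beta * G%:R) / Z; have b0 : 0 <= b.
  by rewrite divr_ge0 ?expR_ge0// ltW ?Z_gt0.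
have step s z : mu s * r s z * (((z \in C)%:R - (s \in C)%:R) * ((z \in C)%:R - (s \in C)%:R)) <= b.
  have [e|ne] := eqVneq (s \in C) (z \in C).
    by rewrite e subrr !mulr0.
  rewrite (_ : _ * _ = mu s * r s z); last first.
    by case: (s \in C) (z \in C) ne => -[]//= _; ring.
  rewrite conductanceE; case: ifP => // sz.
  rewrite ler_wpM2r ?invr_ge0 ?(ltW Z_gt0)// ler_expR !mulNr lerN2 ler_wpM2l ?(ltW beta_gt0)// ler_nat.
  rewrite leqNgt gtn_max; apply: contra ne => /andP[hs hz].
  have esz : edge bc G s z by rewrite /edge/= sz hs.
  have ezs : edge bc G z s by rewrite edge_sym.
  by apply/eqP; apply/idP/idP => h; [exact: closedC h esz|exact: closedC h ezs].
rewrite /dirichlet_form -mulrA -/b.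
rewrite (le_trans (y := 2^-1 * \sum_(s : config) \sum_(z : config) b))//.
  rewrite ler_wpM2l ?invr_ge0//; apply: ler_sum => s _; apply: ler_sum => z _; exact: step.
rewrite sum_pairs_const [N ^+ 2 * b]mulrC.
have : 0 <= b * N ^+ 2 by rewrite mulr_ge0 ?sqr_ge0.
lra.
Qed.

(** The Poincare inequality gives the lower bound, and the indicator of the valley of one ground
    state is the test function for the upper bound. *)
Lemma spectral_gap_potts :
  expR (- beta * G%:R) / N ^+ 4 <= spectral_gap r <= N ^+ 3 * expR (- beta * G%:R).
Proof.
have N0 : 0 < N by rewrite (lt_le_trans _ card_config_ge1).
have [s [z [gs gz sz]]] : exists s z : config, [/\ s \in ground, z \in ground & s != z].
  have : (1 < #|'I_q|)%N by rewrite card_ord.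
  move=> /card_gt1P[a [b [_ _ ab]]].
  exists (monochromatic K L M a), (monochromatic K L M b); split.
  - by apply/imsetP; exists a.
  - by apply/imsetP; exists b.
  - by apply: contra_neq ab => /ffunP/(_ x0); rewrite !ffunE.
have [_ nsz] := ground_connect gs gz sz.
pose C := [set w | connect (edge bc G) s w]%SET.
pose f (w : config) : R := (w \in C)%:R.
have fE : E f <= N ^+ 2 * expR (- beta * G%:R) / Z.
  by apply: cut_dirichlet_le => u v; rewrite !inE => su uv; exact: connect_trans su (connect1 uv).
(* The two ordered pairs formed by [s] and [z] already contribute this much. *)
have vf : Z ^- 2 <= variance mu f.
  rewrite variance_pairs.
  have pos (u v : config) : 0 <= mu u * mu v * (f v - f u) ^+ 2.
    by rewrite mulr_ge0 ?sqr_ge0// mulr_ge0// ltW ?gibbs_gt0.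
  have fs : f s = 1 by rewrite /f inE connect0.
  have fz : f z = 0 by rewrite /f inE (negbTE nsz).
  rewrite mulrC ler_pdivlMr// (bigD1 s)//= (bigD1 z) 1?eq_sym//=.
  rewrite [X in _ <= _ + X](bigD1 z) 1?eq_sym//= [X in _ <= _ + (X + _)](bigD1 s)//=.
  rewrite fs fz !gibbs_ground// subr0 sub0r sqrrN expr1n mulr1 -invfM -expr2.
  have p1 : 0 <= \sum_(i | i != z) mu s * mu i * (f i - 1) ^+ 2.
    by rewrite sumr_ge0// => i _; have := pos s i; rewrite fs.
  have p2 : 0 <= \sum_(i | i != s) mu z * mu i * (f i - 0) ^+ 2.
    by rewrite sumr_ge0// => i _; have := pos z i; rewrite fz.
  have p3 : 0 <= \sum_(i | (i != s) && (i != z)) \sum_j mu i * mu j * (f j - f i) ^+ 2.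
    by rewrite sumr_ge0// => i _; rewrite sumr_ge0.
  rewrite gibbs_ground// in p1; rewrite gibbs_ground// in p2.
  lra.
have v0 : 0 < variance mu f.
  by rewrite (lt_le_trans _ vf)// invr_gt0 exprn_gt0// Z_gt0.
have c0 : 0 < expR (- beta * G%:R) / N ^+ 4 by rewrite divr_gt0 ?expR_gt0 ?exprn_gt0.
have /andP[lb ub] := spectral_gap_bounds metropolis_rate_ge0 gibbs_gt0 metropolis_reversible gibbs_sum1
  c0 poincare_inequality v0.
rewrite lb/= (le_trans ub)// ler_pdivrMr// (le_trans fE)//.
have Nb : 0 <= N ^+ 3 * expR (- beta * G%:R) by rewrite mulr_ge0 ?expR_ge0 ?exprn_ge0.
rewrite (le_trans _ (ler_wpM2l Nb vf))//.
have ZN := partition_function_le; have Z0 := Z_gt0.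
rewrite [leRHS](_ : _ = N ^+ 2 * expR (- beta * G%:R) / Z * (N / Z)); last first.
  by field; rewrite gt_eqF.
apply: ler_peMr; last by rewrite ler_pdivlMr// mul1r.
by rewrite divr_ge0 ?(ltW Z0)// mulr_ge0 ?expR_ge0 ?exprn_ge0.
Qed.

Section Targets.
Variables (A B : {set config}) (a b : config).
Hypotheses (aA : a \in A) (bB : b \in B) (AB : forall s, (s \in ground) = (s \in A) || (s \in B)).
Hypothesis notA : forall s, s \in B -> s \notin A.
Hypothesis symmetric_targets : forall b', b' \in B ->
  exists p : {perm 'I_q}, [/\ forall s, (recolor p s \in A) = (s \in A),
     forall s, (recolor p s \in B) = (s \in B) & recolor p b = b'].

Lemma metropolis_rate_recolor (p : {perm 'I_q}) s z :
  r (recolor p s) (recolor p z) = r s z.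
Proof. by rewrite !metropolis_rateE differ_at_one_site_recolor !hamiltonian_recolor. Qed.

Lemma potts_equilibrium_potential : exists (kappa : R) (h g : config -> R),
  [/\ expR (- beta * G%:R) / (2 * N ^+ 3) <= kappa <= N ^+ 2 * expR (- beta * G%:R),
     [/\ forall x, x \in A -> h x = 0, forall x, h x <= 1, h b = 1 &
       forall x, x \notin A -> - kappa * h x <= gen_op r h x],
     [/\ forall x, x \in A -> g x = 0, forall x, 0 <= g x &
       forall x, x \notin A -> gen_op r g x = -1] &
     g b * kappa <= 1 + N * expR (- beta)].
Proof.
have gA s : s \in A -> s \in ground by rewrite AB => ->.
have gB s : s \in B -> s \in ground by rewrite AB orbC => ->.
have N0 : 0 < N by rewrite (lt_le_trans _ card_config_ge1).
have Z0 := Z_gt0.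
have [|kappa [h [g [k0 [h01 hA hB Lh] [g0 gzA Lg] gk [kE kmin]]]]] :=
  equilibrium_potential metropolis_rate_ge0 gibbs_gt0 metropolis_reversible
    metropolis_irreducible aA bB notA.
  move=> b' /symmetric_targets[p [pA pB pb]]; exists (recolor p); split=> //.
  - exact: recolor_bij.
  - exact: metropolis_rate_recolor.
(* The mass of [B] lies between 1 / Z and N / Z, so that Z drops out of both bounds on [kappa], at
   the price of one more factor N in the lower one. *)
have muB1 : Z^-1 <= \sum_(x in B) mu x.
  rewrite -(gibbs_ground (gB _ bB)) (bigD1 b)//= lerDl sumr_ge0// => x _; exact/ltW/gibbs_gt0.
have muBN : \sum_(x in B) mu x <= N / Z.
  rewrite (le_trans (ler_sum _ (fun s _ => gibbs_le s)))//.
  rewrite sumr_const -[leLHS]mulr_natl ler_wpM2r ?invr_ge0 ?(ltW Z0)// ler_nat.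
  exact: max_card.
have hle x : h x <= 1 by case/andP: (h01 x).
have h0 x : 0 <= h x by case/andP: (h01 x).
exists kappa, h, g; split.
- apply/andP; split.
    have ne : b != a by apply: contraTneq (notA bB) => ->; rewrite aA.
    have [cba _] := ground_connect (gB _ bB) (gA _ aA) ne.
    have := connect_edge_dirichlet h cba.
    rewrite hA// hB// sub0r sqrrN expr1n -kE.
    move=> le1; rewrite mulNr expRN -invfM invf_ple ?posrE//; last first.
      by rewrite mulr_gt0 ?expR_gt0// mulr_gt0// exprn_gt0.
    rewrite -[leLHS]mul1r ler_pdivrMr// (le_trans le1)//.
    have := ler_wpM2l (ltW k0) muBN.
    have c0 : 0 <= 2 * N ^+ 2 * Z * expR (beta * G%:R).
      by rewrite !mulr_ge0 ?expR_ge0 ?exprn_ge0 ?(ltW Z0).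
    move=> /(ler_wpM2l c0) le3.
    rewrite [leLHS]mulrC [leRHS](_ : _ = 2 * N ^+ 2 * Z * expR (beta * G%:R) * (kappa * (N / Z))).
      by move: le3; lra.
    by field; rewrite gt_eqF.
  pose C := [set w | [exists b' in B, connect (edge bc G) b' w]]%SET.
  have CB x : x \in B -> x \in C.
    by move=> xB; rewrite inE; apply/existsP; exists x; rewrite xB connect0.
  have CA x : x \in A -> x \notin C.
    move=> xA; rewrite inE; apply/existsP => -[b' /andP[b'B]]; apply/negP.
    have ne : b' != x by apply: contraTneq (notA b'B) => ->; rewrite xA.
    by have [] := ground_connect (gB _ b'B) (gA _ xA) ne.
  have closedC : forall s z, s \in C -> edge bc G s z -> z \in C.
    move=> s z; rewrite !inE => /existsP[b' /andP[b'B cs]] sz.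
    by apply/existsP; exists b'; rewrite b'B (connect_trans cs (connect1 sz)).
  have := kmin (fun s => (s \in C)%:R).
  move=> /(_ (fun x xA => congr1 (fun b : bool => b%:R) (negbTE (CA x xA)))).
  move=> /(_ (fun x xB => congr1 (fun b : bool => b%:R) (CB x xB))).
  move=> /le_trans/(_ (cut_dirichlet_le closedC)) le2.
  have := le_trans (ler_wpM2l (ltW k0) muB1) le2.
  by rewrite ler_pM2r ?invr_gt0.
- split=> //; first by rewrite hB.
  (* On [B] both sides are equal since h = 1; elsewhere off [A], L h = 0 and h >= 0. *)
  by move=> x xA; rewrite Lh// !mulNr lerN2 ler_wpM2l ?(ltW k0)//; case: (boolP (x \in B)) => // /hB ->.
- by split.
(* After multiplication by mu(B) the left side is mu(h): the mass of [B], plus at most exp(- beta) /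
   Z for each configuration that is not a ground state, to be compared with mu(B) >= 1 / Z. *)
- have muB0 : 0 < \sum_(x in B) mu x by rewrite (lt_le_trans _ muB1)// invr_gt0.
  rewrite -(ler_pM2r muB0) -mulrA gk mulrDl mul1r (bigID (fun x => x \in B))/= lerD//.
    by apply: ler_sum => x xB; rewrite hB// mulr1.
  rewrite (le_trans (y := \sum_(x : config) expR (- beta) / Z))//; last first.
    by rewrite sumr_const -[leLHS]mulr_natl -[leRHS]mulrA ler_wpM2l// ler_wpM2l ?expR_ge0.
  rewrite big_mkcond; apply: ler_sum => x _.
  have e0 : 0 <= expR (- beta) / Z by rewrite divr_ge0 ?expR_ge0// ltW.
  case: ifPn => // xB; have [xA|xA] := boolP (x \in A); first by rewrite hA// mulr0.
  have ngx : x \notin ground by rewrite AB negb_or xA xB.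
  rewrite (le_trans _ (gibbs_not_ground ngx))// ger_pMr// ?gibbs_gt0//.
Qed.

End Targets.
End PottsEstimates.

(** * Low temperature asymptotics *)

Section Asymptotics.
Context {R : realType}.

Lemma eventually_small (C a e : R) : 0 <= C -> 0 < a -> 0 < e ->
  \forall b \near +oo, C * expR (- (b * a)) <= e.
Proof.
move=> C0 a0 e0; exists (C / (a * e)); split; first exact: num_real.
move=> b Cb; have b0 : 0 < b.
  by rewrite (le_lt_trans _ Cb)// divr_ge0// mulr_ge0// ltW.
rewrite (le_trans (ler_wpM2l C0 (expR_le_inv _))) ?mulr_gt0//.
rewrite ler_pdivrMr ?mulr_gt0//.
move: Cb; rewrite ltr_pdivrMr ?mulr_gt0// => /ltW; lra.
Qed.

Lemma ln_rate_cvg (f : R -> R) (G : R) :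
  (forall eta, 0 < eta -> \forall b \near +oo,
     expR (b * (G - eta)) <= f b <= expR (b * (G + eta))) ->
  b^-1 * ln (f b) @[b --> +oo] --> G.
Proof.
move=> fG; apply/cvgrPdist_le => e e0; near=> b.
have b0 : 0 < b by near: b; exact: nbhs_pinfty_gt.
have /andP[lo up] : expR (b * (G - e)) <= f b <= expR (b * (G + e)) by near: b; exact: fG.
have f0 : 0 < f b by rewrite (lt_le_trans _ lo)// expR_gt0.
move: lo up; rewrite -ler_ln ?posrE ?expR_gt0// expRK => lo.
rewrite -ler_ln ?posrE ?expR_gt0// expRK => up.
rewrite distrC ler_distl; apply/andP; split.
  by rewrite ler_pdivlMl.
by rewrite ler_pdivrMl.
Unshelve. all: by end_near. Qed.

Lemma cvge_squeeze (f : R -> \bar R) (a : R) :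
  (forall e, 0 < e -> \forall b \near +oo, ((a - e)%:E <= f b <= (a + e)%:E)%E) ->
  f b @[b --> +oo] --> a%:E.
Proof.
move=> fa; apply/fine_cvgP; split.
  apply: filterS (fa 1 ltr01) => b /andP[lo up].
  by rewrite fin_numElt (lt_le_trans _ lo) ?ltNyr// (le_lt_trans up)// ltry.
apply/cvgrPdist_le => e e0; apply: filterS (fa e e0) => b /andP[lo up].
have fb : f b \is a fin_num.
  by rewrite fin_numElt (lt_le_trans _ lo) ?ltNyr// (le_lt_trans up)// ltry.
by rewrite /= distrC ler_distl -!lee_fin fineK// lo.
Qed.

Lemma exponential_prob_le (t : R) :
  exponential_prob 1 `]-oo, t]%classic = (if 0 <= t then 1 - expR (- t) else 0)%:E.
Proof.
have zero (D : set R) : D `<=` `]-oo, 0[%classic -> exponential_prob 1 D = 0%E.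
  move=> D0; apply: integral0_eq => x Dx; rewrite lt0_exponential_pdf//.
  by have := D0 _ Dx; rewrite /= in_itv.
case: ltP => [t0|t0].
  by apply: zero => x; rewrite /= !in_itv/= => /le_lt_trans; apply.
have split_t : `]-oo, t]%classic = `]-oo, 0[%classic `|` `[0, t]%classic.
  rewrite predeqE => x; rewrite /= !in_itv/=; split => [xt|[x0|/andP[]//]].
    by have [x0|x0] := ltP x 0; [left|right; rewrite xt].
  by rewrite (le_trans (ltW x0)).
have mf D : measurable D ->
    measurable_fun D (fun x => (exponential_pdf (1 : R) x)%:E).
  move=> mD; apply/measurable_EFinP; apply: measurable_funTS.
  exact: measurable_exponential_pdf.
rewrite /exponential_prob split_t ge0_integral_setU//; last 3 first.
- by rewrite -split_t; apply: mf.
- by move=> x _; rewrite lee_fin exponential_pdf_ge0.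
- by apply/disj_setPS => x /= []; rewrite !in_itv/= => x0 /andP[]; rewrite leNgt x0.
rewrite [X in (X + _)%E](zero `]-oo, 0[%classic)// add0e.
move: t0; rewrite le_eqVlt => /predU1P[<-|t0].
  by rewrite set_itv1 integral_set1// oppr0 expR0 subrr.
by rewrite -/(exponential_prob 1 `[0, t]%classic) exponential_prob_itv0c// mulN1r.
Qed.

End Asymptotics.

(** * Almost exponential random times *)

Section ExponentialEstimates.
Context {R : realType} (d : measure_display) (Omega : measurableType d)
  (P : probability Omega R) (tau : Omega -> \bar R).

(* [rho] measures how far [tau] is from an exponential variable of rate [kappa]. *)
Record exponential_estimates (kappa m rho : R) : Prop := {
  est_rate : 0 < kappa;
  est_ge0 : forall w, (0 <= tau w)%E;
  est_measurable : measurable_fun setT tau;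
  est_mean : (\int[P]_w tau w = m%:E)%E;
  est_mean_rate : 1 <= kappa * m <= 1 + rho;
  est_gt : forall t, 0 <= t ->
    ((expR (- (kappa * t)))%:E <= P [set w | (t%:E < tau w)%E])%E;
  est_tail : forall eta t, 0 < eta -> eta <= t ->
    (P [set w | (t%:E < tau w)%E] <=
     (expR (- (kappa * (t - eta))) + rho / (kappa * eta))%:E)%E;
  est_markov : forall t, 0 < t -> (P [set w | (t%:E < tau w)%E] <= (m / t)%:E)%E
}.

Variables (kappa m rho : R).
Hypothesis est : exponential_estimates kappa m rho.

Let mgt t : measurable [set w | (t%:E < tau w)%E].
Proof. by have := emeasurable_fun_o_infty measurableT (est_measurable est) t%:E; rewrite setTI. Qed.

Lemma est_mean_gt0 : 0 < m.
Proof.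
have /andP[h _] := est_mean_rate est.
by rewrite -(pmulr_rgt0 _ (est_rate est)) (lt_le_trans _ h).
Qed.

Lemma prob_le_complement t :
  P [set w | (tau w <= t%:E)%E] = (1 - P [set w | (t%:E < tau w)%E])%E.
Proof.
rewrite -probability_setC//; congr (P _); rewrite predeqE => w /=.
by rewrite leNgt; split => /negP.
Qed.

Lemma est_le t : 0 <= t -> (P [set w | (tau w <= t%:E)%E] <= (kappa * t)%:E)%E.
Proof.
move=> t0; rewrite prob_le_complement.
have Pf : P [set w | (t%:E < tau w)%E] \is a fin_num by apply: fin_num_measure.
have := est_gt est t0; rewrite -(fineK Pf) -EFinB !lee_fin.
have := one_sub_le_expR (kappa * t); lra.
Qed.

(** The Markov bound is stated for a strict inequality; applying it at t / 2 costs the factor 2. *)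
Lemma est_ge t : 0 < t -> (P [set w | (t%:E <= tau w)%E] <= (2 * m / t)%:E)%E.
Proof.
move=> t0; have t2 : 0 < t / 2 by rewrite divr_gt0.
rewrite (@le_trans _ _ (P [set w | ((t / 2)%:E < tau w)%E]))//.
  apply: le_measure; [apply/mem_set|exact/mem_set/mgt|].
    have := emeasurable_fun_c_infty measurableT (est_measurable est) t%:E.
    by rewrite setTI.
  by move=> w /=; apply: lt_le_trans; rewrite lte_fin; lra.
rewrite (le_trans (est_markov est t2))// lee_fin le_eqVlt; apply/orP; left.
by apply/eqP; field; rewrite gt_eqF.
Qed.

(** The tail bound with window delta / kappa: 2 delta is the price of the shift, rho / delta that of
    the excess mean, and t rho that of replacing kappa m by 1. For fixed delta the last two vanish
    with rho. *)
Lemma normalised_law (t delta : R) : 0 <= rho -> 0 < delta -> delta <= 2^-1 -> 0 <= t ->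
  ((1 - expR (- t) - (2 * delta + rho / delta))%:E <=
   P [set w | (tau w / m%:E <= t%:E)%E] <= (1 - expR (- t) + t * rho)%:E)%E.
Proof.
move=> rho0 d0 d2 t0; have m0 := est_mean_gt0; have k0 := est_rate est.
have -> : [set w | (tau w / m%:E <= t%:E)%E] = [set w | (tau w <= (t * m)%:E)%E].
  by rewrite predeqE => w /=; rewrite inver gt_eqF// lee_pdivrMr.
have tm0 : 0 <= t * m by rewrite mulr_ge0// ltW.
have /andP[km1 km2] := est_mean_rate est.
rewrite prob_le_complement.
have Pf : P [set w | ((t * m)%:E < tau w)%E] \is a fin_num by apply: fin_num_measure.
have e1 : expR (- t) <= 1 by rewrite -expR0 ler_expR oppr_le0.
have e0 := expR_ge0 (- t).
have tkm : kappa * (t * m) = t * (kappa * m) by ring.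
have up : fine (P [set w | ((t * m)%:E < tau w)%E]) <= expR (- t) + (2 * delta + rho / delta).
  have rd0 : 0 <= rho / delta by rewrite divr_ge0// ltW.
  have ed : expR delta <= 1 + 2 * delta.
    have := one_sub_le_expR delta; rewrite expRN => h.
    rewrite -[leLHS]invrK invf_ple ?posrE ?invr_gt0 ?expR_gt0//; last by lra.
    rewrite (le_trans _ h)// -[leLHS]mul1r ler_pdivrMr; last by lra.
    have : 0 <= delta * (1 - 2 * delta) by rewrite mulr_ge0 ?(ltW d0)//; lra.
    lra.
  have etd : expR (- t + delta) <= expR (- t) + 2 * delta.
    rewrite expRD; have := ler_wpM2l e0 ed; have := ler_wpM2r (ltW d0) e1; lra.
  (* For t < delta the window does not fit, but exp(- t) + 2 delta is then at least 1. *)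
  have [dt|td] := leP delta t; last first.
    have P1 : fine (P [set w | ((t * m)%:E < tau w)%E]) <= 1.
      by rewrite -lee_fin fineK// probability_le1.
    have : 1 <= expR (- t + delta) by rewrite -expR0 ler_expR; lra.
    lra.
  have eta0 : 0 < delta / kappa by rewrite divr_gt0.
  have etat : delta / kappa <= t * m.
    rewrite ler_pdivrMr// mulrC tkm (le_trans dt)// ler_peMr//.
  have := est_tail est eta0 etat; rewrite -[X in (X <= _)%E]fineK// lee_fin.
  have -> : kappa * (delta / kappa) = delta by rewrite mulrC divfK// gt_eqF.
  have -> : - (kappa * (t * m - delta / kappa)) = - (t * (kappa * m)) + delta.
    by field; rewrite gt_eqF.
  have : expR (- (t * (kappa * m)) + delta) <= expR (- t + delta).
    by rewrite ler_expR lerD2r lerN2 ler_peMr.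
  lra.
have lo : expR (- t) - t * rho <= fine (P [set w | ((t * m)%:E < tau w)%E]).
  rewrite (le_trans (y := expR (- (kappa * (t * m)))))//; last first.
    by rewrite -lee_fin fineK//; exact: (est_gt est).
  rewrite (le_trans (y := expR (- t + - (t * rho))))//; last first.
    rewrite ler_expR tkm -opprD lerN2 -[X in _ <= X + _]mulr1 -mulrDr ler_wpM2l//.
  have tr0 : 0 <= t * rho by rewrite mulr_ge0.
  rewrite expRD; have := ler_wpM2l e0 (one_sub_le_expR (t * rho)).
  have := ler_wpM2r tr0 e1; lra.
rewrite -[X in (_ - X)%E]fineK// -EFinB !lee_fin; apply/andP; split; lra.
Qed.

Lemma normalised_law_neg (t : R) : t < 0 ->
  P [set w | (tau w / m%:E <= t%:E)%E] = 0%E.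
Proof.
move=> t0; rewrite (_ : [set _ | _] = set0) ?measure0// -subset0 => w /=.
have m0 := est_mean_gt0; rewrite inver gt_eqF// lee_pdivrMr// leNgt => /negP; apply.
by rewrite (lt_le_trans _ (est_ge0 est w))// lte_fin nmulr_rlt0.
Qed.

End ExponentialEstimates.

(** * Hitting times between ground states *)

Section PottsHitting.
Context {R : realType} (bc : boundary) (K L M q : nat).
Local Notation site := (site K L M).
Local Notation config := (config K L M q).
Local Notation H := (@hamiltonian bc K L M q).
Local Notation r := (@metropolis_rate R bc K L M q).
Local Notation ground := (ground_states K L M q).
Local Notation N := (#|config|%:R : R).
Context (d : measure_display) (Omega : R -> config -> measurableType d)
  (P : forall (beta : R) (s : config), probability (Omega beta s) R)
  (X : forall (beta : R) (s : config), R -> Omega beta s -> config).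
Arguments P : clear implicits.
Arguments X : clear implicits.
Hypothesis hX : forall (beta : R) (s : config), 0 < beta ->
  is_ctmc (P beta s) (X beta s) (r beta) s.
Variables (x0 : site) (q_ge2 : (2 <= q)%N) (G : nat).
Hypothesis ground_connect : forall s z, s \in ground -> z \in ground -> s != z ->
  connect (edge bc G.+1) s z /\ ~~ connect (edge bc G) s z.

Lemma potts_transition_ge0 beta (t : R) x y : 0 < beta -> 0 <= t ->
  0 <= transition (r beta) t x y.
Proof. by move=> b0; exact: (start_transition_ge0 (hX x b0)). Qed.

Lemma potts_transition_sum1 beta (t : R) x : 0 < beta -> 0 <= t ->
  \sum_y transition (r beta) t x y = 1.
Proof. by move=> b0; exact: (start_transition_sum1 (hX x b0)). Qed.

Lemma potts_chapman_kolmogorov beta (t u : R) x z : 0 < beta -> 0 <= t -> 0 <= u ->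
  transition (r beta) (t + u) x z =
  \sum_y transition (r beta) t x y * transition (r beta) u y z.
Proof. by move=> b0; exact: (start_chapman_kolmogorov (hX x b0)). Qed.

Local Notation tau beta A b := (hitting_time (X beta b) A).

Definition metastable (A : {set config}) (b : config) := forall beta : R, 0 < beta ->
  exists kappa m : R,
    exponential_estimates (P beta b) (tau beta A b) kappa m (N * expR (- beta)) /\
    expR (- beta * G%:R) / (2 * N ^+ 3) <= kappa <= N ^+ 2 * expR (- beta * G%:R).

(** The mean m is at most [g b], in particular finite, and at least 1 / kappa by the lower bound on
    the tail; so kappa m lies in [1, 1 + N exp(- beta)], which makes the tail bound sharp. *)
Lemma metastable_targets (A B : {set config}) (a b : config) :
  a \in A -> b \in B -> (forall s, (s \in ground) = (s \in A) || (s \in B)) ->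
  (forall s, s \in B -> s \notin A) ->
  (forall b', b' \in B ->
    exists p : {perm 'I_q}, [/\ forall s, (recolor p s \in A) = (s \in A),
      forall s, (recolor p s \in B) = (s \in B) & recolor p b = b']) ->
  metastable A b.
Proof.
move=> aA bB AB notA sym beta b0.
have [kappa [h [g [kb [hA h1 hb Lh] [gA g0 Lg] gk]]]] :=
  potts_equilibrium_potential b0 x0 q_ge2 ground_connect aA bB AB notA sym.
have N1 := card_config_ge1 K L M q_ge2 : 1 <= N.
have N0 : 0 < N by rewrite (lt_le_trans _ N1).
have k0 : 0 < kappa.
  case/andP: kb => kb _; apply: lt_le_trans kb.
  by rewrite divr_gt0 ?expR_gt0// mulr_gt0// exprn_gt0.
have HX := hX b b0; have bA := notA _ bB.
have tr0 t x y := @potts_transition_ge0 beta t x y b0.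
have tr1 t x := @potts_transition_sum1 beta t x b0.
have mg t : measurable [set w | (t%:E < tau beta A b w)%E].
  exact: (measurable_hitting_time_gt HX).
pose f t := fine (P beta b [set w | (t%:E < tau beta A b w)%E]).
have fE t : (f t)%:E = P beta b [set w | (t%:E < tau beta A b w)%E].
  by rewrite fineK// fin_num_measure.
pose I := (\int[P beta b]_w tau beta A b w)%E.
have I_le : (I <= (g b)%:E)%E by exact: (mean_hitting_time_le HX tr0 bA gA g0 Lg).
have I_ge0 : (0 <= I)%E by apply: integral_ge0 => w _; exact: hitting_time_ge0.
have I_fin : I \is a fin_num by rewrite ge0_fin_numE// (le_lt_trans I_le)// ltry.
pose m := fine I; have mE : m%:E = I by rewrite fineK.
have m_le : m <= g b by rewrite -lee_fin mE.
have f_ge t : 0 <= t -> expR (- (kappa * t)) <= f t.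
  by move=> t0; rewrite -lee_fin fE; exact: (prob_hitting_time_gt HX tr0 tr1 bA (ltW k0) hA h1 hb Lh).
have f_noninc u v : 0 <= u -> u <= v -> f v <= f u.
  move=> _ uv; rewrite -lee_fin !fE; apply: le_measure; [exact/mem_set|exact/mem_set|].
  by move=> w /=; apply: le_lt_trans; rewrite lee_fin.
have f_sum (dt : R) (n : nat) : 0 < dt -> dt * \sum_(k < n) f (k.+1%:R * dt) <= m.
  move=> dt0; rewrite -lee_fin mE mulr_sumr -sumEFin.
  rewrite (le_trans _ (sum_prob_le_mean HX A n (ltW dt0)))//.
  by apply: lee_sum => k _; rewrite EFinM fE.
have mk := exponential_mean_ge k0 f_ge f_noninc f_sum.
have km1 : 1 <= kappa * m by rewrite -ler_pdivrMl// mulr1.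
have km2 : kappa * m <= 1 + N * expR (- beta).
  by rewrite (le_trans _ gk)// mulrC ler_wpM2r// ltW.
exists kappa, m; split=> //; split=> //.
- by move=> w; exact: hitting_time_ge0.
- exact: (measurable_hitting_time HX).
- by rewrite km1.
- by move=> t t0; rewrite -fE lee_fin f_ge.
- move=> eta t eta0 etat; rewrite -fE lee_fin.
  rewrite (le_trans (exponential_tail k0 f_ge f_noninc f_sum eta0 etat))// lerD2l.
  rewrite invfM mulrA ler_wpM2r ?invr_ge0 ?(ltW eta0)// ler_pdivlMr// mulrBl mulVf ?gt_eqF//.
  by rewrite lerBlDl mulrC.
(* The Markov inequality is the Riemann sum bound with a single cell. *)
- move=> t t0; rewrite -fE lee_fin ler_pdivlMr// mulrC.
  by have := f_sum t 1%N t0; rewrite big_ord1 mul1r.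
Qed.

Lemma metastable_mean (A : {set config}) (b : config) (eta : R) : metastable A b ->
  0 < eta -> \forall beta \near +oo, 0 < beta /\ exists kappa m : R,
    [/\ exponential_estimates (P beta b) (tau beta A b) kappa m (N * expR (- beta)),
      expR (beta * (G%:R - eta)) <= m <= expR (beta * (G%:R + eta)) &
      kappa <= N ^+ 2 * expR (- beta * G%:R)].
Proof.
move=> ms eta0; have N1 : 1 <= N := card_config_ge1 K L M q_ge2.
have N0 : 0 < N by rewrite (lt_le_trans _ N1).
have C0 : 0 < 2 * N ^+ 3 by rewrite mulr_gt0// exprn_gt0.
have C1 : 0 <= (1 + N) * (2 * N ^+ 3) by rewrite mulr_ge0 ?addr_ge0// ltW.
near=> beta.
have b0 : 0 < beta by near: beta; exact: nbhs_pinfty_gt.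
split=> //; have [kappa [m [est /andP[k1 k2]]]] := ms beta b0.
exists kappa, m; split=> //.
have c1 : N ^+ 2 * expR (- (beta * eta)) <= 1.
  by near: beta; apply: eventually_small => //; exact: sqr_ge0.
have c2 : (1 + N) * (2 * N ^+ 3) * expR (- (beta * eta)) <= 1.
  by near: beta; exact: eventually_small.
have k0 := est_rate est; have /andP[km1 km2] := est_mean_rate est.
have m0 := est_mean_gt0 est.
have e0 := expR_gt0 (beta * G%:R).
apply/andP; split.
  rewrite mulrBr expRD -(ler_pM2l k0) (le_trans _ km1)//.
  rewrite (le_trans _ c1)// mulrA ler_wpM2r ?expR_ge0//.
  by rewrite -ler_pdivlMr// -expRN -mulNr.
rewrite mulrDr expRD.
have mke : m * kappa <= 1 + N.
  rewrite mulrC (le_trans km2)// lerD2l ger_pMr// -expR0 ler_expR oppr_le0 ltW//.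
have h1 : m * (expR (- beta * G%:R) / (2 * N ^+ 3)) <= 1 + N.
  by rewrite (le_trans _ mke)// ler_wpM2l// ltW.
rewrite mulrA ler_pdivrMr// in h1.
have c2' : (1 + N) * (2 * N ^+ 3) <= expR (beta * eta).
  by move: c2; rewrite expRN ler_pdivrMr ?expR_gt0// mul1r.
rewrite [leRHS]mulrC (le_trans (y := (1 + N) * (2 * N ^+ 3) * expR (beta * G%:R)))//.
  by rewrite -ler_pdivrMr// -expRN -mulNr.
by rewrite ler_wpM2r// ltW.
Unshelve. all: by end_near. Qed.

Lemma mean_log_rate (A : {set config}) (b : config) : metastable A b ->
  (beta^-1%:E * lne (\int[P beta b]_w tau beta A b w))%E @[beta --> +oo] --> G%:R%:E.
Proof.
move=> ms; apply: cvge_squeeze => e e0.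
apply: filterS (metastable_mean ms e0) => beta [b0 [kappa [m [est /andP[lo up] _]]]].
rewrite (est_mean est) lne_EFin ?(est_mean_gt0 est)// -EFinM !lee_fin.
rewrite ler_pdivlMl// ler_pdivrMl//.
rewrite -[_ * (_ - e)]expRK -[_ * (_ + e)]expRK.
by rewrite !ler_ln ?posrE ?expR_gt0 ?(est_mean_gt0 est)// lo.
Qed.

Lemma normalised_law_cvg (A : {set config}) (b : config) : metastable A b ->
  cvg_in_distribution (fun beta => P beta b)
    (fun beta w => (tau beta A b w / \int[P beta b]_w tau beta A b w)%E)
    (exponential_prob 1).
Proof.
move=> ms t _; rewrite exponential_prob_le; apply: cvge_squeeze => e e0.
have N1 : 1 <= N := card_config_ge1 K L M q_ge2.
have N0 : 0 < N by rewrite (lt_le_trans _ N1).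
have [t0|t0] := leP 0 t; last first.
  near=> beta; have b0 : 0 < beta by near: beta; exact: nbhs_pinfty_gt.
  have [kappa [m [est _]]] := ms beta b0.
  by rewrite (est_mean est) (normalised_law_neg est)// sub0r add0r !lee_fin oppr_le0 !ltW.
pose delta := Num.min 2^-1 (e / 4).
have d0 : 0 < delta by rewrite lt_min invr_gt0 ltr0n divr_gt0.
have d1 : delta <= 2^-1 by rewrite ge_min lexx.
have d2 : 2 * delta <= e / 2.
  have : delta <= e / 4 by rewrite ge_min lexx orbT.
  lra.
near=> beta; have b0 : 0 < beta by near: beta; exact: nbhs_pinfty_gt.
have [kappa [m [est _]]] := ms beta b0.
rewrite (est_mean est).
have rho0 : 0 <= N * expR (- beta) by rewrite mulr_ge0 ?expR_ge0.
have /andP[lo up] := normalised_law est rho0 d0 d1 t0.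
have s1 : N / delta * expR (- (beta * 1)) <= e / 2.
  near: beta; apply: eventually_small; rewrite ?divr_gt0//.
  by rewrite divr_ge0// ltW.
have s2 : t * N * expR (- (beta * 1)) <= e.
  by near: beta; apply: eventually_small; rewrite ?mulr_ge0.
rewrite mulr1 in s1 s2.
rewrite (le_trans _ lo) ?(le_trans up)// lee_fin.
  by rewrite lerD2l mulrA.
rewrite lerD2l lerN2 mulrAC; lra.
Unshelve. all: by end_near. Qed.

(** The middle inequality holds on every path as A' is contained in A. The other two fail with small
    probability: kappa exp(beta (G - eps)) is small, and the mean of the hitting time of A' is at
    most exp(beta (G + eps / 2)), half of eps being left for the Markov inequality. *)
Lemma transition_time_cvg (A A' : {set config}) (b : config) (eps : R) :
  metastable A b -> metastable A' b -> (A' \subset A)%N -> 0 < eps ->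
  P beta b [set w |
    ((expR (beta * (G%:R - eps)))%:E < tau beta A b w
    /\ tau beta A b w <= tau beta A' b w
    /\ tau beta A' b w < (expR (beta * (G%:R + eps)))%:E)%E]
  @[beta --> +oo] --> 1%E.
Proof.
move=> ms ms' sub eps0; apply: cvge_squeeze => e e0.
have N1 : 1 <= N := card_config_ge1 K L M q_ge2.
have N0 : 0 < N by rewrite (lt_le_trans _ N1).
near=> beta.
have [b0 [kappa [m [est _ kub]]]] :
  0 < beta /\ exists kappa m : R,
    [/\ exponential_estimates (P beta b) (tau beta A b) kappa m (N * expR (- beta)),
      expR (beta * (G%:R - eps)) <= m <= expR (beta * (G%:R + eps)) &
      kappa <= N ^+ 2 * expR (- beta * G%:R)].
  by near: beta; exact: metastable_mean.
have [_ [kappa' [m' [est' /andP[_ m'up] _]]]] :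
  0 < beta /\ exists kappa m : R,
    [/\ exponential_estimates (P beta b) (tau beta A' b) kappa m (N * expR (- beta)),
      expR (beta * (G%:R - eps / 2)) <= m <= expR (beta * (G%:R + eps / 2)) &
      kappa <= N ^+ 2 * expR (- beta * G%:R)].
  by near: beta; apply: metastable_mean => //; rewrite divr_gt0.
set t1 := expR (beta * (G%:R - eps)); set t2 := expR (beta * (G%:R + eps)).
have t10 : 0 < t1 by exact: expR_gt0.
have t20 : 0 < t2 by exact: expR_gt0.
have s1 : N ^+ 2 * expR (- (beta * eps)) <= e / 2.
  by near: beta; apply: eventually_small; rewrite ?sqr_ge0 ?divr_gt0.
have s2 : 2 * expR (- (beta * (eps / 2))) <= e / 2.
  by near: beta; apply: eventually_small; rewrite ?divr_gt0.
have HX := hX b b0.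
have mA := measurable_hitting_time_le HX A t1.
have mA' : measurable [set w | (t2%:E <= tau beta A' b w)%E].
  have := emeasurable_fun_c_infty measurableT (est_measurable est') t2%:E.
  by rewrite setTI.
have PA : (P beta b [set w | (tau beta A b w <= t1%:E)%E] <= (e / 2)%:E)%E.
  rewrite (le_trans (est_le est (ltW t10)))// lee_fin (le_trans _ s1)//.
  rewrite (le_trans (ler_wpM2r (ltW t10) kub))// -mulrA -expRD.
  by rewrite ler_wpM2l ?sqr_ge0// ler_expR; lra.
have PA' : (P beta b [set w | (t2%:E <= tau beta A' b w)%E] <= (e / 2)%:E)%E.
  rewrite (le_trans (est_ge est' t20))// lee_fin (le_trans _ s2)//.
  rewrite -mulrA ler_wpM2l// ler_pdivrMr// -expRD (le_trans m'up)// ler_expR; lra.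
set E := [set w | _].
have EE : E = ~` ([set w | (tau beta A b w <= t1%:E)%E] `|` [set w | (t2%:E <= tau beta A' b w)%E]).
  rewrite setCU predeqE => w; split=> [[h1 [_ h2]]|[/= /negP h1 /negP h2]].
    by split; apply/negP; rewrite -ltNge.
  rewrite -ltNge in h1; rewrite -ltNge in h2; split=> //; split=> //.
  apply: ereal_inf_le_tmp => _ [u [u0 Xu] <-]; exists u => //; split=> //.
  by move/fintype.subsetP: sub; apply.
have mU := measurableU _ _ mA mA'.
have PU : (P beta b ([set w | (tau beta A b w <= t1%:E)%E] `|` [set w | (t2%:E <= tau beta A' b w)%E]) <= e%:E)%E.
  rewrite (le_trans (measureU2 _ mA mA'))// [e]splitr EFinD leeD//.
have Pf := fin_num_measure (P beta b) _ mU.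
rewrite EE probability_setC// -(fineK Pf) -EFinB !lee_fin.
rewrite -(fineK Pf) lee_fin in PU.
have := fine_ge0 (measure_ge0 (P beta b) ([set w | (tau beta A b w <= t1%:E)%E] `|` [set w | (t2%:E <= tau beta A' b w)%E])).
by move=> ?; apply/andP; split; lra.
Unshelve. all: by end_near. Qed.

End PottsHitting.

(** * Mixing time of the Potts dynamics *)

Section PottsMixing.
Context {R : realType} (bc : boundary) (K L M q : nat).
Local Notation site := (site K L M).
Local Notation config := (config K L M q).
Local Notation H := (@hamiltonian bc K L M q).
Local Notation r := (@metropolis_rate R bc K L M q).
Local Notation mu := (@gibbs R bc K L M q).
Local Notation ground := (ground_states K L M q).
Local Notation N := (#|config|%:R : R).
Context (d : measure_display) (Omega : R -> config -> measurableType d)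
  (P : forall (beta : R) (s : config), probability (Omega beta s) R)
  (X : forall (beta : R) (s : config), R -> Omega beta s -> config).
Arguments P : clear implicits.
Arguments X : clear implicits.
Hypothesis hX : forall (beta : R) (s : config), 0 < beta ->
  is_ctmc (P beta s) (X beta s) (r beta) s.
Variables (x0 : site) (q_ge2 : (2 <= q)%N) (G : nat).
Hypothesis ground_connect : forall s z, s \in ground -> z \in ground -> s != z ->
  connect (edge bc G.+1) s z /\ ~~ connect (edge bc G) s z.

Let law (beta : R) (s : config) (t : R) (z : config) : R :=
  fine (P beta s [set w | X beta s t w = z]).

Lemma law_transition beta s t : 0 < beta -> 0 <= t ->
  law beta s t = transition (r beta) t s.
Proof. by move=> b0 t0; apply/funext => z; rewrite /law (prob_at (hX s b0)). Qed.

Lemma mixed_eventually (eps eta : R) : 0 < eps -> 0 < eta ->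
  \forall beta \near +oo, \big[Num.max/0]_(s : config)
    tv_dist (law beta s (expR (beta * (G%:R + eta)))) (mu beta) <= eps.
Proof.
move=> e0 eta0; have N1 : 1 <= N := card_config_ge1 K L M q_ge2.
have N0 : 0 < N by rewrite (lt_le_trans _ N1).
(* Every configuration has mass at least exp(- beta h) / N, so the condition of [mixed_after]
   follows from 2 c t >= beta h + k0. *)
pose h : R := (\max_s H s)%:R; pose k0 := ln (N / eps ^+ 2).
have Ne0 : 0 < N / eps ^+ 2 by rewrite divr_gt0// exprn_gt0.
near=> beta.
have b0 : 0 < beta by near: beta; exact: nbhs_pinfty_gt.
have b1 : 1 <= beta by near: beta; exact: nbhs_pinfty_ge.
(* Here 2 c t = 2 exp(beta eta) / N^4 is at least (beta eta)^2 / N^4, and this quadratic bound beats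
   the linear beta h + k0 from this threshold on. *)
have b2 : (h + `|k0|) * N ^+ 4 / eta ^+ 2 <= beta.
  by near: beta; apply: nbhs_pinfty_ge; exact: num_real.
set t := expR (beta * (G%:R + eta)); have t0 : 0 <= t by exact: expR_ge0.
rewrite (eq_bigr (fun s => tv_dist (transition (r beta) t s) (mu beta))); last first.
  by move=> s _; rewrite law_transition.
pose c := expR (- beta * G%:R) / N ^+ 4.
have c0 : 0 <= c by rewrite divr_ge0 ?expR_ge0// exprn_ge0.
apply: (@mixed_after _ _ (r beta) (mu beta) _ _ _ _ _ _ _ c) => //.
- by move=> *; exact: metropolis_rate_ge0.
- by move=> s; exact: gibbs_gt0.
- by move=> *; exact: metropolis_reversible.
- exact: gibbs_sum1.
- by move=> *; exact: (potts_transition_ge0 hX).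
- by move=> *; exact: (potts_transition_sum1 hX).
- by move=> *; exact: (potts_chapman_kolmogorov hX).
- exact: ltW.
- by move=> f; exact: (poincare_inequality b0 x0 q_ge2 ground_connect).
move=> s.
have muge : expR (- (beta * h)) / N <= mu beta s.
  rewrite gibbsE ler_pM ?expR_ge0 ?invr_ge0//.
    by rewrite ler_expR mulNr lerN2 ler_pM2l// ler_nat leq_bigmax.
  by rewrite lef_pV2 ?posrE ?partition_function_gt0// partition_function_le.
rewrite (le_trans (y := eps ^+ 2 * (expR (- (beta * h)) / N)))//; last first.
  by rewrite ler_wpM2l ?sqr_ge0.
have -> : eps ^+ 2 * (expR (- (beta * h)) / N) = expR (- (beta * h + k0)).
  rewrite opprD expRD [in RHS]expRN (expRN k0) lnK ?posrE// expRN.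
  by field; rewrite !gt_eqF ?expR_gt0.
rewrite ler_expR lerN2.
have -> : 2 * c * t = 2 * expR (beta * eta) / N ^+ 4.
  rewrite /c /t mulrDr expRD mulNr expRN; field.
  by rewrite !gt_eqF ?expR_gt0.
have be0 : 0 <= beta * eta by rewrite mulr_ge0 ?ltW.
have := expR_ge1Dxn 1 be0; rewrite (_ : 2`!%:R = 2)// => ex.
have N4 : 0 < N ^+ 4 by rewrite exprn_gt0.
have eta2 : 0 < eta ^+ 2 by rewrite exprn_gt0.
rewrite ler_pdivlMr//; apply: (@le_trans _ _ ((beta * eta) ^+ 2)); last by lra.
rewrite ler_pdivrMr// in b2.
have k0n : k0 <= beta * `|k0| by rewrite (le_trans (ler_norm _))// ler_peMl.
have := ler_wpM2l (ltW b0) b2.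
have := ler_wpM2r (ltW N4) k0n.
by rewrite exprMn expr2; lra.
Unshelve. all: by end_near. Qed.

Variables (s : config) (A : {set config}).
Hypotheses (sg : s \in ground) (A_def : A = other_ground_states s) (A0 : exists a, a \in A).
Hypothesis ms : metastable P X G A s.

(** [A] contains a ground state of the same mass as [s], and only N exp(- beta) is left outside: [A]
    has mass almost 1/2, whence the range of eps in the mixing time. *)
Lemma gibbs_others_ge beta : 0 < beta ->
  1 - N * expR (- beta) <= 2 * \sum_(a in A) mu beta a.
Proof.
move=> b0; have [a aA] := A0.
have ag : a \in ground by move: aA; rewrite A_def !inE => /andP[].
have muA : mu beta s <= \sum_(a in A) mu beta a.
  rewrite (gibbs_ground bc beta sg) -(gibbs_ground bc beta ag) (bigD1 a)//= lerDl.
  by rewrite sumr_ge0// => z _; rewrite ltW// gibbs_gt0.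
have e0 : 0 <= expR (- beta) := expR_ge0 _.
have : 1 <= \sum_(a in A) mu beta a + mu beta s + N * expR (- beta); last by lra.
have mu1 : \sum_z mu beta z = 1 by exact: gibbs_sum1.
rewrite -[leLHS]mu1 (bigID (fun z => z \in A))/= -addrA lerD2l.
rewrite (bigD1 s)/=; last by rewrite A_def !inE eqxx.
rewrite lerD2l (le_trans (y := \sum_(z : config) expR (- beta)))//.
  rewrite big_mkcond; apply: ler_sum => z _; case: ifPn => // /andP[zA zs].
  have zg : z \notin ground by move: zA; rewrite A_def !inE zs.
  rewrite (le_trans (gibbs_not_ground bc b0 x0 q_ge2 zg))//.
  by rewrite ler_pdivrMr ?partition_function_gt0// ler_peMr// partition_function_ge1.
by rewrite sumr_const -[leLHS]mulr_natl.
Qed.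

Lemma not_mixed_before (eps eta : R) : 0 < eps < 1 / 2 -> 0 < eta ->
  \forall beta \near +oo, forall t, 0 <= t ->
    \big[Num.max/0]_(x : config) tv_dist (law beta x t) (mu beta) <= eps ->
    expR (beta * (G%:R - eta)) <= t.
Proof.
move=> /andP[e0 e2] eta0; have N1 : 1 <= N := card_config_ge1 K L M q_ge2.
have N0 : 0 < N by rewrite (lt_le_trans _ N1).
(* The estimates lose delta / 2 in the mass of [A] and delta in the law at time t, less in total
   than 1/2 - eps = 2 delta. *)
pose delta := (1 / 2 - eps) / 2; have d0 : 0 < delta by rewrite divr_gt0// subr_gt0.
near=> beta.
have b0 : 0 < beta by near: beta; exact: nbhs_pinfty_gt.
have s1 : N * expR (- (beta * 1)) <= delta by near: beta; exact: eventually_small.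
have s2 : N ^+ 2 * expR (- (beta * eta)) <= delta.
  by near: beta; apply: eventually_small; rewrite ?sqr_ge0.
rewrite mulr1 in s1.
move=> t t0 mix; rewrite leNgt; apply/negP => tlt.
have [kappa [m [est /andP[_ kub]]]] := ms b0.
have HX := hX s b0.
have : tv_dist (law beta s t) (mu beta) <= eps.
  by apply: le_trans mix; exact: (le_bigmax _ (fun x => tv_dist (law beta x t) (mu beta)) s).
have : `|\sum_(a in A) law beta s t a - \sum_(a in A) mu beta a| <= tv_dist (law beta s t) (mu beta).
  exact: (le_bigmax _ (fun A : {set config} => `|\sum_(a in A) law beta s t a - \sum_(a in A) mu beta a|) A).
have : \sum_(a in A) law beta s t a <= delta.
  rewrite law_transition// -lee_fin -(prob_at_in HX (mem A) t0).
  rewrite (@le_trans _ _ (P beta s [set w | (hitting_time (X beta s) A w <= t%:E)%E]))//.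
    apply: le_measure; [apply/mem_set|exact/mem_set/(measurable_hitting_time_le HX)|].
      exact: (measurable_at_in HX).
    by move=> w /= Xw; apply: ereal_inf_lbound; exists t.
  rewrite (le_trans (est_le est t0))// lee_fin (le_trans _ s2)//.
  rewrite (le_trans (ler_wpM2l (ltW (est_rate est)) (ltW tlt)))//.
  rewrite (le_trans (ler_wpM2r (expR_ge0 _) kub))// -mulrA -expRD.
  by rewrite ler_wpM2l ?sqr_ge0// ler_expR; lra.
have := gibbs_others_ge b0.
have := ler_norm (\sum_(a in A) mu beta a - \sum_(a in A) law beta s t a); rewrite distrC.
rewrite /delta in s1 s2 *; lra.
Unshelve. all: by end_near. Qed.

Lemma mixing_time_rate (eps : R) : 0 < eps < 1 / 2 ->
  beta^-1 * ln (mixing_time (law beta) (mu beta) eps) @[beta --> +oo] --> (G%:R : R).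
Proof.
move=> e01; have e0 : 0 < eps by case/andP: e01.
apply: ln_rate_cvg => eta eta0; near=> beta.
have up : \big[Num.max/0]_(s : config)
    tv_dist (law beta s (expR (beta * (G%:R + eta)))) (mu beta) <= eps.
  by near: beta; exact: mixed_eventually.
have lo : forall t, 0 <= t ->
    \big[Num.max/0]_(x : config) tv_dist (law beta x t) (mu beta) <= eps ->
    expR (beta * (G%:R - eta)) <= t.
  by near: beta; exact: not_mixed_before.
apply/andP; split.
  apply: lb_le_inf; first by exists (expR (beta * (G%:R + eta))); split=> //; exact: expR_ge0.
  by move=> t [t0 mix]; exact: lo.
apply: ge_inf; first by exists 0 => t [].
by split=> //; exact: expR_ge0.
Unshelve. all: by end_near. Qed.

End PottsMixing.

(** * Spin permutations acting on the ground states *)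

Section GroundStates.
Context (bc : boundary) (K L M q : nat).
Local Notation config := (config K L M q).
Local Notation ground := (ground_states K L M q).

Lemma recolor_ground (p : {perm 'I_q}) (s : config) : (recolor p s \in ground) = (s \in ground).
Proof.
apply/imsetP/imsetP => [[a _ e]|[a _ ->]]; last first.
  by exists (p a) => //; rewrite recolor_monochromatic.
exists ((p^-1)%g a) => //; apply: (bij_inj (@recolor_bij K L M q p)).
by rewrite recolor_monochromatic permKV.
Qed.

(** Gamma is given by one pair of ground states; some spin permutation carries this pair to any
    other, and recolouring preserves energies. *)
Lemma ground_connect_all (G : nat) (g g' : config) :
  g \in ground -> g' \in ground -> g != g' ->
  connect (edge bc G.+1) g g' -> ~~ connect (edge bc G) g g' ->
  forall s s', s \in ground -> s' \in ground -> s != s' ->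
  connect (edge bc G.+1) s s' /\ ~~ connect (edge bc G) s s'.
Proof.
move=> /imsetP[a _ ->] /imsetP[a' _ ->] ne c1 c2 s s' /imsetP[b _ ->] /imsetP[b' _ ->] ne'.
have aa' : a != a' by apply: contra_neq ne => ->.
have bb' : b != b' by apply: contra_neq ne' => ->.
split.
  have [p [pa pa']] := perm_pair aa' bb'.
  by have := connect_edge_recolor p c1; rewrite !recolor_monochromatic pa pa'.
apply: contra c2 => c2; have [p [pb pb']] := perm_pair bb' aa'.
by have := connect_edge_recolor p c2; rewrite !recolor_monochromatic pb pb'.
Qed.

Lemma recolor_swap (s s' z : config) : s \in ground -> s' \in ground -> z \in ground ->
  s != z -> s' != z ->
  exists p : {perm 'I_q}, recolor p s = s' /\ recolor p z = z.
Proof.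
move=> /imsetP[a _ ->] /imsetP[a' _ ->] /imsetP[b _ ->] ab a'b.
exists (tperm a a'); rewrite !recolor_monochromatic tpermL tpermD//.
  by apply: contra_neq ab => ->.
by apply: contra_neq a'b => ->.
Qed.

End GroundStates.

Theorem theorem2p7 (R : realType) (bc : boundary) (q K L M : nat)
  (hq : (2 <= q)%N) (hK : (2829 <= K)%N) (hKL : (K <= L)%N) (hLM : (L <= M)%N)
  (* the process started at s at inverse temperature beta lives on
     (Omega beta s, P beta s) *)
  (d : measure_display)
  (Omega : R -> config K L M q -> measurableType d)
  (P : forall (beta : R) (s : config K L M q), probability (Omega beta s) R)
  (X : forall (beta : R) (s : config K L M q),
     R -> Omega beta s -> config K L M q)
  (hX : forall (beta : R) (s : config K L M q), 0 < beta ->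
     is_ctmc (P beta s) (X beta s) (metropolis_rate bc beta) s)
  (* Gamma is the communication height between any two distinct ground states *)
  (g g' : config K L M q)
  (hg : g \in ground_states K L M q) (hg' : g' \in ground_states K L M q)
  (hgg' : g != g') :
  let Gamma : R := communication_height bc g g' in
  let tau (A : {set config K L M q}) (s : config K L M q) (beta : R)
      : Omega beta s -> \bar R := hitting_time (X beta s) A in
  let mean_tau (A : {set config K L M q}) (s : config K L M q) (beta : R)
      : \bar R := (\int[P beta s]_w tau A s beta w)%E in
  let law (beta : R) (s : config K L M q) (t : R) (z : config K L M q) : R :=
    fine (P beta s [set w | X beta s t w = z]) in
  let tmix (beta eps : R) : R :=
    mixing_time (law beta) (gibbs bc beta) eps in
  [/\ forall s s' : config K L M q,
        s \in ground_states K L M q -> s' \in ground_states K L M q ->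
        s != s' ->
        [/\ forall eps : R, 0 < eps ->
              P beta s [set w |
                ((expR (beta * (Gamma - eps)))%:E
                   < tau (other_ground_states s) s beta w
                /\ tau (other_ground_states s) s beta w <= tau [set s']%SET s beta w
                /\ tau [set s']%SET s beta w
                   < (expR (beta * (Gamma + eps)))%:E)%E]
                @[beta --> +oo] --> 1%E,
            (beta^-1%:E * lne (mean_tau (other_ground_states s) s beta))%E
              @[beta --> +oo] --> Gamma%:E,
            (beta^-1%:E * lne (mean_tau [set s']%SET s beta))%E
              @[beta --> +oo] --> Gamma%:E,
            cvg_in_distribution (fun beta => P beta s)
              (fun beta w => (tau (other_ground_states s) s beta w
                              / mean_tau (other_ground_states s) s beta)%E)
              (exponential_prob 1)
          & cvg_in_distribution (fun beta => P beta s)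
              (fun beta w => (tau [set s']%SET s beta w
                              / mean_tau [set s']%SET s beta)%E)
              (exponential_prob 1)],
      forall eps : R, 0 < eps < 1 / 2 ->
        beta^-1 * ln (tmix beta eps) @[beta --> +oo] --> Gamma
    & exists c1 c2 : R, [/\ 0 < c1, c1 <= c2 & forall beta : R, 0 < beta ->
        c1 * expR (- beta * Gamma) <= spectral_gap (@metropolis_rate R bc K L M q beta)
          <= c2 * expR (- beta * Gamma)]].

Proof.
have K0 : (0 < K)%N by exact: leq_trans hK.
have L0 : (0 < L)%N by exact: leq_trans hKL.
have M0 : (0 < M)%N by exact: leq_trans hLM.
pose x0 : site K L M := (Ordinal K0, Ordinal L0, Ordinal M0).
have [G [GE c1 c2]] := communication_heightP bc R hgg'.
have gc := ground_connect_all hg hg' hgg' c1 c2.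
move=> Gamma tau mean_tau law tmix.
have -> : Gamma = G%:R by [].
have others s s' : s \in ground_states K L M q -> s' \in ground_states K L M q ->
    s != s' -> metastable P X G (other_ground_states s) s.
  move=> sg s'g ss'.
  (* [B] is the starting point alone, so the identity provides the symmetry. *)
  apply: (metastable_targets hX x0 hq gc (a := s') (B := [set s]%SET)).
  - by rewrite !inE eq_sym ss'.
  - by rewrite inE.
  - by move=> z; rewrite !inE; case: eqVneq => [->|_]; rewrite ?sg ?orbF.
  - by move=> z; rewrite !inE => /eqP ->; rewrite eqxx.
  - move=> b' /set1P ->; exists 1%g; have r1 z : recolor 1%g z = z :> config K L M q.
      by apply/ffunP => x; rewrite ffunE perm1.
    by split=> [z|z|]; rewrite r1.
have single s s' : s \in ground_states K L M q -> s' \in ground_states K L M q ->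
    s != s' -> metastable P X G [set s']%SET s.
  move=> sg s'g ss'.
  (* [B] is all ground states but [s']; the transpositions of spins that fix [s'] carry [s] to any
     of its points. *)
  apply: (metastable_targets hX x0 hq gc (a := s') (B := other_ground_states s')).
  - by rewrite inE.
  - by rewrite !inE ss'.
  - by move=> z; rewrite !inE; case: eqVneq => [->|_].
  - by move=> z; rewrite !inE => /andP[].
  - move=> b'; rewrite !inE => /andP[b's' b'g].
    have [p [ps ps']] := recolor_swap sg b'g s'g ss' b's'.
    have pz z : (recolor p z == s') = (z == s').
      by rewrite -[X in _ == X]ps' (inj_eq (bij_inj (@recolor_bij K L M q p))).
    exists p; split=> // z; rewrite !inE; first exact: pz.
    by rewrite recolor_ground pz.
split.
- move=> s s' sg s'g ss'.
  have ms := others s s' sg s'g ss'; have ms' := single s s' sg s'g ss'.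
  split.
  + move=> eps e0; apply: (transition_time_cvg hX hq ms ms' _ e0).
    by apply/fintype.subsetP => z; rewrite !inE => /eqP ->; rewrite eq_sym ss' s'g.
  + exact: (mean_log_rate hq ms).
  + exact: (mean_log_rate hq ms').
  + exact: (normalised_law_cvg hq ms).
  + exact: (normalised_law_cvg hq ms').
- move=> eps e01.
  apply: (mixing_time_rate hX x0 hq gc hg erefl _ (others g g' hg hg' hgg')) => //.
  by exists g'; rewrite !inE eq_sym hgg'.
- have N1 : 1 <= #|config K L M q|%:R :> R := card_config_ge1 K L M hq.
  have N0 : 0 < #|config K L M q|%:R :> R by rewrite (lt_le_trans _ N1).
  exists (#|config K L M q|%:R ^- 4), (#|config K L M q|%:R ^+ 3); split.
  + by rewrite invr_gt0 exprn_gt0.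
  + by rewrite (le_trans (y := 1)) ?exprn_ege1// invf_le1 ?exprn_gt0// exprn_ege1.
  + move=> beta b0; have := spectral_gap_potts b0 x0 hq gc.
    by rewrite [_ ^- 4 * _]mulrC.
Qed.
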